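(* Let $\lambda>0$, $p>2$, $\varphi_0\in H^1(\mathbb{R}^2)$, and let $\varphi\in C([0,T);H^1(\mathbb{R}^2))$ be the maximal solution of the Cauchy problem of the time-dependent Chern–Simons–Schrödinger system with $\varphi(0)=\varphi_0$. If either (a) $2<p<4$, or (b) $p=4$ and $\|\varphi_0\|_2$ is sufficiently small, or (c) $p>4$ and $\varphi_0\in\mathcal O_c:=\{u\in S(c):E(u)<\gamma(c),\ Q(u)>0\}$ for some $c>0$, then $T=\infty$.
   Context: All functions are complex-valued. $G_j(x)=-\frac{1}{2\pi}\frac{x_j}{|x|^2}$; $A_1(u)=-\frac12G_2*|u|^2$, $A_2(u)=\frac12G_1*|u|^2$, $D_j=\partial_j+iA_j$; $E(u)=\frac12\int(|D_1u|^2+|D_2u|^2)-\frac{\lambda}{p}\int|u|^p$; $S(c)=\{u\in H^1:\|u\|_2^2=c\}$; $Q(u)=\int(|D_1u|^2+|D_2u|^2)-\frac{\lambda(p-2)}{p}\int|u|^p$; $\mathcal M(c)=\{u\in S(c):Q(u)=0\}$; $\gamma(c)=\inf_{\mathcal M(c)}E$. The time-dependent system: $iD_t\varphi+(D_1D_1+D_2D_2)\varphi=-\lambda|\varphi|^{p-2}\varphi$, $\partial_tA_1-\partial_1A_0=-\mathrm{Im}(\bar\varphi D_2\varphi)$, $\partial_tA_2-\partial_2A_0=\mathrm{Im}(\bar\varphi D_1\varphi)$, $\partial_1A_2-\partial_2A_1=-\frac12|\varphi|^2$, $D_t=\partial_t+iA_0$, with Coulomb gauge $\partial_1A_1+\partial_2A_2=0$.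 Standing fact used (local theory): for $\varphi_0\in H^1$ there is a unique maximal solution $\varphi\in C([0,T);H^1)$ conserving $\|\varphi(t)\|_2$ and $E(\varphi(t))$, and either $T=\infty$ or $\|D_1\varphi(t)\|_2+\|D_2\varphi(t)\|_2\to\infty$ as $t\to T^-$. *)

(* Defs.v *)
From HB Require Import structures.
From mathcomp Require Import all_boot all_order all_algebra.
From mathcomp Require Import all_classical all_reals all_analysis.
From Stdlib Require Import ClassicalEpsilon.
Set Implicit Arguments. Unset Strict Implicit. Unset Printing Implicit Defensive.
Import Order.TTheory GRing.Theory Num.Theory.
Import numFieldNormedType.Exports.
Local Open Scope classical_set_scope.
Local Open Scope ring_scope.

(* Points of R^2 are pairs (x1, x2) : R * R.
   Complex values z are encoded as pairs (Re z, Im z) : R * R. *)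
Definition cfun (R : realType) := (R * R -> R * R)%type.

Section CSS.
Variable R : realType.

Definition leb2 := ((@lebesgue_measure R) \x (@lebesgue_measure R))%E.

Definition int2 (f : R * R -> R) : \bar R := (\int[leb2]_x EFin (f x))%E.

Definition L2 (f : R * R -> R) : Prop :=
  measurable_fun setT f /\ (int2 (fun x => f x ^+ 2) < +oo%E)%O.

Definition pd (e : R * R) (psi : R * R -> R) (x : R * R) : R :=
  derive1 (fun s : R => psi (x.1 + s * e.1, x.2 + s * e.2)) 0.

Definition pd_exists (e : R * R) (psi : R * R -> R) (x : R * R) : Prop :=
  derivable (fun s : R => psi (x.1 + s * e.1, x.2 + s * e.2)) 0 1.

Definition e1 : R * R := (1, 0).
Definition e2 : R * R := (0, 1).

Definition testfun (psi : R * R -> R) : Prop :=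
  (forall x, pd_exists e1 psi x /\ pd_exists e2 psi x) /\
  continuous psi /\ continuous (pd e1 psi) /\ continuous (pd e2 psi) /\
  exists r : R, forall x : R * R, r < `|x.1| + `|x.2| -> psi x = 0.

Definition weak_deriv (e : R * R) (f g : R * R -> R) : Prop :=
  forall psi, testfun psi ->
    (\int[leb2]_x EFin (f x * pd e psi x)%R = - \int[leb2]_x EFin (g x * psi x)%R)%E.

Definition H1r (f : R * R -> R) : Prop :=
  L2 f /\ (exists g, weak_deriv e1 f g /\ L2 g) /\ (exists g, weak_deriv e2 f g /\ L2 g).

(* the (a.e. unique) weak derivative, chosen *)
Definition wd (e : R * R) (f : R * R -> R) : R * R -> R :=
  epsilon (inhabits (fun _ => 0)) (fun g => weak_deriv e f g /\ L2 g).

Definition H1 (u : cfun R) : Prop := H1r (fun x => (u x).1) /\ H1r (fun x => (u x).2).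

Definition re (u : cfun R) : R * R -> R := fun x => (u x).1.
Definition im (u : cfun R) : R * R -> R := fun x => (u x).2.

Definition abs2 (u : cfun R) : R * R -> R := fun x => (u x).1 ^+ 2 + (u x).2 ^+ 2.

Definition mass (u : cfun R) : R := fine (int2 (abs2 u)).

Definition G1 (z : R * R) : R := - (z.1 / (2 * pi * (z.1 ^+ 2 + z.2 ^+ 2))).
Definition G2 (z : R * R) : R := - (z.2 / (2 * pi * (z.1 ^+ 2 + z.2 ^+ 2))).

Definition conv (K f : R * R -> R) (x : R * R) : R :=
  fine (\int[leb2]_y EFin (K (x.1 - y.1, x.2 - y.2) * f y)%R)%E.

Definition A1 (u : cfun R) : R * R -> R := fun x => - (1/2) * conv G2 (abs2 u) x.
Definition A2 (u : cfun R) : R * R -> R := fun x =>   (1/2) * conv G1 (abs2 u) x.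

(* D_j u = d_j u + i A_j u *)
Definition Dj (e : R * R) (A : cfun R -> R * R -> R) (u : cfun R) : cfun R :=
  fun x => (wd e (re u) x - A u x * im u x, wd e (im u) x + A u x * re u x).

Definition D1 (u : cfun R) : cfun R := Dj e1 A1 u.
Definition D2 (u : cfun R) : cfun R := Dj e2 A2 u.

Definition kin (u : cfun R) : R := fine (int2 (fun x => abs2 (D1 u) x + abs2 (D2 u) x)).

Definition Lp (p : R) (u : cfun R) : R := fine (int2 (fun x => Num.sqrt (abs2 u x) `^ p)).

Definition energy (lam p : R) (u : cfun R) : R := kin u / 2 - lam / p * Lp p u.

Definition Qf (lam p : R) (u : cfun R) : R := kin u - lam * (p - 2) / p * Lp p u.

Definition Sc (c : R) : set (cfun R) := [set u | H1 u /\ mass u = c].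

Definition Mc (lam p c : R) : set (cfun R) := [set u | Sc c u /\ Qf lam p u = 0].

Definition gammac (lam p c : R) : \bar R :=
  ereal_inf [set (energy lam p u)%:E | u in Mc lam p c].

Definition Oc (lam p c : R) : set (cfun R) :=
  [set u | Sc c u /\ ((energy lam p u)%:E < gammac lam p c)%E /\ 0 < Qf lam p u].

Definition Dnorm (u : cfun R) : R :=
  Num.sqrt (fine (int2 (abs2 (D1 u)))) + Num.sqrt (fine (int2 (abs2 (D2 u)))).

Definition csub (u v : cfun R) : cfun R := fun x => ((u x).1 - (v x).1, (u x).2 - (v x).2).

Definition H1norm2 (w : cfun R) : R :=
  fine (int2 (fun x => abs2 w x + wd e1 (re w) x ^+ 2 + wd e2 (re w) x ^+ 2
                         + wd e1 (im w) x ^+ 2 + wd e2 (im w) x ^+ 2)).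

Definition cont_H1 (phi : R -> cfun R) (T : \bar R) : Prop :=
  forall t, 0 <= t -> (t%:E < T)%E ->
    forall eps, 0 < eps -> exists2 delta, 0 < delta &
      forall s, 0 <= s -> (s%:E < T)%E -> `|s - t| < delta ->
        H1norm2 (csub (phi s) (phi t)) < eps.

End CSS.

(* Main.v *)
Require Import Defs.
From HB Require Import structures.
From mathcomp Require Import all_boot all_order all_algebra.
From mathcomp Require Import all_classical all_reals all_analysis.
From mathcomp Require Import measurable_realfun.
From mathcomp Require Import ring lra.
Import Order.TTheory GRing.Theory Num.Theory.
Import numFieldNormedType.Exports.
Local Open Scope classical_set_scope.
Local Open Scope ring_scope.
Set Implicit Arguments. Unset Strict Implicit.

(* Blow-up means that kin = ||D_1 u||^2 + ||D_2 u||^2 diverges, and E bounds kin as soon as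
   (2 lam / p) ||u||_p^p is absorbed by kin up to a constant. The gradient of |u|^2 is
   2 Re(conj u D_j u), since the potentials cancel, so the Ladyzhenskaya inequality gives
   ||u||_4^4 <= 4 ||u||_2^2 (kin + 1): this settles p = 4 with small mass, and p < 4 after
   |u|^p <= eps |u|^4 + C |u|^2. For p > 4, Q cannot vanish along the flow, because a zero of
   Q would lie in M(c) with energy below gamma(c); hence Q stays positive, which gives
   kin <= 2 (p - 2) / (p - 4) E. Here Q = 2 E - lam (p - 4) / p ||u||_p^p, so that by
   conservation of energy only the continuity of the L^p norm along the flow is needed.
   All this presupposes kin < oo on H^1, i.e. that the potentials A_j are bounded.
   Gagliardo-Nirenberg bounds come from the primitives of almost every slice: a weak
   derivative tested on tensor products is a weak derivative on almost every line. *)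

(** * One-dimensional tools *)

(** The kernel G_j is of size 1/|x|, whose square is not locally integrable in the plane, so an L^2
    bound on |u|^2 does not control A_j, whereas an L^3 bound, that is the L^6 norm of u, does. The
    Gagliardo argument is therefore iterated over all even exponents, which also makes every L^p
    norm with p >= 2 finite. Polar coordinates are avoided: the singular part of the convolution is
    dominated by |y_1|^(-3/4) |y_2|^(-3/4), locally integrable in each variable separately. H^1
    functions are never approximated by smooth ones. On almost every line they are replaced by a
    locally absolutely continuous representative, whose product rule is Fubini on the two sides of a
    diagonal, and decay at infinity is replaced by the existence of points where the representative
    is small. *)

Section steps.
Context {R : realType}.
Implicit Types (x e a b : R).

(** Suited to functions given by cases: at a kink of the derivative, such as 0 for [pos_sq], a
    single inequality covers both sides. *)
Lemma is_derive_quadratic (f : R -> R) (x l C : R) :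
  (forall h, `|f (x + h) - f x - l * h| <= C * h ^+ 2) -> is_derive x 1 f l.
Proof.
move=> fC.
have C0 : 0 <= C by have := le_trans (normr_ge0 _) (fC 1); rewrite expr1n mulr1.
have cv : h^-1 *: (f (h *: 1 + x) - f x) @[h --> 0^'] --> l.
  apply/cvgrPdist_le => /= eps eps0; near=> h.
  have h0 : h != 0 by near: h; exact: nbhs_dnbhs_neq.
  have hd : `|h| <= eps / (C + 1).
    near: h; apply: dnbhs0_le; rewrite divr_gt0 ?ltr_wpDl//.
  have -> : h *: (1 : R) = h by rewrite /GRing.scale/= mulr1.
  rewrite /GRing.scale/= (addrC h) distrC -(mulKf h0 l) -mulrBr normrM normfV.
  rewrite ler_pdivrMl ?normr_gt0// (mulrC h l).
  apply: (le_trans (fC h)).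
  rewrite -normr_id -[h ^+ 2]ger0_norm ?sqr_ge0// normrX expr2 mulrA mulrAC mulrC normr_id.
  rewrite ler_wpM2l// (le_trans (_ : _ <= (C + 1) * `|h|)) ?ler_wpM2r ?lerDl//.
  by rewrite mulrC -ler_pdivlMr ?ltr_wpDl.
apply: DeriveDef; first by apply/cvg_ex; exists l.
exact: cvg_lim cv.
Unshelve. all: by end_near. Qed.

Definition pos_sq x : R := Num.max 0 x ^+ 2.

Lemma is_derive_pos_sq x : is_derive x 1 pos_sq (2 * Num.max 0 x).
Proof.
apply: (@is_derive_quadratic _ _ _ 1) => h; rewrite mul1r /pos_sq.
rewrite ler_norml; apply/andP.
by case: (leP 0 (x + h)) => ?; case: (leP 0 x) => ?; split; nra.
Qed.

(* A C^1 smoothing of the Heaviside function, obtained as a second difference of x_+^2;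
   its derivative hat is an approximate identity. *)
Definition step e x : R :=
  (pos_sq x - 2 * pos_sq (x - e) + pos_sq (x - 2 * e)) / (2 * e ^+ 2).
Definition hat e x : R :=
  (Num.max 0 x - 2 * Num.max 0 (x - e) + Num.max 0 (x - 2 * e)) / e ^+ 2.

Lemma is_derive_subr (f : R -> R) (x a l : R) :
  is_derive (x - a) 1 f l -> is_derive x 1 (fun t => f (t - a)) l.
Proof.
move=> df; have := @is_derive1_comp _ f (fun t => t - a) x l 1.
rewrite mulr1; apply => //; rewrite -[X in is_derive _ _ _ X]subr0.
by apply: is_deriveB.
Qed.

Lemma is_derive_step e x : 0 < e -> is_derive x 1 (step e) (hat e x).
Proof.
move=> e0.
have d0 := is_derive_pos_sq x.
have d1 := is_derive_subr (is_derive_pos_sq (x - e)).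
have d2 := @is_derive_subr pos_sq x (2 * e) _ (is_derive_pos_sq (x - 2 * e)).
have -> : step e = (fun t => (2 * e ^+ 2)^-1 *:
   (pos_sq t - 2 *: pos_sq (t - e) + pos_sq (t - 2 * e))).
  by apply/funext => t; rewrite /step /GRing.scale/= mulrC.
have -> : hat e x = (2 * e ^+ 2)^-1 *: ((2 * Num.max 0 x) -
    2 *: (2 * Num.max 0 (x - e)) + 2 * Num.max 0 (x - 2 * e)).
  rewrite /hat /GRing.scale/=; field; lra.
apply: is_deriveZ.
Qed.

Lemma continuous_hat e : continuous (hat e).
Proof.
have cm a : continuous (fun x : R => Num.max 0 (x - a)).
  move=> x; apply: (@continuous_max _ _ (cst 0) (fun x => x - a)).
    exact: cvg_cst.
  by apply: cvgB; [exact: cvg_id|exact: cvg_cst].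
have -> : hat e = (fun x => (Num.max 0 (x - 0) - 2 * Num.max 0 (x - e) +
   Num.max 0 (x - 2 * e)) / e ^+ 2) by apply/funext => x; rewrite subr0.
move=> x; apply: cvgM; last exact: cvg_cst.
apply: cvgD; last exact: cm.
apply: cvgB; first exact: cm.
by apply: cvgM; [exact: cvg_cst|exact: cm].
Qed.

Lemma step_le0 e x : 0 < e -> x <= 0 -> step e x = 0.
Proof.
move=> e0 x0; rewrite /step /pos_sq.
by rewrite !max_l; [rewrite expr0n/= mulr0 subr0 addr0 mul0r|lra..].
Qed.

(** The second difference of t^2 with increment e is the constant 2 e^2, whence the normalisation of
    [step]. *)
Lemma step_ge e x : 0 < e -> 2 * e <= x -> step e x = 1.
Proof.
move=> e0 x0; rewrite /step /pos_sq !max_r; [|lra..].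
by field; lra.
Qed.

Lemma step_ge0 e x : 0 < e -> 0 <= step e x.
Proof.
move=> e0; rewrite /step; apply: divr_ge0; last nra.
rewrite /pos_sq; case: (leP 0 x) => ?; case: (leP 0 (x - e)) => ?;
  case: (leP 0 (x - 2 * e)) => ?; nra.
Qed.

Lemma step_le1 e x : 0 < e -> step e x <= 1.
Proof.
move=> e0; rewrite /step ler_pdivrMr ?mul1r; last nra.
rewrite /pos_sq; case: (leP 0 x) => ?; case: (leP 0 (x - e)) => ?;
  case: (leP 0 (x - 2 * e)) => ?; nra.
Qed.

Lemma hat_le0 e x : 0 < e -> x <= 0 -> hat e x = 0.
Proof.
move=> e0 x0; rewrite /hat.
by rewrite !max_l; [rewrite mulr0 subr0 addr0 mul0r|lra..].
Qed.

Lemma hat_ge e x : 0 < e -> 2 * e <= x -> hat e x = 0.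
Proof.
move=> e0 x0; rewrite /hat !max_r; [|lra..].
by field; lra.
Qed.

Lemma hat_ge0 e x : 0 < e -> 0 <= hat e x.
Proof.
move=> e0; rewrite /hat; apply: divr_ge0; last nra.
case: (leP 0 x) => ?; case: (leP 0 (x - e)) => ?;
  case: (leP 0 (x - 2 * e)) => ?; nra.
Qed.

(** The second difference of x_+ is a tent over [0, 2e] with peak e at x = e; dividing by e^2 leaves
    height 1/e. *)
Lemma hat_le e x : 0 < e -> hat e x <= e^-1.
Proof.
move=> e0; rewrite /hat ler_pdivrMr; last nra.
have -> : e^-1 * e ^+ 2 = e by field; lra.
case: (leP 0 x) => ?; case: (leP 0 (x - e)) => ?;
  case: (leP 0 (x - 2 * e)) => ?; nra.
Qed.

End steps.

(** * Tensor product test functions and kernels at Lebesgue points *)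

Section test_functions.
Context {R : realType}.
Local Notation mu := (@lebesgue_measure R).
Implicit Types (x e a b : R).

(** The derivative is carried as data, so that the partial derivatives of tensor products are
    explicit. One M serves both supports and one C both bounds. *)
Definition c1_bump (f f' : R -> R) : Prop :=
  [/\ forall x, is_derive x 1 f (f' x), continuous f' &
   exists M C : R, forall x, [/\ M < `|x| -> f x = 0 /\ f' x = 0, `|f x| <= C & `|f' x| <= C]].

Lemma is_derive_continuous (f : R -> R) (x l : R) :
  is_derive x 1 f l -> {for x, continuous f}.
Proof.
by move=> df; apply/differentiable_continuous/derivable1_diffP/ex_derive.
Qed.

Lemma c1_bump_continuous f f' : c1_bump f f' -> continuous f.
Proof. by case=> d _ _ x; exact: is_derive_continuous (d x). Qed.

(** Far to the left both steps are 0 and far to the right both are 1, so the difference has compact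
    support. Testing a weak derivative with it compares averages of the function near a and near
    b. *)
Lemma c1_bump_step e e' a b : 0 < e -> 0 < e' ->
  c1_bump (fun x => step e (x - a) - step e' (x - b))
          (fun x => hat e (x - a) - hat e' (x - b)).
Proof.
move=> e0 e'0; split.
- move=> x; apply: is_deriveB.
    by apply: is_derive_subr; exact: is_derive_step.
  by apply: is_derive_subr; exact: is_derive_step.
- have ch d c : continuous (fun x => hat d (x - c)).
    move=> x; apply: (@continuous_comp _ _ _ (fun x => x - c) (hat d)).
      by apply: cvgB; [exact: cvg_id|exact: cvg_cst].
    exact: continuous_hat.
  by move=> x; apply: cvgB; exact: ch.
- exists (`|a| + `|b| + 2 * e + 2 * e'), (1 + e^-1 + e'^-1) => x.
  have ei : 0 < e^-1 by rewrite invr_gt0.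
  have ei' : 0 < e'^-1 by rewrite invr_gt0.
  have := @step_ge0 _ e (x - a) e0; have := @step_le1 _ e (x - a) e0.
  have := @step_ge0 _ e' (x - b) e'0; have := @step_le1 _ e' (x - b) e'0.
  have := @hat_ge0 _ e (x - a) e0; have := @hat_le _ e (x - a) e0.
  have := @hat_ge0 _ e' (x - b) e'0; have := @hat_le _ e' (x - b) e'0.
  move=> ????????; split.
  + have := ler_norm a; have := ler_norm b.
    have := ler_norm (- a); have := ler_norm (- b); rewrite !normrN => ????.
    case: (leP 0 x) => x0; rewrite ?(ger0_norm x0) ?(ltr0_norm x0) => Mx.
      by rewrite !step_ge ?hat_ge ?subrr//; lra.
    by rewrite !step_le0 ?hat_le0 ?subrr//; lra.
  + by rewrite ler_norml; apply/andP; split; lra.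
  + by rewrite ler_norml; apply/andP; split; lra.
Qed.

Lemma is_derive_translate (f : R -> R) (x l : R) :
  is_derive x 1 f l -> is_derive (0:R) 1 (fun s => f (x + s)) l.
Proof.
move=> df; have := @is_derive_subr R f 0 (- x) l.
rewrite opprK add0r => /(_ df).
by under eq_fun do rewrite addrC.
Qed.

Lemma pd1_tensor (a a' b : R -> R) : (forall x, is_derive x 1 a (a' x)) ->
  forall z, pd_exists (e1 R) (fun z => a z.1 * b z.2) z /\
  pd (e1 R) (fun z => a z.1 * b z.2) z = a' z.1 * b z.2.
Proof.
move=> da z.
have d : is_derive (0:R) 1 (fun s : R => a (z.1 + s * ((1, 0) : R * R).1) * b (z.2 + s * ((1, 0) : R * R).2))
    (a' z.1 * b z.2).
  have -> : (fun s : R => a (z.1 + s * ((1, 0) : R * R).1) * b (z.2 + s * ((1, 0) : R * R).2)) =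
     (fun s => b z.2 *: a (z.1 + s)).
    by apply/funext => s /=; rewrite mulr1 mulr0 addr0 mulrC.
  rewrite mulrC; apply: is_deriveZ; exact: is_derive_translate.
by split; [exact: ex_derive|rewrite /pd derive1E; exact: derive_val].
Qed.

Lemma pd2_tensor (a b b' : R -> R) : (forall x, is_derive x 1 b (b' x)) ->
  forall z, pd_exists (e2 R) (fun z => a z.1 * b z.2) z /\
  pd (e2 R) (fun z => a z.1 * b z.2) z = a z.1 * b' z.2.
Proof.
move=> da z.
have d : is_derive (0:R) 1 (fun s : R => a (z.1 + s * ((0, 1) : R * R).1) * b (z.2 + s * ((0, 1) : R * R).2))
    (a z.1 * b' z.2).
  have -> : (fun s : R => a (z.1 + s * ((0, 1) : R * R).1) * b (z.2 + s * ((0, 1) : R * R).2)) =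
     (fun s => a z.1 *: b (z.2 + s)).
    by apply/funext => s /=; rewrite mulr1 mulr0 addr0.
  apply: is_deriveZ; exact: is_derive_translate.
by split; [exact: ex_derive|rewrite /pd derive1E; exact: derive_val].
Qed.

Lemma continuous_tensor (a b : R -> R) : continuous a -> continuous b ->
  continuous (fun z : R * R => a z.1 * b z.2).
Proof.
move=> ca cb z; apply: cvgM.
  by apply: (@continuous_comp _ _ _ fst a); [exact: cvg_fst|exact: ca].
by apply: (@continuous_comp _ _ _ snd b); [exact: cvg_snd|exact: cb].
Qed.

Lemma testfun_tensor (a a' b b' : R -> R) : c1_bump a a' -> c1_bump b b' ->
  testfun (fun z => a z.1 * b z.2).
Proof.
move=> ba bb; have [da ca' [Ma [Ca bda]]] := ba; have [db cb' [Mb [Cb bdb]]] := bb.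
split; first by move=> z; split; [exact: (@pd1_tensor _ _ b da _).1|exact: (@pd2_tensor a _ _ db _).1].
split.
  by apply: continuous_tensor; [exact: c1_bump_continuous ba|exact: c1_bump_continuous bb].
split.
  rewrite (_ : pd _ _ = fun z => a' z.1 * b z.2).
    by apply: continuous_tensor => //; exact: c1_bump_continuous bb.
  by apply/funext => z; exact: (@pd1_tensor _ _ b da _).2.
split.
  rewrite (_ : pd _ _ = fun z => a z.1 * b' z.2).
    by apply: continuous_tensor => //; exact: c1_bump_continuous ba.
  by apply/funext => z; exact: (@pd2_tensor a _ _ db _).2.
(* If |z_1| + |z_2| exceeds the sum, one coordinate leaves the support of its own factor. *)
exists (Ma + Mb) => z Mz; have [l|l] := ltP Ma `|z.1|.
  by have [/(_ l)[-> _] _ _] := bda z.1; rewrite mul0r.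
have l2 : Mb < `|z.2| by lra.
by have [/(_ l2)[-> _] _ _] := bdb z.2; rewrite mulr0.
Qed.

(** The integral is at most 1/r times that of |h - h a| over the ball, which is twice the mean
    deviation because the ball has length 2r. The kernel may have any sign and any mass, so the same
    lemma serves bumps and approximate identities. *)
Lemma lebesgue_pt_kernel (h : R -> R) (a d : R) : measurable_fun setT h ->
  lebesgue_pt h a -> 0 < d ->
  exists2 rho : R, 0 < rho & forall (r : R) (K : R -> R), 0 < r -> r < rho ->
    measurable_fun setT K -> (forall s, `|K s| <= r^-1) ->
    (forall s, r <= `|s - a| -> K s = 0) ->
    (\int[mu]_s `|((h s - h a) * K s)%:E| <= d%:E)%E.
Proof.
move=> mh ha d0.
have d20 : (0 < (d / 2)%:E)%E by rewrite lte_fin divr_gt0.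
(* Half of d, to pay for the factor 2 between 1/r and 1/(2r). *)
have : \forall r \near (0:R)^'+, (davg h a r < (d / 2)%:E)%E.
  by have := ha [set z | (z < (d / 2)%:E)%E]; apply; apply: open_nbhs_nbhs; split; [exact: open_ereal_lt_ereal|].
move=> [rho /= rho0 H]; exists rho => // r K r0 rrho mK K1 K0.
have {H}H : (davg h a r < (d / 2)%:E)%E.
  by apply: H => //=; rewrite sub0r normrN gtr0_norm.
have mb : measurable (ball a r) by exact: measurable_ball.
rewrite /davg /iavg lebesgue_measure_ball ?ltW// inver mulrn_eq0/= gt_eqF//= in H.
pose J := (\int[mu]_(y in ball a r) `|(h y - h a)%:E|)%E.
have mhK : measurable_fun setT (fun s => `|((h s - h a) * K s)%:E|)%E.
  apply/measurableT_comp => //; apply/measurable_EFinP/measurable_funM => //.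
  exact: measurable_funB.
have mJ (D : set R) : measurable_fun D (fun y => `|(h y - h a)%:E|)%E.
  apply/measurableT_comp => //; apply/measurable_EFinP/measurable_funB => //.
  exact: measurable_funS mh.
have le : (\int[mu]_s `|((h s - h a) * K s)%:E| <= (r^-1)%:E * J)%E.
  rewrite [leLHS](_ : _ = \int[mu]_(s in ball a r) `|((h s - h a) * K s)%:E|)%E.
    rewrite /J -ge0_integralZl_EFin ?invr_ge0 ?(ltW r0)//; last exact: mJ.
    apply: ge0_le_integral => //.
    - by apply: measurable_funS mhK.
    - by apply: measurable_funeM; exact: mJ.
    - by move=> y _; rewrite !abse_EFin -EFinM lee_fin normrM mulrC ler_wpM2r.
  rewrite [RHS]integral_mkcond; apply: eq_integral => s _; rewrite patchE.
  case: ifPn => // /negP; rewrite inE /ball/= => /negP; rewrite -leNgt distrC => rs.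
  by rewrite K0// mulr0 normr0.
apply: (le_trans le).
have {}H : ((r *+ 2)^-1%:E * J < (d / 2)%:E)%E by [].
have -> : ((r^-1)%:E * J = 2%:E * ((r *+ 2)^-1%:E * J))%E.
  by rewrite muleA -EFinM; congr (_%:E * _)%E; field; lra.
apply: le_trans (lee_wpmul2l _ (ltW H)) _ => //; rewrite -EFinM lee_fin; lra.
Qed.

End test_functions.

(** * Square integrable functions and slices *)

Section square_integrable.
Context {R : realType}.
Local Notation mu := (@lebesgue_measure R).
Local Notation m2 := (mu \x mu)%E.

Lemma measurable_EFin d (T : measurableType d) (D : set T) (f : T -> R) :
  measurable_fun D f -> measurable_fun D (fun x => (f x)%:E).
Proof. by move=> mf; apply/measurable_EFinP. Qed.

Lemma ae_impl d (T : measurableType d) (m : {measure set T -> \bar R}) (P Q : T -> Prop) :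
  (forall x, P x -> Q x) -> {ae m, forall x, P x} -> {ae m, forall x, Q x}.
Proof. by move=> PQ; apply: filterS. Qed.

Lemma ae_impl2 d (T : measurableType d) (m : {measure set T -> \bar R}) (P Q S : T -> Prop) :
  (forall x, P x -> Q x -> S x) -> {ae m, forall x, P x} -> {ae m, forall x, Q x} ->
  {ae m, forall x, S x}.
Proof. by move=> PQ; apply: filterS2. Qed.

Lemma integrable_le d (T : measurableType d) (m : {measure set T -> \bar R})
    (f g : T -> R) :
  m.-integrable setT (fun x => (g x)%:E) -> measurable_fun setT f ->
  (forall x, `|f x| <= g x) -> m.-integrable setT (fun x => (f x)%:E).
Proof.
move=> gi mf fg; apply: le_integrable gi => //; first exact: measurable_EFin.
by move=> x _ /=; rewrite lee_fin (le_trans (fg x))// ler_norm.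
Qed.

Lemma integrable_boundedM d (T : measurableType d) (m : {measure set T -> \bar R})
    (f b : T -> R) (C : R) :
  m.-integrable setT (fun x => (f x)%:E) -> measurable_fun setT b ->
  (forall x, `|b x| <= C) -> m.-integrable setT (fun x => (f x * b x)%:E).
Proof.
move=> fi mb bC.
have mf : measurable_fun setT f by apply/measurable_EFinP; exact: measurable_int fi.
apply: (@integrable_le _ _ _ _ (fun x => C * `|f x|)).
- have : m.-integrable setT (fun x => C%:E * `|(f x)%:E|)%E.
    by apply: integrableZl => //; exact: integrable_abse.
  by [].
- exact: measurable_funM.
- by move=> x; rewrite normrM mulrC ler_wpM2r.
Qed.

(** A local form of the fundamental lemma of the calculus of variations: only bumps living within
    rho of the Lebesgue point c are tested, which later allows a cut-off to be the constant 1 on all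
    of them. *)
Lemma lebesgue_pt_bump_eq0 (h : R -> R) (c rho : R) : 0 < rho ->
  mu.-integrable setT (fun x => (h x)%:E) -> lebesgue_pt h c ->
  (forall b b', c1_bump b b' -> (forall y, rho <= `|y - c| -> b y = 0) ->
     (\int[mu]_y (h y * b y)%:E = 0)%E) ->
  h c = 0.
Proof.
move=> rho0 hi hc hb; apply/eqP/negPn/negP => hc0.
have mh : measurable_fun setT h by apply/measurable_EFinP; exact: measurable_int hi.
(* The plateau below yields at least |h c| e / r = |h c| / 6, so any divisor larger than 6
   contradicts the kernel estimate. *)
have d0 : 0 < `|h c| / 20 by rewrite divr_gt0 ?normr_gt0.
have [rho' rho'0 H] := lebesgue_pt_kernel mh hc d0.
pose r := Num.min rho rho' / 2.
have m0 : 0 < Num.min rho rho' by rewrite lt_min rho0.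
have r0 : 0 < r by rewrite divr_gt0.
have rrho' : r < rho'.
  have : Num.min rho rho' <= rho' by rewrite ge_min lexx orbT.
  rewrite /r; lra.
have rrho : r < rho.
  have : Num.min rho rho' <= rho by rewrite ge_min lexx.
  rewrite /r; lra.
(* The bump rises on [c, c + 2e], equals 1 on [c + 2e, c + 3e] and falls until c + 5e, hence stays
   within r = 6e of c. *)
pose e := r / 6.
have e0 : 0 < e by rewrite divr_gt0.
pose b := fun y => step e (y - c) - step e (y - (c + 3 * e)).
have bb := c1_bump_step c (c + 3 * e) e0 e0.
have mb : measurable_fun setT b.
  by apply: continuous_measurable_fun; exact: c1_bump_continuous bb.
have b01 y : 0 <= b y <= 1.
  have := step_ge0 (y - c) e0; have := step_le1 (y - c) e0.
  have := step_ge0 (y - (c + 3 * e)) e0; have := step_le1 (y - (c + 3 * e)) e0.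
  move=> ? ? ? ?; rewrite /b; have [l|l] := leP y (c + 3 * e).
    by rewrite (@step_le0 _ e (y - (c + 3 * e)))//; lra.
  by rewrite (@step_ge _ e (y - c))//; lra.
have bout y : r <= `|y - c| -> b y = 0.
  have re : r = 6 * e by rewrite /e; field.
  rewrite /b re; have [l|l] := leP 0 (y - c).
    by rewrite ger0_norm// => ?; rewrite !step_ge ?subrr//; lra.
  by rewrite ltr0_norm// => ?; rewrite !step_le0 ?subrr//; lra.
have ib : mu.-integrable setT (fun y => (b y)%:E).
  have ii : mu.-integrable setT (fun y => (\1_(`[c - r, c + r]%classic : set R) y)%:E).
    exact: integrable_indic_itv.
  apply: (integrable_le ii) => //.
  move=> y; have /andP[b0 b1] := b01 y.
  rewrite indicE; case: (boolP (y \in _)) => [_|].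
    by rewrite ger0_norm.
  rewrite mem_setE in_itv/= => yr; rewrite bout ?normr0//.
  move: yr; rewrite negb_and -!ltNge => /orP[] ?.
    by rewrite ltr0_norm; lra.
  by rewrite gtr0_norm; lra.
have ihb : mu.-integrable setT (fun y => (h y * b y)%:E).
  apply: (integrable_boundedM (C := 1)) => // y.
  by have /andP[b0 b1] := b01 y; rewrite ger0_norm.
have z : (\int[mu]_y (h y * b y)%:E = 0)%E.
  apply: hb bb _ => y ry; apply: bout; apply: le_trans ry; exact: ltW.
have eb : (e%:E <= \int[mu]_y (b y)%:E)%E.
  have -> : e%:E = (\int[mu]_y (\1_(`[c + 2 * e, c + 3 * e]) y)%:E)%E.
    rewrite integral_indic//= setIT lebesgue_measure_itv/= lte_fin ifT; last lra.
    by rewrite -EFinB; congr (_%:E); ring.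
  apply: ge0_le_integral => //.
  - by apply: measurable_EFin.
  - exact: measurable_EFin.
  - move=> y _; rewrite lee_fin indicE; case: (boolP (y \in _)) => [|_].
      rewrite mem_setE in_itv/= => /andP[y1 y2].
      rewrite /b step_ge ?step_le0//; [by rewrite subr0|lra|lra].
    by have /andP[] := b01 y.
have mK : measurable_fun setT (fun y => r^-1 * b y) by apply: measurable_funM.
have K1 t : `|r^-1 * b t| <= r^-1.
  have /andP[b0 b1] := b01 t.
  by rewrite ger0_norm ?mulr_ge0 ?invr_ge0 ?(ltW r0)// ger_pMr ?invr_gt0.
have K0 t : r <= `|t - c| -> r^-1 * b t = 0 by move/bout => ->; rewrite mulr0.
have := H r (fun y => r^-1 * b y) r0 rrho' mK K1 K0.
apply/negP; rewrite -ltNge.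
have ib2 : mu.-integrable setT (fun y => (h c * b y)%:E).
  by have := integrableZl measurableT (h c) ib.
have mhK : measurable_fun setT (fun s => ((h s - h c) * (r^-1 * b s))%:E).
  by apply: measurable_EFin; apply: measurable_funM => //; exact: measurable_funB.
have le2 : (`|\int[mu]_s ((h s - h c) * (r^-1 * b s))%:E| <=
    \int[mu]_s `|((h s - h c) * (r^-1 * b s))%:E|)%E.
  exact: le_abse_integral.
apply: lt_le_trans le2.
have -> : (\int[mu]_s ((h s - h c) * (r^-1 * b s))%:E =
   (r^-1)%:E * (- ((h c)%:E * \int[mu]_s (b s)%:E)))%E.
  rewrite -(sub0e (_ * _)%E) -{1}z -integralZl// -integralB//.
  rewrite -integralZl//; last exact: integrableB.
  apply: eq_integral => s _.
  rewrite -[RHS]/((r^-1 * (h s * b s - h c * b s))%:E); congr (_%:E); ring.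
have fb : (\int[mu]_s (b s)%:E)%E \is a fin_num by apply: integrable_fin_num.
move: eb; rewrite -(fineK fb) lee_fin; set I := fine _ => eI.
rewrite -[X in (_ < `|X|)%E]/((r^-1 * - (h c * I))%:E) abse_EFin lte_fin !normrM normrN normrM.
rewrite (@gtr0_norm _ r^-1) ?invr_gt0// (@ger0_norm _ I); last lra.
have : `|h c| * e <= `|h c| * I by rewrite ler_wpM2l.
have -> : r = 6 * e by rewrite /e; field.
move=> le1; rewrite ltr_pdivlMl; last lra.
apply: lt_le_trans le1.
have : 0 < `|h c| by rewrite normr_gt0.
nra.
Qed.

Lemma L2_measurable (f : R * R -> R) : L2 f -> measurable_fun setT f.
Proof. by case. Qed.

Lemma L2_integrable_sqr (f : R * R -> R) : L2 f ->
  m2.-integrable setT (fun z => (f z ^+ 2)%:E).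
Proof.
move=> [mf fo]; apply/integrableP; split.
  by apply/measurable_EFin/measurable_funX.
move: fo; rewrite /int2 /leb2; apply: le_lt_trans.
by rewrite le_eqVlt; apply/orP; left; apply/eqP; apply: eq_integral => z _; rewrite abse_EFin ger0_norm ?sqr_ge0.
Qed.

Lemma integrable_L2M (f g : R * R -> R) : L2 f -> L2 g ->
  m2.-integrable setT (fun z => (f z * g z)%:E).
Proof.
move=> f2 g2; have mf := L2_measurable f2; have mg := L2_measurable g2.
have i2 : m2.-integrable setT (fun z => (f z ^+ 2 + g z ^+ 2)%:E).
  have := integrableD measurableT (L2_integrable_sqr f2) (L2_integrable_sqr g2).
  by [].
apply: (integrable_le i2); first exact: measurable_funM.
move=> z; rewrite ler_norml; apply/andP; split; nra.
Qed.

Lemma box_L2 (f : R * R -> R) (M C : R) : measurable_fun setT f ->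
  (forall z, `|f z| <= C) -> (forall z, M < `|z.1| -> f z = 0) ->
  (forall z, M < `|z.2| -> f z = 0) -> L2 f.
Proof.
move=> mf fC f1 f2; split => //; rewrite /int2 /leb2.
pose B := `[- M, M]%classic `*` `[- M, M]%classic : set (R * R).
have mB : measurable B by exact: measurableX.
apply: (@le_lt_trans _ _ (\int[m2]_z ((C ^+ 2) * \1_B z)%:E)%E).
  apply: ge0_le_integral => //.
  - by move=> z _; rewrite lee_fin sqr_ge0.
  - by apply/measurable_EFin/measurable_funX.
  - by apply/measurable_EFin/measurable_funM.
  - move=> z _; rewrite lee_fin indicE.
    have [zB|] := boolP (z \in B).
      by rewrite mulr1 -real_normK ?num_real// lerXn2r ?nnegrE// (le_trans _ (fC z)).
    rewrite notin_setE /B/= !in_itv/= -!ler_norml => /not_andP[] /negP; rewrite -ltNge => l.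
      by rewrite f1// expr0n/= mulr0.
    by rewrite f2// expr0n/= mulr0.
under eq_integral do rewrite EFinM.
rewrite ge0_integralZl_EFin ?sqr_ge0//; last exact: measurable_EFin.
rewrite integral_indic//= setIT.
have -> : (mu \x mu)%E B = (mu `[(- M)%R, M%R]%classic * mu `[(- M)%R, M%R]%classic)%E.
  by rewrite product_measure1E.
rewrite !lebesgue_measure_itv/=; case: ifP => _; last by rewrite !mule0 ltry.
by rewrite -!EFinB -!EFinM ltry.
Qed.

End square_integrable.

(** * Calculus of locally absolutely continuous functions *)

Section primitives.
Context {R : realType}.
Local Notation mu := (@lebesgue_measure R).
Local Notation m2 := (mu \x mu)%E.

Lemma integrable_tensor (f g : R -> R) (K : R * R -> R) (C : R) :
  mu.-integrable setT (fun x => (f x)%:E) -> mu.-integrable setT (fun x => (g x)%:E) ->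
  measurable_fun setT K -> (forall z, `|K z| <= C) ->
  m2.-integrable setT (fun z => (f z.1 * g z.2 * K z)%:E).
Proof.
move=> fi gi mK KC.
have mf : measurable_fun setT f by apply/measurable_EFinP; exact: measurable_int fi.
have mg : measurable_fun setT g by apply/measurable_EFinP; exact: measurable_int gi.
have mf1 : measurable_fun setT (fun z : R * R => f z.1) by apply: measurableT_comp.
have mg2 : measurable_fun setT (fun z : R * R => g z.2) by apply: measurableT_comp.
have mfg : measurable_fun setT (fun z : R * R => f z.1 * g z.2) by apply: measurable_funM.
have ifg : m2.-integrable setT (fun z => (f z.1 * g z.2)%:E).
  apply/integrable12ltyP; first exact: measurable_EFin.
  have -> : (fun x : R => \int[mu]_y `|(f (x, y).1 * g (x, y).2)%:E|)%E =
            (fun x : R => `|f x|%:E * \int[mu]_y `|g y|%:E)%E.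
    apply/funext => x /=.
    under eq_integral do rewrite normrM EFinM.
    rewrite ge0_integralZl_EFin//.
    by apply/measurable_EFin/measurableT_comp.
  have gl : (\int[mu]_y `|g y|%:E < +oo)%E by have /integrableP[] := gi.
  have fl : (\int[mu]_y `|f y|%:E < +oo)%E by have /integrableP[] := fi.
  rewrite ge0_integralZr//.
  - by rewrite lte_mul_pinfty// ?integral_ge0// ge0_fin_numE// integral_ge0.
  - by apply/measurable_EFin/measurableT_comp.
  - by apply: integral_ge0.
exact: integrable_boundedM ifg mK KC.
Qed.

Lemma measurable_le_indic d (X : measurableType d) (f g : X -> R) :
  measurable_fun setT f -> measurable_fun setT g ->
  measurable_fun setT (fun z => (f z <= g z)%R%:R : R).
Proof.
move=> mf mg.
have mA : measurable [set z | f z <= g z] by rewrite -[X in measurable X]setTI; exact: measurable_fun_le.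
have -> : (fun z => (f z <= g z)%R%:R : R) = \1_[set z | f z <= g z].
  apply/funext => z; rewrite indicE; congr (_%:R : R).
  by have [h|h] := boolP (f z <= g z); [rewrite mem_set|rewrite memNset//; exact/negP].
exact: measurable_indic.
Qed.

(** Integration by parts as Fubini: the plane is cut along the diagonal into t <= s and s < t, and
    each half is integrated in the order that makes the inner integral a primitive. *)
Lemma integrable_triangle (f g : R -> R) :
  mu.-integrable setT (fun x => (f x)%:E) -> mu.-integrable setT (fun x => (g x)%:E) ->
  (\int[mu]_s (f s * \int[mu]_t (g t * (t <= s)%R%:R)) +
   \int[mu]_t (g t * \int[mu]_s (f s * (1 - (t <= s)%R%:R)))
   = (\int[mu]_s f s) * (\int[mu]_t g t)).
Proof.
move=> fi gi.
have mK : measurable_fun setT (fun z : R * R => (z.2 <= z.1)%R%:R : R).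
  exact: measurable_le_indic.
have K1 (b : bool) : `|b%:R : R| <= 1 by case: b; rewrite ?normr0 ?normr1.
have K1' (b : bool) : `|1 - b%:R : R| <= 1 by case: b; rewrite ?subrr ?subr0 ?normr0 ?normr1.
have i1 := integrable_tensor fi gi mK (fun z => K1 _).
have mK' : measurable_fun setT (fun z : R * R => 1 - (z.2 <= z.1)%R%:R : R).
  exact: measurable_funB.
have i2 := integrable_tensor fi gi mK' (fun z => K1' _).
have cutg s : mu.-integrable setT (fun t => (g t * (t <= s)%R%:R)%:E).
  apply: (integrable_boundedM gi (C := 1)) => //.
  exact: measurable_le_indic.
have cutf t : mu.-integrable setT (fun s => (f s * (1 - (t <= s)%R%:R))%:E).
  apply: (integrable_boundedM fi (C := 1)) => //.
  by apply: measurable_funB => //; exact: measurable_le_indic.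
have e1 : (\int[m2]_z (f z.1 * g z.2 * (z.2 <= z.1)%R%:R)%:E =
   \int[mu]_s (f s * \int[mu]_t (g t * (t <= s)%R%:R))%:E)%E.
  rewrite -(integral12_prod_meas1 i1); apply: eq_integral => s _.
  rewrite /fubini_F /=.
  under eq_integral do rewrite -mulrA EFinM.
  rewrite integralZl// EFinM; congr (_ * _)%E.
  by rewrite fineK//; exact: integrable_fin_num.
have e2 : (\int[m2]_z (f z.1 * g z.2 * (1 - (z.2 <= z.1)%R%:R))%:E =
   \int[mu]_t (g t * \int[mu]_s (f s * (1 - (t <= s)%R%:R)))%:E)%E.
  rewrite -(integral21_prod_meas1 i2); apply: eq_integral => t _.
  rewrite /fubini_G /=.
  under eq_integral do rewrite (mulrC (f _)) -mulrA EFinM.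
  rewrite integralZl// EFinM; congr (_ * _)%E.
  by rewrite fineK//; exact: integrable_fin_num.
have f1 := integrable_fin_num measurableT i1.
have f2 := integrable_fin_num measurableT i2.
apply: EFin_inj; rewrite EFinD /Rintegral -e1 -e2 !fineK//.
rewrite -integralD//.
have i0 := @integrable_tensor f g (cst 1) 1 fi gi (measurable_cst _) (fun z => K1 true).
transitivity (\int[m2]_z (f z.1 * g z.2 * 1)%:E)%E.
  by apply: eq_integral => z _; rewrite -EFinD -mulrDr; congr (_ * _)%:E; ring.
rewrite -(integral12_prod_meas1 i0) EFinM.
transitivity (\int[mu]_s ((f s)%:E * (fine (\int[mu]_t (g t)%:E))%:E))%E.
  apply: eq_integral => s _; rewrite /fubini_F /=.
  under eq_integral do rewrite mulr1 EFinM.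
  by rewrite integralZl// fineK//; exact: integrable_fin_num.
have fg : (\int[mu]_t (g t)%:E)%E \is a fin_num by exact: integrable_fin_num.
have ff : (\int[mu]_t (f t)%:E)%E \is a fin_num by exact: integrable_fin_num.
by rewrite (fineK ff) integralZr.
Qed.

(** Local absolute continuity in integral form, so that no pointwise derivative of F enters; f is
    only required to be integrable on bounded intervals. *)
Definition primitive_of (F f : R -> R) : Prop :=
  [/\ measurable_fun setT f,
   forall x y, mu.-integrable `[x, y] (fun s => (f s)%:E) &
   forall x y, x <= y -> F y - F x = \int[mu]_(s in `[x, y]) f s].

Lemma primitive_of_continuous F f : primitive_of F f -> continuous F.
Proof.
move=> [mf fi Ff] x.
have xx : x - 1 < x + 1 by lra.
have := parameterized_integral_continuous (ltW xx) (fi (x - 1) (x + 1)).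
move=> /(continuous_within_itvP _ xx)[+ _ _] => /(_ x).
rewrite in_itv/= gtrBl ltrDl ltr01 => /(_ isT) cx.
have FE y : x - 1 <= y -> F y = F (x - 1) + parameterized_integral mu (x - 1) y f.
  by move=> xy; rewrite /parameterized_integral -Ff// addrC subrK.
have cg : {for x, continuous (fun y => F (x - 1) + parameterized_integral mu (x - 1) y f)}.
  by apply: cvgD; [exact: cvg_cst|exact: cx].
rewrite /continuous_at [F x]FE; last lra.
apply: cvg_trans cg; apply: near_eq_cvg; near=> y; rewrite [RHS]FE//.
by near: y; exists 1; [exact: ltr01|move=> z]; rewrite /ball_/= ltr_norml => /andP[]; lra.
Unshelve. all: by end_near. Qed.

Lemma primitive_of_bounded F f x y : primitive_of F f -> x <= y ->
  exists C, forall s, s \in `[x, y] -> `|F s| <= C.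
Proof.
move=> pF xy; have cF := primitive_of_continuous pF.
have [c _ Hc] : exists2 c, c \in `[x, y]%R & forall t, t \in `[x, y]%R -> `|F t| <= `|F c|.
  apply: (@EVT_max _ (fun t => `|F t|)) => //.
  apply: continuous_subspaceT => t; apply: (@continuous_comp _ _ _ F Num.norm).
    exact: cF.
  exact: norm_continuous.
by exists `|F c|.
Qed.

Lemma primitive_of_mulr_integrable F f g x y : primitive_of F f ->
  measurable_fun setT g -> mu.-integrable `[x, y] (fun s => (g s)%:E) ->
  mu.-integrable `[x, y] (fun s => (g s * F s)%:E).
Proof.
move=> pF mg gi; have [xy|xy] := leP x y; last first.
  by rewrite set_itv_ge -?ltNge//; exact: integrable_set0.
have [C FC] := primitive_of_bounded pF xy.
have mF := continuous_measurable_fun (primitive_of_continuous pF).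
have : mu.-integrable `[x, y] (fun s => (C * `|g s|)%:E).
  have : mu.-integrable `[x, y] (fun s => C%:E * `|(g s)%:E|)%E.
    by apply: integrableZl => //; exact: integrable_abse.
  by [].
apply: le_integrable => //.
  by apply/measurable_EFin/measurable_funTS; exact: measurable_funM.
move=> s /= sxy; rewrite lee_fin (le_trans _ (ler_norm _))//.
by rewrite normrM mulrC ler_wpM2r// FC.
Qed.

(** With f and g cut off to [x, y], [integrable_triangle] reads: the integral of f (G - G x) plus
    that of g (F - F x) equals (F y - F x) (G y - G x). Expanding gives the product rule. *)
Lemma primitive_ofM F f G g : primitive_of F f -> primitive_of G g ->
  primitive_of (fun s => F s * G s) (fun s => f s * G s + g s * F s).
Proof.
move=> pF pG; have [mf fi Ff] := pF; have [mg gi Gg] := pG.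
have mF := continuous_measurable_fun (primitive_of_continuous pF).
have mG := continuous_measurable_fun (primitive_of_continuous pG).
have fGi x y := primitive_of_mulr_integrable pG mf (fi x y).
have gFi x y := primitive_of_mulr_integrable pF mg (gi x y).
split.
- by apply: measurable_funD; exact: measurable_funM.
- by move=> x y; apply: (integrableD _ (fGi x y) (gFi x y)); exact: measurable_itv.
move=> x y xy.
rewrite RintegralD//.
pose D := `[x, y]%classic : set R.
have mD : measurable D by exact: measurable_itv.
pose ft s := f s * \1_D s; pose gt s := g s * \1_D s.
have cut (h : R -> R) : mu.-integrable D (fun s => (h s)%:E) ->
    mu.-integrable setT (fun s => (h s * \1_D s)%:E).
  move=> hi; have := (integrable_mkcond (mu := mu) (D := D) (fun s => (h s)%:E) (measurable_itv _)).1 hi.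
  apply: eq_integrable => // s _; rewrite patchE indicE.
  by case: ifP => _; rewrite ?mulr1 ?mulr0.
have cutE (h : R -> R) : \int[mu]_(s in D) h s = \int[mu]_s (h s * \1_D s).
  rewrite Rintegral_mkcond; apply: eq_Rintegral => s _; rewrite patchE indicE.
  by case: ifP => _; rewrite ?mulr1 ?mulr0.
have fti : mu.-integrable setT (fun s => (ft s)%:E) by apply: cut; exact: fi.
have gti : mu.-integrable setT (fun s => (gt s)%:E) by apply: cut; exact: gi.
have tri := integrable_triangle fti gti.
have GE s : s \in `[x, y] -> \int[mu]_t (gt t * (t <= s)%R%:R) = G s - G x.
  rewrite in_itv/= => /andP[xs sy]; rewrite Gg// [RHS]Rintegral_mkcond.
  apply: eq_Rintegral => t _; rewrite patchE /gt indicE /D !mem_setE !in_itv/=.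
  case: (leP x t) => xt; case: (leP t s) => ts; case: (leP t y) => ty;
    rewrite /= ?mulr1 ?mulr0 ?mul0r//; lra.
(* The strict half of the plane produces the half-open interval [x, s[; its missing endpoint is
   null. *)
have FE s : s \in `[x, y] -> \int[mu]_t (ft t * (1 - (s <= t)%R%:R)) = F s - F x.
  rewrite in_itv/= => /andP[xs sy]; rewrite Ff// -Rintegral_itv_bndo_bndc; last first.
    apply: integrableS (fi x s) => //.
    by move=> t /=; rewrite !in_itv/= => /andP[-> /ltW ->].
  rewrite [RHS]Rintegral_mkcond.
  apply: eq_Rintegral => t _; rewrite patchE /ft indicE /D !mem_setE !in_itv/=.
  case: (leP x t) => xt; case: (leP s t) => ts; case: (leP t y) => ty;
    rewrite /= ?subrr ?subr0 ?mulr1 ?mulr0 ?mul0r//; lra.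
have eG : \int[mu]_s (ft s * \int[mu]_t (gt t * (t <= s)%R%:R)) =
    \int[mu]_(s in D) (f s * G s) - G x * \int[mu]_(s in D) f s.
  have fGx : mu.-integrable D (fun s => (f s * G x)%:E).
    by apply: (integrableZr _ (G x) (fi x y)); exact: measurable_itv.
  have -> : G x * \int[mu]_(s in D) f s = \int[mu]_(s in D) (f s * G x).
    by rewrite mulrC RintegralZr; [by []|exact: mD|exact: fi].
  rewrite -RintegralB; [|exact: mD|exact: fGi|exact: fGx].
  rewrite cutE; apply: eq_Rintegral => s _; rewrite /ft indicE.
  have [|_] := boolP (s \in D); last by rewrite !mulr0 mul0r.
  by rewrite inE => sD; rewrite GE//; ring.
have eF : \int[mu]_t (gt t * \int[mu]_s (ft s * (1 - (t <= s)%R%:R))) =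
    \int[mu]_(s in D) (g s * F s) - F x * \int[mu]_(s in D) g s.
  have gFx : mu.-integrable D (fun s => (g s * F x)%:E).
    by apply: (integrableZr _ (F x) (gi x y)); exact: measurable_itv.
  have -> : F x * \int[mu]_(s in D) g s = \int[mu]_(s in D) (g s * F x).
    by rewrite mulrC RintegralZr; [by []|exact: mD|exact: gi].
  rewrite -RintegralB; [|exact: mD|exact: gFi|exact: gFx].
  rewrite cutE; apply: eq_Rintegral => s _; rewrite /gt indicE.
  have [|_] := boolP (s \in D); last by rewrite !mulr0 mul0r.
  by rewrite inE => sD; rewrite FE//; ring.
move: tri; rewrite eG eF -!cutE -(Ff x y xy) -(Gg x y xy) => tri.
by move/eqP: tri; rewrite -subr_eq0 => /eqP tri; apply/eqP; rewrite -subr_eq0; apply/eqP;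
  rewrite -[RHS]oppr0 -tri; ring.
Qed.

Lemma primitive_ofX F f n : primitive_of F f ->
  primitive_of (fun s => F s ^+ n.+1) (fun s => n.+1%:R * F s ^+ n * f s).
Proof.
move=> pF; elim: n => [|n IH].
  have -> : (fun s => F s ^+ 1) = F by apply/funext => s; rewrite expr1.
  by have -> : (fun s => 1%:R * F s ^+ 0 * f s) = f by apply/funext => s; rewrite expr0 !mul1r.
have := primitive_ofM IH pF.
have -> : (fun s => F s ^+ n.+1 * F s) = (fun s => F s ^+ n.+2).
  by apply/funext => s; rewrite -exprSr.
have -> // : (fun s => n.+1%:R * F s ^+ n * f s * F s + f s * F s ^+ n.+1) =
  (fun s => n.+2%:R * F s ^+ n.+1 * f s).
by apply/funext => s; rewrite exprSr -natr1; ring.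
Qed.

Lemma primitive_ofD F f G g : primitive_of F f -> primitive_of G g ->
  primitive_of (fun s => F s + G s) (fun s => f s + g s).
Proof.
move=> [mf fi Ff] [mg gi Gg]; split; first exact: measurable_funD.
- by move=> x y; apply: (integrableD _ (fi x y) (gi x y)); exact: measurable_itv.
- by move=> x y xy; rewrite RintegralD// -Ff// -Gg//; ring.
Qed.

(** W x differs from W a by at most the integral of |w|, and a may be chosen with W a as small as
    desired. The right side may be infinite, so no global integrability of w has to be checked. *)
Lemma primitive_of_sup W w : primitive_of W w ->
  (forall e, 0 < e -> exists a, `|W a| < e) ->
  forall x, (`|W x|%:E <= \int[mu]_s `|w s|%:E)%E.
Proof.
move=> [mw wi Ww] small x; apply/lee_addgt0Pr => e e0.
have [a ae] := small e e0.
have key u v : u <= v -> (`|W v - W u|%:E <= \int[mu]_s `|w s|%:E)%E.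
  move=> uv; rewrite Ww//.
  apply: (@le_trans _ _ (\int[mu]_(s in `[u, v]) `|w s|%:E)%E).
    rewrite /Rintegral -abse_EFin fineK; last exact: integrable_fin_num.
    by apply: le_abse_integral => //; exact/measurable_funTS/measurable_EFin.
  apply: ge0_subset_integral => //.
  by apply/measurable_EFin/measurableT_comp.
have : (`|W x - W a|%:E <= \int[mu]_s `|w s|%:E)%E.
  have [ax|xa] := leP a x; first exact: key.
  by rewrite distrC; apply: key; exact: ltW.
move=> h; apply: (@le_trans _ _ (`|W x - W a|%:E + e%:E)%E); last by rewrite leeD2r.
rewrite -EFinD lee_fin -[X in `|X| <= _](subrK (W a)).
by apply: (le_trans (ler_normD _ _)); rewrite lerD2l ltW.
Qed.

End primitives.

(** * From weak derivatives in the plane to weak derivatives on lines *)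

Section slicing.
Context {R : realType}.
Local Notation mu := (@lebesgue_measure R).
Local Notation m2 := (mu \x mu)%E.

Lemma c1_bump_measurable (b b' : R -> R) : c1_bump b b' ->
  measurable_fun setT b /\ measurable_fun setT b'.
Proof.
move=> bb; split; apply: continuous_measurable_fun.
  exact: c1_bump_continuous bb.
by case: bb.
Qed.

Lemma measurable_tensor (a b : R -> R) : measurable_fun setT a -> measurable_fun setT b ->
  measurable_fun setT (fun z : R * R => a z.1 * b z.2).
Proof. by move=> ma mb; apply: measurable_funM; exact: measurableT_comp. Qed.

Lemma tensor_L2 (a b : R -> R) (M C : R) : measurable_fun setT a -> measurable_fun setT b ->
  (forall x, `|a x| <= C) -> (forall x, `|b x| <= C) ->
  (forall x, M < `|x| -> a x = 0) -> (forall x, M < `|x| -> b x = 0) ->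
  L2 (fun z => a z.1 * b z.2).
Proof.
move=> ma mb aC bC a0 b0; apply: (@box_L2 _ _ M (C * C)).
- exact: measurable_tensor.
- by move=> z; rewrite normrM ler_pM.
- by move=> z /a0 ->; rewrite mul0r.
- by move=> z /b0 ->; rewrite mulr0.
Qed.

(** A weak derivative in the first variable, tested on tensor products only. After exchanging
    coordinates it also covers the second variable, so each slice lemma is proved once. *)
Definition weak_partial (f g : R * R -> R) : Prop :=
  forall a a' b b', c1_bump a a' -> c1_bump b b' ->
    (\int[m2]_z (f z * (a' z.1 * b z.2))%:E = - \int[m2]_z (g z * (a z.1 * b z.2))%:E)%E.

Lemma weak_partial1 (f g : R * R -> R) : weak_deriv (e1 R) f g -> weak_partial f g.
Proof.
move=> fg a a' b b' ba bb; have := fg _ (testfun_tensor ba bb); rewrite /leb2 => <-.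
apply: eq_integral => z _; congr ((_ * _)%:E).
by have [da _ _] := ba; rewrite (@pd1_tensor _ _ _ b da z).2.
Qed.

(** For a fixed bump a, the function of y obtained by integrating in x is annihilated by all bumps
    in y, hence vanishes at its Lebesgue points. The null set depends on a. *)
Lemma ae_slice_weak (f g : R * R -> R) (a a' : R -> R) :
  L2 f -> L2 g -> weak_partial f g -> c1_bump a a' ->
  {ae mu, forall y, (\int[mu]_x (f (x, y) * a' x + g (x, y) * a x)%:E = 0)%E}.
Proof.
move=> f2 g2 fg ba.
have mf := L2_measurable f2; have mg := L2_measurable g2.
have [ma ma'] := c1_bump_measurable ba.
have [da ca' [Ma [Ca bda]]] := ba.
suff H (N : nat) : {ae mu, forall y, `|y| < N%:R ->
    (\int[mu]_x (f (x, y) * a' x + g (x, y) * a x)%:E = 0)%E}.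
  have := ae_foralln H; apply: ae_impl => y /(_ (Num.truncn `|y|).+1); apply.
  exact: truncnS_gt.
(* f and g are only square integrable, so the integrand becomes integrable over the plane only once
   y is restricted to a bounded interval. *)
pose X : R -> R := \1_(`[- N%:R, N%:R]%classic).
have mX : measurable_fun setT X by exact: measurable_indic.
have X1 y : `|X y| <= 1 by rewrite /X indicE; case: (_ \in _); rewrite ?normr0 ?normr1.
have X0 y : N%:R < `|y| -> X y = 0.
  move=> Ny; rewrite /X indicE memNset//= in_itv/= -ler_norml.
  by move: Ny; rewrite ltNge => /negP.
have XE y : `|y| <= N%:R -> X y = 1.
  by move=> Ny; rewrite /X indicE mem_set//= in_itv/= -ler_norml.
have L2a (b : R -> R) C : measurable_fun setT b -> (forall x, `|b x| <= C) ->
    (forall x, N%:R < `|x| -> b x = 0) ->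
    L2 (fun z => a z.1 * b z.2) /\ L2 (fun z => a' z.1 * b z.2).
  move=> mb bC b0.
  split; apply: (@tensor_L2 _ _ (Num.max Ma N%:R) (Num.max Ca C)) => // x;
    rewrite ?gt_max ?le_max.
  - by have [_ ->] := bda x.
  - by rewrite bC orbT.
  - by move=> /andP[l _]; have [/(_ l)[]] := bda x.
  - by move=> /andP[_ /b0].
  - by have [_ _ ->] := bda x.
  - by rewrite bC orbT.
  - by move=> /andP[l _]; have [/(_ l)[]] := bda x.
  - by move=> /andP[_ /b0].
have [L2X L2X'] := L2a X 1 mX X1 X0.
pose h z := f z * (a' z.1 * X z.2) + g z * (a z.1 * X z.2).
have ih : m2.-integrable setT (fun z => (h z)%:E).
  by apply: (integrableD _ (integrable_L2M f2 L2X') (integrable_L2M g2 L2X)).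
pose k y := (\int[mu]_x (h (x, y))%:E)%E.
have mh : measurable_fun setT (fun z => (h z)%:E) by exact: measurable_int ih.
have ik : mu.-integrable setT k.
  apply/integrableP; split; first exact: measurable_fubini_G ih.
  apply: le_lt_trans ((integrable21ltyP mu mu mh).1 ih).
  apply: ge0_le_integral => //.
  - by apply: measurableT_comp => //; exact: measurable_fubini_G ih.
  - by apply: (@measurable_fun_fubini_tonelli_G _ _ _ _ _ mu (fun z => `|(h z)%:E|%E)) => //; exact: measurableT_comp.
  - move=> y _; apply: le_abse_integral => //.
    by apply: measurableT_comp mh _.
pose kr y := fine (k y).
have mkr : measurable_fun setT kr.
  by apply: measurableT_comp => //; exact: measurable_int ik.
have ikr : mu.-integrable setT (fun y => (kr y)%:E).
  apply: le_integrable ik => //; first exact: measurable_EFin.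
  by move=> y _; rewrite /kr; case: (k y) => [r| |]//=; rewrite ?normr0 ?leey.
have lkr : locally_integrable setT kr.
  by apply: open_integrable_locally => //; exact: openT.
have kfin : {ae mu, forall y, k y \is a fin_num}.
  by have := integrable_ae measurableT ik; apply: ae_impl => y; apply.
(* A bump supported in [-N, N] does not see the cut-off, so the weak derivative in the plane applies
   to it. *)
have key b b' : c1_bump b b' -> (forall y, N%:R < `|y| -> b y = 0) ->
    (\int[mu]_y (kr y * b y)%:E = 0)%E.
  move=> bb b0; have [mb mb'] := c1_bump_measurable bb.
  have [db cb' [Mb [Cb bdb]]] := bb.
  have bC x : `|b x| <= Cb by have [] := bdb x.
  have [L2b L2b'] := L2a b Cb mb bC b0.
  have mb2 : measurable_fun setT (fun z : R * R => b z.2) by exact: measurableT_comp.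
  have ihb : m2.-integrable setT (fun z => (h z * b z.2)%:E).
    by apply: (integrable_boundedM ih mb2 (C := Cb)) => z; exact: bC.
  have e1' : (\int[mu]_y (kr y * b y)%:E = \int[m2]_z (h z * b z.2)%:E)%E.
    rewrite -(integral21_prod_meas1 ihb); apply: ae_eq_integral => //.
    - by apply: measurable_EFin; exact: measurable_funM.
    - exact: measurable_fubini_G ihb.
    - have := ae_integrable2 ih; apply: ae_impl => y iy _; rewrite /fubini_G /=.
      under eq_integral do rewrite EFinM.
      rewrite integralZr// EFinM; congr (_ * _)%E; rewrite /kr fineK//.
      exact: integrable_fin_num.
  rewrite e1'; have fgE := fg _ _ _ _ ba bb.
  have if1 := integrable_L2M f2 L2b'; have ig1 := integrable_L2M g2 L2b.
  transitivity (\int[m2]_z ((f z * (a' z.1 * b z.2))%:E + (g z * (a z.1 * b z.2))%:E))%E.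
    apply: eq_integral => z _; rewrite -EFinD /h; congr (_%:E).
    have [/b0 ->|/XE ->] := ltP N%:R `|z.2|; ring.
  by rewrite integralD// fgE addeC subee//; exact: integrable_fin_num.
have lp := @lebesgue_differentiation R kr lkr.
apply: ae_impl2 kfin lp => y yfin ylp yN.
have kr0 : kr y = 0.
  (* The radius N - |y| keeps every tested bump inside [-N, N]. *)
  apply: (@lebesgue_pt_bump_eq0 _ _ _ (N%:R - `|y|)) => //; first by rewrite subr_gt0.
  move=> b b' bb b0; apply: key bb _ => t tN; apply: b0.
  by rewrite lerBlDr; apply: le_trans (ltW tN) _; rewrite -{1}(subrK y t) ler_normD.
transitivity (k y); last by rewrite -(fineK yfin) -/(kr y) kr0.
by apply: eq_integral => x _; rewrite /h /= XE ?mulr1// ltW.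
Qed.

End slicing.

(** * Recovering a primitive from weak identities on a line *)

Section slice_1d.
Context {R : realType}.
Local Notation mu := (@lebesgue_measure R).

Lemma primitive_of_C1 (F f : R -> R) : (forall x : R, is_derive x 1 F (f x)) ->
  continuous f -> primitive_of F f.
Proof.
move=> dF cf; have cF x : {for x, continuous F} by exact: is_derive_continuous (dF x).
split; first exact: continuous_measurable_fun.
  move=> x y; apply: continuous_compact_integrable; first exact: segment_compact.
  by apply: continuous_subspaceT => t; exact: cf.
move=> x y; rewrite le_eqVlt => /predU1P[->|xy].
  by rewrite subrr set_itv1 Rintegral_set1.
rewrite /Rintegral (@continuous_FTC2 _ f F)//.
- by apply: continuous_subspaceT => t; exact: cf.
- split; first by move=> t _; exact: ex_derive.
    by apply: cvg_at_right_filter; exact: cF.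
  by apply: cvg_at_left_filter; exact: cF.
- by move=> t _; rewrite derive1E; exact: derive_val.
Qed.

Lemma cut_integrable (h K : R -> R) (M C : R) :
  mu.-integrable `[- M, M] (fun s => (h s)%:E) -> measurable_fun setT h ->
  measurable_fun setT K -> (forall x, `|K x| <= C) -> (forall x, M < `|x| -> K x = 0) ->
  mu.-integrable setT (fun s => (h s * K s)%:E).
Proof.
move=> hi mh mK KC K0.
have hi' : mu.-integrable setT (fun s => (h s * \1_(`[- M, M]%classic : set R) s)%:E).
  have := (integrable_mkcond (mu := mu) (D := `[- M, M]%classic) (fun s => (h s)%:E)
    (measurable_itv _)).1 hi.
  apply: eq_integrable => // s _; rewrite patchE indicE.
  by case: ifP => _; rewrite ?mulr1 ?mulr0.
have := integrable_boundedM hi' mK KC.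
apply: eq_integrable => // s _; congr (_%:E); rewrite -mulrA; congr (_ * _).
have [/K0 ->|sM] := ltP M `|s|; first by rewrite mulr0.
by rewrite indicE mem_set ?mul1r//= in_itv/= -ler_norml.
Qed.

(** Dominated convergence in which uniform boundedness and a common support of the kernels replace
    global integrability of h. *)
Lemma cut_cvg (h : R -> R) (K_ : nat -> R -> R) (K : R -> R) (M C : R) :
  mu.-integrable `[- M, M] (fun s => (h s)%:E) -> measurable_fun setT h ->
  (forall k, measurable_fun setT (K_ k)) -> measurable_fun setT K ->
  (forall k x, `|K_ k x| <= C) -> (forall k x, M < `|x| -> K_ k x = 0) ->
  (forall x, K_ k x @[k --> \oo] --> K x) ->
  \int[mu]_s (h s * K_ k s) @[k --> \oo] --> \int[mu]_s (h s * K s).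
Proof.
move=> hi mh mK_ mK KC K0 KK.
have ind1 : measurable_fun setT (\1_(`[- M, M]%classic : set R) : R -> R).
  exact: measurable_indic.
have C0 : 0 <= C by exact: le_trans (KC 0%N 0).
have gi : mu.-integrable setT (fun s => (h s * (C * \1_(`[- M, M]%classic : set R) s))%:E).
  apply: (cut_integrable (M := M) (C := C) hi) => //.
  - exact: measurable_funM.
  - move=> x; rewrite indicE; case: (_ \in _); rewrite ?mulr1 ?mulr0 ?normr0//.
    by rewrite ger0_norm.
  - move=> x xM; rewrite indicE memNset ?mulr0//= in_itv/= -ler_norml.
    by move: xM; rewrite ltNge => /negP.
have gi2 := integrable_abse gi.
have mk k : measurable_fun setT (fun s => (h s * K_ k s)%:E).
  by apply/measurable_EFin/measurable_funM.
have mK' : measurable_fun setT (fun s => (h s * K s)%:E).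
  by apply/measurable_EFin/measurable_funM.
have fE : {ae mu, forall x, setT x -> (h x * K_ k x)%:E @[k --> \oo] --> (h x * K x)%:E}.
  apply: aeW => x _; apply: cvg_EFin; first exact: nearW.
  by apply: cvgM; [exact: cvg_cst|exact: KK].
have fb : {ae mu, forall x k, setT x ->
    (`|(h x * K_ k x)%:E| <= `|(h x * (C * \1_(`[- M, M]%classic : set R) x))%:E|)%E}.
  apply: aeW => x k _ /=; rewrite lee_fin !normrM ler_wpM2l// (ger0_norm C0).
  have [/K0 ->|xM] := ltP M `|x|; first by rewrite normr0 mulr_ge0.
  by rewrite indicE mem_set ?normr1 ?mulr1//= in_itv/= -ler_norml.
have [ii _ cv] := @dominated_convergence _ _ _ mu _ (@measurableT _ _) _ _ _ mk mK' fE gi2 fb.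
rewrite /Rintegral; apply: fine_cvg.
by rewrite fineK//; exact: integrable_fin_num.
Qed.

(** The mass of the tent is the total rise of its primitive [step]. *)
Lemma integral_hat e a : 0 < e -> \int[mu]_x hat e (x - a) = 1.
Proof.
move=> e0.
have pr : primitive_of (fun x : R => step e (x - a)) (fun x => hat e (x - a)).
  apply: primitive_of_C1.
    by move=> x; apply: is_derive_subr; exact: is_derive_step.
  move=> x; apply: (@continuous_comp _ _ _ (fun x => x - a) (hat e)).
    by apply: cvgB; [exact: cvg_id|exact: cvg_cst].
  exact: continuous_hat.
have [_ _ /(_ a (a + 2 * e))] := pr.
rewrite [X in X - _]step_ge//; last lra.
rewrite step_le0//; last lra.
rewrite subr0 => -> //; last lra.
rewrite [RHS]Rintegral_mkcond; apply: eq_Rintegral => x _; rewrite patchE mem_setE in_itv/=.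
have [ax|ax] := leP a x; last by rewrite hat_le0//; lra.
have [xa|xa] := leP x (a + 2 * e) => //=.
by rewrite hat_ge//; lra.
Qed.

(* Only countably many bumps are tested, so that one null set of lines serves all of them
   when the lemma is applied to slices; at a Lebesgue point a of f, letting the
   width 1/(n+1) tend to 0 recovers f a as a primitive of g. *)
Lemma slice_primitive (f g : R -> R) :
  measurable_fun setT f -> measurable_fun setT g ->
  (forall M, mu.-integrable `[- M, M] (fun s => (f s)%:E)) ->
  (forall M, mu.-integrable `[- M, M] (fun s => (g s)%:E)) ->
  (forall (q : rat) (n : nat), (\int[mu]_x (f x * (hat n.+1%:R^-1 (x - ratr q) - hat 1 (x - 0)) +
      g x * (step n.+1%:R^-1 (x - ratr q) - step 1 (x - 0)))%:E = 0)%E) ->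
  exists2 F, primitive_of F g & {ae mu, forall x, f x = F x}.
Proof.
move=> mf mg fi gi fg.
pose e n : R := n.+1%:R^-1.
have e0 n : 0 < e n by rewrite invr_gt0.
have e1 n : e n <= 1 by rewrite invf_le1// ler1n.
(* [L] is the test function and [K] its derivative. The moving step at a is the one that shrinks;
   the fixed step at 0 of width 2 only makes the support compact. *)
pose K a n x := hat (e n) (x - a) - hat 1 (x - 0).
pose L a n x := step (e n) (x - a) - step 1 (x - 0).
have cs d c : 0 < d -> continuous (fun x : R => step d (x - c)).
  move=> d0 x; apply: (@is_derive_continuous _ _ _ (hat d (x - c))).
  by apply: is_derive_subr; exact: is_derive_step.
have ch d c : continuous (fun x : R => hat d (x - c)).
  move=> x; apply: (@continuous_comp _ _ _ (fun x => x - c) (hat d)).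
    by apply: cvgB; [exact: cvg_id|exact: cvg_cst].
  exact: continuous_hat.
have mh d c : measurable_fun setT (fun x : R => hat d (x - c)).
  by apply: continuous_measurable_fun; exact: ch.
have ms d c : 0 < d -> measurable_fun setT (fun x : R => step d (x - c)).
  by move=> d0; apply: continuous_measurable_fun; exact: cs.
have mK a n : measurable_fun setT (K a n) by exact: measurable_funB.
have mL a n : measurable_fun setT (L a n) by apply: measurable_funB; apply: ms.
have KC a n x : `|K a n x| <= (e n)^-1 + 1.
  have := @hat_ge0 _ (e n) (x - a) (e0 n); have := @hat_le _ (e n) (x - a) (e0 n).
  have := @hat_ge0 _ 1 (x - 0) ltr01; have := @hat_le _ 1 (x - 0) ltr01.
  have : 0 < (e n)^-1 by rewrite invr_gt0.
  by rewrite /K invr1 => *; rewrite ler_norml; apply/andP; split; lra.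
have LC a n x : `|L a n x| <= 1.
  have := @step_ge0 _ (e n) (x - a) (e0 n); have := @step_le1 _ (e n) (x - a) (e0 n).
  have := @step_ge0 _ 1 (x - 0) ltr01; have := @step_le1 _ 1 (x - 0) ltr01.
  by rewrite /L => *; rewrite ler_norml; apply/andP; split; lra.
(* Each ramp has width at most 2, so both are over before |a| + 4. *)
have KL0 a n x : `|a| + 4 < `|x| -> K a n x = 0 /\ L a n x = 0.
  rewrite /K /L; have := e1 n; have := e0 n; move: (e n) => d d0 d1.
  have := ler_norm a; have := ler_norm (- a); rewrite normrN => ??.
  case: (leP 0 x) => x0; rewrite ?(ger0_norm x0) ?(ltr0_norm x0) => Mx.
    by rewrite !step_ge ?hat_ge ?subrr//; lra.
  by rewrite !step_le0 ?hat_le0 ?subrr//; lra.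
(* The tested identity is continuous in the centre a, so it passes from rational to real centres by
   density and dominated convergence. *)
have all_a a n : \int[mu]_x (f x * K a n x) + \int[mu]_x (g x * L a n x) = 0.
  have /(_ _)/cid/= q_ (k : nat) : exists q : rat, `|ratr q - a| < k.+1%:R^-1.
    have [|q] := @rat_in_itvoo R (a - k.+1%:R^-1) (a + k.+1%:R^-1).
      by rewrite ltrBlDr -addrA ltrDl addr_gt0 ?invr_gt0.
    by rewrite in_itv/= => /andP[q1 q2]; exists q; rewrite ltr_distl q1 q2.
  pose q k := sval (q_ k).
  have qa : ratr (q k) @[k --> \oo] --> a.
    apply/cvgrPdist_lt => eps eps0; near=> k.
    rewrite distrC; apply: lt_trans (svalP (q_ k)) _; near: k.
    exact: near_infty_natSinv_lt (PosNum eps0).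
  pose M := `|a| + 5.
  have qM k (x : R) : M < `|x| -> `|(ratr (q k) : R)| + 4 < `|x|.
    apply: le_lt_trans; rewrite /M.
    have tri (r : R) : `|r - a| < 1 -> `|r| + 4 <= `|a| + 5.
      have := ler_normD (r - a) a; rewrite subrK; lra.
    apply: tri; apply: lt_le_trans (svalP (q_ k)) _.
    by rewrite invf_le1// ler1n.
  have c1 : \int[mu]_s (f s * K (ratr (q k)) n s) @[k --> \oo] --> \int[mu]_s (f s * K a n s).
    apply: (cut_cvg (M := M) (C := (e n)^-1 + 1)) => //.
      by move=> k x xM; have [] := KL0 (ratr (q k)) n x (qM k x xM).
    move=> x; apply: cvgB; last exact: cvg_cst.
    have cq : x - ratr (q k) @[k --> \oo] --> x - a by apply: cvgB => //; exact: cvg_cst.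
    by apply: cvg_comp cq _; exact: continuous_hat.
  have c2 : \int[mu]_s (g s * L (ratr (q k)) n s) @[k --> \oo] --> \int[mu]_s (g s * L a n s).
    apply: (cut_cvg (M := M) (C := 1)) => //.
      by move=> k x xM; have [] := KL0 (ratr (q k)) n x (qM k x xM).
    move=> x; apply: cvgB; last exact: cvg_cst.
    have cq : x - ratr (q k) @[k --> \oo] --> x - a by apply: cvgB => //; exact: cvg_cst.
    apply: cvg_comp cq _; apply: is_derive_continuous; exact: is_derive_step.
  have cS : \int[mu]_s (f s * K (ratr (q k)) n s) + \int[mu]_s (g s * L (ratr (q k)) n s)
     @[k --> \oo] --> \int[mu]_s (f s * K a n s) + \int[mu]_s (g s * L a n s).
    by apply: cvgD.
  rewrite -(cvg_lim (@Rhausdorff _) cS); apply: cvg_lim => //.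
  apply: cvg_near_cst; apply: nearW => k.
  rewrite -RintegralD//; last 2 first.
    - apply: (cut_integrable (M := M) (C := (e n)^-1 + 1)) => //.
      by move=> x xM; have [] := KL0 (ratr (q k)) n x (qM k x xM).
    - apply: (cut_integrable (M := M) (C := 1)) => //.
      by move=> x xM; have [] := KL0 (ratr (q k)) n x (qM k x xM).
  by rewrite /Rintegral fg.
(* The pointwise limit of [L a n]. The Heaviside part is 0 at x = a itself, as [step] vanishes at
   0. *)
pose H (a x : R) : R := (~~ (x <= a)%R)%:R - step 1 (x - 0).
have mH a : measurable_fun setT (H a).
  apply: measurable_funB; last exact: ms.
  have -> : (fun x : R => (~~ (x <= a)%R)%:R : R) = (fun x => 1 - (x <= a)%R%:R).
    by apply/funext => x; case: (x <= a); rewrite ?subrr ?subr0.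
  by apply: measurable_funB => //; exact: measurable_le_indic.
have H0 a x : `|a| + 4 < `|x| -> H a x = 0.
  rewrite /H; have := ler_norm a; have := ler_norm (- a); rewrite normrN => ??.
  case: (leP 0 x) => x0; rewrite ?(ger0_norm x0) ?(ltr0_norm x0) => Mx.
    rewrite step_ge//; last lra.
    by have [?|_] := leP x a; [lra|rewrite subrr].
  rewrite step_le0//; last lra.
  by have [_|?] := leP x a; [rewrite subrr|lra].
have H1 a x : `|H a x| <= 1.
  have := @step_ge0 _ 1 (x - 0) ltr01; have := @step_le1 _ 1 (x - 0) ltr01.
  rewrite /H => ??; rewrite ler_norml; apply/andP.
  by case: (x <= a) => /=; split; lra.
have iH a : mu.-integrable setT (fun s => (g s * H a s)%:E).
  by apply: (cut_integrable (M := `|a| + 4) (C := 1)) => //; exact: H0.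
have LH a x : L a n x @[n --> \oo] --> H a x.
  apply: cvgB; last exact: cvg_cst.
  have [xa|ax] := leP x a => /=.
    apply: cvg_near_cst; apply: nearW => n.
    by rewrite step_le0//; lra.
  have xa0 : 0 < (x - a) / 2 by rewrite divr_gt0// subr_gt0.
  apply: cvg_near_cst; near=> n; rewrite step_ge//.
  have : e n < (x - a) / 2.
    by near: n; exact: near_infty_natSinv_lt (PosNum xa0).
  lra.
(* In the limit of small width, the tested identity becomes f a - c + (integral of g H_a) = 0;
   solving it for f a dictates the definition of [F]. *)
pose c := \int[mu]_x (f x * hat 1 (x - 0)).
pose F a := c - \int[mu]_x (g x * H a x).
exists F.
  split => //.
    move=> x y; pose M := Num.max (- x) y.
    apply: integrableS (gi M) => // t /=; rewrite !in_itv/= => /andP[xt ty].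
    by rewrite /M; case: (leP (- x) y) => ?; apply/andP; split; lra.
  move=> x y xy; rewrite /F.
  (* H_x - H_y is the indicator of ]x, y], because the fixed step cancels. *)
  have -> : c - \int[mu]_x0 (g x0 * H y x0) - (c - \int[mu]_x0 (g x0 * H x x0)) =
     \int[mu]_x0 (g x0 * H x x0) - \int[mu]_x0 (g x0 * H y x0) by ring.
  rewrite -RintegralB; [|by []|exact: iH|exact: iH].
  have oc : \int[mu]_(s in `]x, y]) g s = \int[mu]_(s in `[x, y]) g s.
    apply: Rintegral_itv_obnd_cbnd; pose M := Num.max (- x) y.
    apply: integrableS (gi M) => // t /=; rewrite !in_itv/= => /andP[/ltW xt ty].
    by rewrite /M; case: (leP (- x) y) => ?; apply/andP; split; lra.
  rewrite -oc.
  rewrite [RHS]Rintegral_mkcond; apply: eq_Rintegral => t _.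
  rewrite patchE mem_setE in_itv/= /H.
  have [tx|xt] := leP t x; have [ty|yt] := leP t y => /=.
  - by rewrite subrr.
  - by exfalso; lra.
  - by ring.
  - by rewrite subrr.
have lf : locally_integrable setT f.
  split => //; first exact: openT.
  move=> A _ cA; have [M [_ HM]] := compact_bounded cA.
  have AM : A `<=` `[- (M + 1), M + 1].
    move=> x Ax /=; rewrite in_itv/= -ler_norml.
    by apply: (HM (M + 1)) => //; lra.
  have /integrableP[_] := fi (M + 1).
  apply: le_lt_trans; apply: ge0_subset_integral => //.
  - exact: compact_measurable.
  - by apply/measurable_EFin/measurable_funTS/measurableT_comp.
have := @lebesgue_differentiation R f lf.
apply: ae_impl => a lpa.
have hatI n : mu.-integrable setT (fun x => (hat (e n) (x - a))%:E).
  have : mu.-integrable setT (fun s => (cst 1 s * hat (e n) (s - a))%:E).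
    apply: (cut_integrable (M := `|a| + 4) (C := (e n)^-1)) => //.
    - apply: continuous_compact_integrable; first exact: segment_compact.
      by apply: continuous_subspaceT => t; exact: cvg_cst.
    - by move=> x; rewrite ger0_norm ?hat_ge0// hat_le.
    - move=> x; have := e1 n; have := e0 n; move: (e n) => d d0 d1.
      have := ler_norm a; have := ler_norm (- a); rewrite normrN => ??.
      case: (leP 0 x) => x0; rewrite ?(ger0_norm x0) ?(ltr0_norm x0) => Mx.
        by rewrite hat_ge//; lra.
      by rewrite hat_le0//; lra.
  by apply: eq_integrable => // s _; rewrite /= mul1r.
have fhatI n : mu.-integrable setT (fun x => (f x * hat (e n) (x - a))%:E).
  apply: (cut_integrable (M := `|a| + 4) (C := (e n)^-1)) => //.
  - by move=> x; rewrite ger0_norm ?hat_ge0// hat_le.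
  - move=> x; have := e1 n; have := e0 n; move: (e n) => d d0 d1.
    have := ler_norm a; have := ler_norm (- a); rewrite normrN => ??.
    case: (leP 0 x) => x0; rewrite ?(ger0_norm x0) ?(ltr0_norm x0) => Mx.
      by rewrite hat_ge//; lra.
    by rewrite hat_le0//; lra.
have chat : \int[mu]_x (f x * hat (e n) (x - a)) @[n --> \oo] --> f a.
  apply/cvgrPdist_le => eps eps0.
  have eps20 : 0 < eps / 2 by rewrite divr_gt0.
  have [rho rho0 Hr] := lebesgue_pt_kernel mf lpa eps20.
  have rho20 : 0 < rho / 2 by rewrite divr_gt0.
  near=> n.
  have en : 2 * e n < rho.
    have : e n < rho / 2.
      by near: n; exact: near_infty_natSinv_lt (PosNum rho20).
    lra.
  have en0 := e0 n.
  (* Over its support of length r = 2e the tent reaches 1/e = 2/r, so it is halved to satisfy the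
     bound 1/r of [lebesgue_pt_kernel]. *)
  have := Hr (2 * e n) (fun x => hat (e n) (x - a) / 2).
  have h1 : 0 < 2 * e n by lra.
  have h2 : measurable_fun setT (fun x : R => hat (e n) (x - a) / 2) by exact: measurable_funM.
  have h3 s : `|hat (e n) (s - a) / 2| <= (2 * e n)^-1.
    have := @hat_ge0 _ (e n) (s - a) en0; have := @hat_le _ (e n) (s - a) en0.
    by move=> q1 q2; rewrite invfM ger0_norm; lra.
  have h4 s : 2 * e n <= `|s - a| -> hat (e n) (s - a) / 2 = 0.
    case: (leP 0 (s - a)) => x0; rewrite ?(ger0_norm x0) ?(ltr0_norm x0) => Mx.
      by rewrite hat_ge ?mul0r.
    by rewrite hat_le0 ?mul0r//; lra.
  move=> /(_ h1 en h2 h3 h4) le1.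
  have hai : mu.-integrable setT (fun x => (f a * hat (e n) (x - a))%:E).
    by apply: (integrableZl _ (f a) (hatI n)).
  have -> : f a - \int[mu]_x (f x * hat (e n) (x - a)) =
      - \int[mu]_x (f x * hat (e n) (x - a) - f a * hat (e n) (x - a)).
    have -> : \int[mu]_x (f x * hat (e n) (x - a) - f a * hat (e n) (x - a)) =
        \int[mu]_x (f x * hat (e n) (x - a)) - \int[mu]_x (f a * hat (e n) (x - a)).
      by apply: (RintegralB _ (fhatI n) hai); exact: measurableT.
    have -> : \int[mu]_x (f a * hat (e n) (x - a)) = f a * \int[mu]_x hat (e n) (x - a).
      by rewrite RintegralZl; [by []|by []|exact: hatI].
    by rewrite integral_hat//; ring.
  rewrite normrN.
  have ii : mu.-integrable setT (fun x => (f x * hat (e n) (x - a) - f a * hat (e n) (x - a))%:E).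
    by apply: (integrableB _ (fhatI n) hai).
  have fin := integrable_fin_num measurableT ii.
  rewrite /Rintegral -lee_fin -abse_EFin fineK//.
  apply: le_trans (le_abse_integral _ _ _) _ => //; first exact: measurable_int ii.
  have -> : (\int[mu]_x `|(f x * hat (e n) (x - a) - f a * hat (e n) (x - a))%:E| =
     2%:E * \int[mu]_s `|((f s - f a) * (hat (e n) (s - a) / 2))%:E|)%E.
    rewrite -ge0_integralZl_EFin//; last first.
      by apply/measurable_EFin/measurableT_comp => //; apply: measurable_funM => //; exact: measurable_funB.
    apply: eq_integral => s _; rewrite !abse_EFin -EFinM; congr (_%:E).
    have -> : f s * hat (e n) (s - a) - f a * hat (e n) (s - a) =
      2 * ((f s - f a) * (hat (e n) (s - a) / 2)) by field.
    by rewrite normrM ger0_norm.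
  apply: le_trans (lee_wpmul2l _ le1) _ => //.
  by rewrite -EFinM lee_fin; lra.
have cL : \int[mu]_x (g x * L a n x) @[n --> \oo] --> \int[mu]_x (g x * H a x).
  apply: (cut_cvg (M := `|a| + 4) (C := 1)) => //.
  by move=> n x xM; have [] := KL0 a n x xM.
have hat1I : mu.-integrable setT (fun x => (f x * hat 1 (x - 0))%:E).
  apply: (cut_integrable (M := 4) (C := 1)) => //.
  - by move=> x; rewrite ger0_norm ?hat_ge0// (le_trans (hat_le _ _))// invr1.
  - move=> x; case: (leP 0 x) => x0; rewrite ?(ger0_norm x0) ?(ltr0_norm x0) => Mx.
      by rewrite hat_ge//; lra.
    by rewrite hat_le0//; lra.
have cS : \int[mu]_x (f x * hat (e n) (x - a)) + \int[mu]_x (g x * L a n x)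
    @[n --> \oo] --> f a + \int[mu]_x (g x * H a x) by apply: cvgD.
have cE : c = f a + \int[mu]_x (g x * H a x).
  rewrite -(cvg_lim (@Rhausdorff _) cS); apply/esym/cvg_lim => //.
  apply: cvg_near_cst; apply: nearW => n; have := all_a a n.
  have -> : \int[mu]_x (f x * K a n x) = \int[mu]_x (f x * hat (e n) (x - a)) - c.
    by rewrite -RintegralB; [apply: eq_Rintegral => x _; rewrite -mulrBr|by []|exact: fhatI|exact: hat1I].
  by move=> h; apply/eqP; rewrite -subr_eq0; apply/eqP; rewrite -{}h; ring.
by rewrite /F cE addrK.
Unshelve. all: by end_near. Qed.

End slice_1d.

(** * Pointwise bounds on almost every line, and exchange of coordinates *)

Section a_e_slices.
Context {R : realType}.
Local Notation mu := (@lebesgue_measure R).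
Local Notation m2 := (mu \x mu)%E.

Lemma measurable_slice1 (f : R * R -> R) (y : R) : measurable_fun setT f ->
  measurable_fun setT (fun x => f (x, y)).
Proof. by move=> mf; exact: measurable_fun_pair1. Qed.

Lemma sqr_integrable_itv (f : R -> R) M : measurable_fun setT f ->
  mu.-integrable setT (fun x => (f x ^+ 2)%:E) ->
  mu.-integrable `[- M, M] (fun x => (f x)%:E).
Proof.
move=> mf f2; have i1 : mu.-integrable `[- M, M] (fun x : R => (1 : R)%:E).
  apply: continuous_compact_integrable; first exact: segment_compact.
  by apply: continuous_subspaceT => t; exact: cvg_cst.
have i2 : mu.-integrable `[- M, M] (fun x => (f x ^+ 2)%:E).
  exact: integrableS f2.
have i3 : mu.-integrable `[- M, M] (fun x => (1 + f x ^+ 2)%:E).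
  by apply: (integrableD _ i1 i2); exact: measurable_itv.
apply: le_integrable i3 => //; first by apply/measurable_EFin/measurable_funTS.
move=> x _ /=; rewrite lee_fin (le_trans _ (ler_norm _))// ler_norml.
by apply/andP; split; nra.
Qed.

Lemma ae_slice_sqr_integrable (f : R * R -> R) : L2 f ->
  {ae mu, forall y, mu.-integrable setT (fun x => (f (x, y) ^+ 2)%:E)}.
Proof. by move=> f2; exact: ae_integrable2 (L2_integrable_sqr f2). Qed.

(** The bumps demanded by [slice_primitive] are indexed by pairs (q, n); coding the pairs by natural
    numbers merges their exceptional sets into one null set of lines. *)
Lemma ae_slice_primitive (f g : R * R -> R) : L2 f -> L2 g -> weak_partial f g ->
  {ae mu, forall y, exists2 F, primitive_of F (fun x => g (x, y)) &
     {ae mu, forall x, f (x, y) = F x}}.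
Proof.
move=> f2 g2 fg.
have mf := L2_measurable f2; have mg := L2_measurable g2.
have H (k : nat) : {ae mu, forall y, forall q n, unpickle k = Some (q, n) ->
   (\int[mu]_x (f (x, y) * (hat n.+1%:R^-1 (x - ratr (q : rat)) - hat 1 (x - 0)) +
      g (x, y) * (step n.+1%:R^-1 (x - ratr q) - step 1 (x - 0)))%:E = 0)%E}.
  case: (unpickle k) => [[q n]|]; last by apply: aeW.
  have n0 : 0 < n.+1%:R^-1 :> R by rewrite invr_gt0.
  have := ae_slice_weak f2 g2 fg (c1_bump_step (ratr q) 0 n0 ltr01).
  by apply: ae_impl => y hy q' n' [<- <-].
have {}H := ae_foralln H.
have fi := ae_slice_sqr_integrable f2; have gi := ae_slice_sqr_integrable g2.
have fgi := @filterI _ _ (ae_filter_ringOfSetsType mu) _ _ fi gi.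
apply: (ae_impl2 _ H fgi) => y Hy [fiy giy].
apply: slice_primitive.
- exact: measurable_slice1.
- exact: measurable_slice1.
- by move=> M; apply: sqr_integrable_itv => //; exact: measurable_slice1.
- by move=> M; apply: sqr_integrable_itv => //; exact: measurable_slice1.
- by move=> q n; apply: (Hy (pickle (q, n))); rewrite pickleK.
Qed.

(** The line has infinite measure, so an integrable h cannot stay above e almost everywhere. The
    extra property P lets the point be chosen where an almost everywhere identity holds. *)
Lemma ae_small (h : R -> R) (P : R -> Prop) (e : R) :
  measurable_fun setT h -> (forall x, 0 <= h x) ->
  mu.-integrable setT (fun x => (h x)%:E) -> {ae mu, forall x, P x} -> 0 < e ->
  exists2 a, P a & h a < e.
Proof.
move=> mh h0 hi aeP e0; apply: contrapT => no.
have aege : {ae mu, forall x, setT x -> (e%:E <= (h x)%:E)%E}.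
  apply: ae_impl aeP => x Px _; rewrite lee_fin leNgt; apply/negP => hx.
  by apply: no; exists x.
have : (\int[mu]_x (cst e%:E x) <= \int[mu]_x (h x)%:E)%E.
  apply: ae_ge0_le_integral => // [x _|x _|].
  - by rewrite lee_fin ltW.
  - by rewrite lee_fin.
  - exact: measurable_EFin.
rewrite integral_cst// => hle.
have muT : mu [set: R] = +oo%E by rewrite -set_itvNyy lebesgue_measure_itv.
have : (e%:E * mu [set: R] <= \int[mu]_x (h x)%:E)%E by exact: hle.
rewrite muT gt0_muley ?lte_fin// leye_eq => /eqP hE.
by have /integrableP[_] := hi; under eq_integral do rewrite abse_EFin ger0_norm//; rewrite hE.
Qed.

(** On a good line f agrees with an absolutely continuous F, so f^(n+1) has the primitive derivative
    (n+1) f^n g, and square integrability of the slice supplies points where F is small. *)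
Lemma ae_slice_power (f g : R * R -> R) (n : nat) : L2 f -> L2 g -> weak_partial f g ->
  {ae mu, forall y, {ae mu, forall x, (`|f (x, y) ^+ n.+1|%:E <=
     \int[mu]_s (n.+1%:R * `|f (s, y) ^+ n * g (s, y)|)%:E)%E}}.
Proof.
move=> f2 g2 fg; have mf := L2_measurable f2; have mg := L2_measurable g2.
have fi := ae_slice_sqr_integrable f2.
have pr := ae_slice_primitive f2 g2 fg.
apply: (ae_impl2 _ fi pr) => y fiy [F pF fF].
have pW := primitive_ofX n pF.
have := primitive_of_sup pW => /(_ _)/wrap[].
  move=> e e0.
  (* Below 1 a higher power is smaller than |f|, so smallness of |f| suffices for every n. *)
  have e10 : 0 < Num.min e 1 by rewrite lt_min e0 ltr01.
  have e20 : 0 < Num.min e 1 ^+ 2 by rewrite exprn_gt0.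
  have [||a fa sa] := ae_small _ _ fiy fF e20.
  - by apply: measurable_funX; exact: measurable_slice1.
  - by move=> x; exact: sqr_ge0.
  exists a; rewrite normrX -fa.
  have fle : `|f (a, y)| < Num.min e 1.
    by rewrite -(@ltr_pXn2r _ 2)// ?nnegrE ?normr_ge0 ?(ltW e10)// real_normK ?num_real.
  have f1 : `|f (a, y)| <= 1 by apply: (le_trans (ltW fle)); rewrite ge_min lexx orbT.
  apply: (@le_lt_trans _ _ `|f (a, y)|).
    by rewrite exprS ler_piMr// exprn_ile1.
  by apply: (lt_le_trans fle); rewrite ge_min lexx.
move=> H; apply: ae_impl (fF) => x fx; rewrite fx.
apply: (le_trans (H x)).
rewrite le_eqVlt; apply/orP; left; apply/eqP.
apply: ae_eq_integral => //.
- apply/measurable_EFin/measurableT_comp => //.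
  have [_ _ _] := pW; have [mw _ _] := pW; exact: mw.
- apply/measurable_EFin/measurable_funM => //; apply: measurableT_comp => //.
  apply: measurable_funM; last exact: measurable_slice1.
  by apply: measurable_funX; exact: measurable_slice1.
- by apply: ae_impl (fF) => s fs _; rewrite fs -mulrA normrM ger0_norm.
Qed.

(** The components are added before taking absolute values: f1 g1 + f2 g2 is the real part of
    conj(u) d_j u, the only combination that is unaffected by a magnetic potential. *)
Lemma ae_slice_sqr_sum (f1 f2 g1 g2 : R * R -> R) :
  L2 f1 -> L2 f2 -> L2 g1 -> L2 g2 ->
  weak_partial f1 g1 -> weak_partial f2 g2 ->
  {ae mu, forall y, {ae mu, forall x, ((f1 (x, y) ^+ 2 + f2 (x, y) ^+ 2)%:E <=
     \int[mu]_s (2 * `|f1 (s, y) * g1 (s, y) + f2 (s, y) * g2 (s, y)|)%:E)%E}}.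
Proof.
move=> L1 L2' G1 G2 w1 w2.
have mf1 := L2_measurable L1; have mg1 := L2_measurable G1.
have mf2 := L2_measurable L2'; have mg2 := L2_measurable G2.
have fi1 := ae_slice_sqr_integrable L1; have fi2 := ae_slice_sqr_integrable L2'.
have pr1 := ae_slice_primitive L1 G1 w1; have pr2 := ae_slice_primitive L2' G2 w2.
have fi12 := @filterI _ _ (ae_filter_ringOfSetsType mu) _ _ fi1 fi2.
have pr12 := @filterI _ _ (ae_filter_ringOfSetsType mu) _ _ pr1 pr2.
apply: (ae_impl2 _ fi12 pr12) =>
  y [fi1y fi2y] [[F1 pF1 fF1] [F2 pF2 fF2]].
have fF := @filterI _ _ (ae_filter_ringOfSetsType mu) _ _ fF1 fF2.
have pW := primitive_ofD (primitive_ofX 1 pF1) (primitive_ofX 1 pF2).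
have msq : measurable_fun setT (fun x => f1 (x, y) ^+ 2 + f2 (x, y) ^+ 2).
  by apply: measurable_funD; apply: measurable_funX; exact: measurable_slice1.
have small e : 0 < e -> exists a, `|F1 a ^+ 2 + F2 a ^+ 2| < e.
  move=> e0.
  have i12 : mu.-integrable setT (fun x => (f1 (x, y) ^+ 2 + f2 (x, y) ^+ 2)%:E).
    exact: (integrableD _ fi1y fi2y).
  have [|a [fa1 fa2] sa] := ae_small msq _ i12 fF e0.
    by move=> x; rewrite addr_ge0 ?sqr_ge0.
  by exists a; rewrite -fa1 -fa2 ger0_norm// addr_ge0 ?sqr_ge0.
have H := primitive_of_sup pW small.
apply: ae_impl (fF) => x [fx1 fx2]; rewrite fx1 fx2.
apply: (le_trans _ (le_trans (H x) _)); first by rewrite lee_fin ler_norm.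
rewrite le_eqVlt; apply/orP; left; apply/eqP.
apply: ae_eq_integral => //.
- apply/measurable_EFin/measurableT_comp => //.
  by have [mw _ _] := pW; exact: mw.
- apply/measurable_EFin/measurable_funM => //; apply: measurableT_comp => //.
  by apply: measurable_funD; apply: measurable_funM; exact: measurable_slice1.
- have fF' := @filterI _ _ (ae_filter_ringOfSetsType mu) _ _ fF1 fF2.
  apply: ae_impl (fF') => s [fs1 fs2] _; rewrite fs1 fs2 !expr1 -!mulrA -mulrDr normrM.
  by rewrite ger0_norm.
Qed.

Lemma measurable_swap (f : R * R -> R) : measurable_fun setT f ->
  measurable_fun setT (fun z : R * R => f (z.2, z.1)).
Proof.
move=> mf; have -> : (fun z : R * R => f (z.2, z.1)) = f \o (fun z => (z.2, z.1)) by [].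
apply: measurableT_comp => //.
exact: (measurable_fun_pair (measurable_snd) (measurable_fst)).
Qed.

Lemma ge0_integral_swap (f : R * R -> R) : measurable_fun setT f -> (forall z, 0 <= f z) ->
  (\int[m2]_z (f (z.2, z.1))%:E = \int[m2]_z (f z)%:E)%E.
Proof.
move=> mf f0.
have mE : measurable_fun setT (fun z => (f z)%:E) by exact: measurable_EFin.
have mE' : measurable_fun setT (fun z : R * R => (f (z.2, z.1))%:E).
  by apply: measurable_EFin; exact: measurable_swap.
transitivity (\int[mu]_x \int[mu]_y (f (y, x))%:E)%E.
  by apply: (@fubini_tonelli1 _ _ _ _ _ mu mu _ mE') => z; rewrite lee_fin.
by symmetry; apply: (@fubini_tonelli2 _ _ _ _ _ mu mu _ mE) => z; rewrite lee_fin.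
Qed.

(** Positive and negative parts are exchanged separately by Tonelli, so no integrability is
    required. *)
Lemma integral_swap (f : R * R -> R) : measurable_fun setT f ->
  (\int[m2]_z (f (z.2, z.1))%:E = \int[m2]_z (f z)%:E)%E.
Proof.
move=> mf; rewrite integralE [RHS]integralE.
have mp : measurable_fun setT (fun z => Num.max (f z) 0) by exact: measurable_maxr.
have mn : measurable_fun setT (fun z => Num.max (- f z) 0).
  by apply: measurable_maxr => //; exact: measurableT_comp.
have pE (h : R * R -> R) : (fun z => (h z)%:E)^\+%E = (fun z => (Num.max (h z) 0)%:E).
  by apply/funext => z; rewrite funeposE -EFin_max.
have nE (h : R * R -> R) : (fun z => (h z)%:E)^\-%E = (fun z => (Num.max (- h z) 0)%:E).
  by apply/funext => z; rewrite funenegE -EFinN -EFin_max.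
rewrite !pE !nE; congr (_ - _)%E.
  by apply: (ge0_integral_swap mp) => z; rewrite le_max lexx orbT.
by apply: (ge0_integral_swap mn) => z; rewrite le_max lexx orbT.
Qed.

Definition swap (f : R * R -> R) : R * R -> R := fun z => f (z.2, z.1).

Lemma L2_swap (f : R * R -> R) : L2 f -> L2 (swap f).
Proof.
move=> [mf fo]; split; first exact: measurable_swap.
rewrite /int2 /leb2 (@ge0_integral_swap (fun z => f z ^+ 2))//.
- exact: measurable_funX.
- by move=> z; exact: sqr_ge0.
Qed.

Lemma weak_partial2 (f g : R * R -> R) : measurable_fun setT f -> measurable_fun setT g ->
  weak_deriv (e2 R) f g -> weak_partial (swap f) (swap g).
Proof.
move=> mf mg fg a a' b b' ba bb.
have [ma ma'] := c1_bump_measurable ba; have [mb mb'] := c1_bump_measurable bb.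
have mF : measurable_fun setT (fun z => f z * (b z.1 * a' z.2)).
  by apply: measurable_funM => //; exact: measurable_tensor.
have mG : measurable_fun setT (fun z => g z * (b z.1 * a z.2)).
  by apply: measurable_funM => //; exact: measurable_tensor.
have := fg _ (testfun_tensor bb ba); rewrite /leb2.
under eq_integral.
  move=> z _; have [da _ _] := ba; rewrite (@pd2_tensor _ b _ _ da z).2; over.
rewrite -(integral_swap mF) -(integral_swap mG) => h.
transitivity (\int[m2]_z (f (z.2, z.1) * (b z.2 * a' z.1))%:E)%E.
  by apply: eq_integral => z _; rewrite /swap (mulrC (b _)).
rewrite h; congr (- _)%E; apply: eq_integral => z _.
by rewrite /swap (mulrC (b _)).
Qed.

End a_e_slices.

(** * Gagliardo-Nirenberg inequalities *)

Section gagliardo.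
Context {R : realType}.
Local Notation mu := (@lebesgue_measure R).
Local Notation m2 := (mu \x mu)%E.

(** The Gagliardo argument: w is bounded once by a function of y alone and once by a function of x
    alone, so w^2 is bounded by a product whose integral factors. *)
Lemma integral_sqr_le (w h1 h2 : R * R -> R) :
  measurable_fun setT w -> measurable_fun setT h1 -> measurable_fun setT h2 ->
  (forall z, 0 <= w z) -> (forall z, 0 <= h1 z) -> (forall z, 0 <= h2 z) ->
  {ae mu, forall y, {ae mu, forall x, ((w (x, y))%:E <= \int[mu]_s (h1 (s, y))%:E)%E}} ->
  {ae mu, forall x, {ae mu, forall y, ((w (x, y))%:E <= \int[mu]_t (h2 (x, t))%:E)%E}} ->
  (\int[m2]_z (w z ^+ 2)%:E <= \int[m2]_z (h1 z)%:E * \int[m2]_z (h2 z)%:E)%E.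
Proof.
move=> mw mh1 mh2 w0 h10 h20 H1 H2.
have mE (h : R * R -> R) : measurable_fun setT h -> measurable_fun setT (fun z => (h z)%:E).
  by move=> mh; exact: measurable_EFin.
have ge (h : R * R -> R) : (forall z, 0 <= h z) -> forall z, (0 <= (h z)%:E)%E.
  by move=> h0 z; rewrite lee_fin.
pose a y := (\int[mu]_s (h1 (s, y))%:E)%E.
pose b x := (\int[mu]_t (h2 (x, t))%:E)%E.
have a0 y : (0 <= a y)%E by apply: integral_ge0 => s _; rewrite lee_fin.
have b0 y : (0 <= b y)%E by apply: integral_ge0 => s _; rewrite lee_fin.
have ma : measurable_fun setT a.
  exact: (@measurable_fun_fubini_tonelli_G _ _ _ _ _ mu _ (mE _ mh1) (ge _ h10)).
have mb : measurable_fun setT b.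
  exact: (@measurable_fun_fubini_tonelli_F _ _ _ _ _ mu _ (mE _ mh2) (ge _ h20)).
have ia : (\int[m2]_z (h1 z)%:E = \int[mu]_y a y)%E.
  exact: (@fubini_tonelli2 _ _ _ _ _ mu mu _ (mE _ mh1) (ge _ h10)).
have ib : (\int[m2]_z (h2 z)%:E = \int[mu]_x b x)%E.
  exact: (@fubini_tonelli1 _ _ _ _ _ mu mu _ (mE _ mh2) (ge _ h20)).
have {}H1 : {ae mu, forall y, {ae mu, forall x, ((w (x, y))%:E <= a y)%E}} by exact: H1.
have {}H2 : {ae mu, forall x, {ae mu, forall y, ((w (x, y))%:E <= b x)%E}} by exact: H2.
clearbody a b.
have mw2 : measurable_fun setT (fun z => w z ^+ 2) by exact: measurable_funX.
have w20 z : 0 <= w z ^+ 2 by exact: sqr_ge0.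
have ms1 (h : R * R -> R) y : measurable_fun setT h ->
    measurable_fun setT (fun x => (h (x, y))%:E).
  by move=> mh; apply: measurable_EFin; exact: measurable_fun_pair1.
have ms2 (h : R * R -> R) x : measurable_fun setT h ->
    measurable_fun setT (fun y => (h (x, y))%:E).
  by move=> mh; apply: measurable_EFin; exact: measurable_fun_pair2.
have mW : measurable_fun setT (fun y => \int[mu]_x (w (x, y))%:E)%E.
  exact: (@measurable_fun_fubini_tonelli_G _ _ _ _ _ mu _ (mE _ mw) (ge _ w0)).
have mW2 : measurable_fun setT (fun y => \int[mu]_x (w (x, y) ^+ 2)%:E)%E.
  exact: (@measurable_fun_fubini_tonelli_G _ _ _ _ _ mu _ (mE _ mw2) (ge _ w20)).
have W0 y : (0 <= \int[mu]_x (w (x, y))%:E)%E.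
  by apply: integral_ge0 => s _; rewrite lee_fin.
(* Only one factor w is replaced at a time: the two bounds hold off null sets of different slicings,
   and Tonelli exchanges the slicing in between. *)
have step1 : (\int[m2]_z (w z ^+ 2)%:E <= \int[mu]_y (a y * \int[mu]_x (w (x, y))%:E))%E.
  have -> : (\int[m2]_z (w z ^+ 2)%:E = \int[mu]_y \int[mu]_x (w (x, y) ^+ 2)%:E)%E.
    exact: (@fubini_tonelli2 _ _ _ _ _ mu mu _ (mE _ mw2) (ge _ w20)).
  apply: ae_ge0_le_integral => //.
  - by move=> y _; apply: integral_ge0 => x _; rewrite lee_fin sqr_ge0.
  - by move=> y _; exact: mule_ge0.
  - exact: emeasurable_funM.
  apply: ae_impl H1 => y Hy _; rewrite -ge0_integralZl//; last 2 first.
  - exact: ms1.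
  - by move=> x _; rewrite lee_fin.
  apply: ae_ge0_le_integral => //.
  - by move=> x _; rewrite lee_fin sqr_ge0.
  - exact: (ms1 (fun z => w z ^+ 2) y mw2).
  - by move=> x _; rewrite mule_ge0// lee_fin.
  - by apply: emeasurable_funM => //; exact: ms1.
  by apply: ae_impl Hy => x wx _; rewrite expr2 EFinM lee_pmul// lee_fin.
have mga : measurable_fun setT (fun z : R * R => (a z.2 * (w z)%:E)%E).
  by apply: emeasurable_funM; [exact: measurableT_comp|exact: mE].
have ga0 (z : R * R) : (0 <= a z.2 * (w z)%:E)%E by rewrite mule_ge0// lee_fin.
have step2 : (\int[mu]_y (a y * \int[mu]_x (w (x, y))%:E) =
   \int[mu]_x \int[mu]_y (a y * (w (x, y))%:E))%E.
  transitivity (\int[mu]_y \int[mu]_x (a y * (w (x, y))%:E))%E.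
    apply: eq_integral => y _; rewrite ge0_integralZl//; first exact: ms1.
    by move=> x _; rewrite lee_fin.
  rewrite -[LHS](@fubini_tonelli2 _ _ _ _ _ mu mu (fun z => a z.2 * (w z)%:E)%E)//.
  exact: (@fubini_tonelli1 _ _ _ _ _ mu mu (fun z => a z.2 * (w z)%:E)%E).
have iA0 : (0 <= \int[mu]_y a y)%E by exact: integral_ge0.
apply: (le_trans step1); rewrite step2 ia ib -ge0_integralZl//.
apply: ae_ge0_le_integral => //.
- by move=> x _; apply: integral_ge0 => y _; rewrite mule_ge0// lee_fin.
- exact: (@measurable_fun_fubini_tonelli_F _ _ _ _ _ mu _ mga ga0).
- by move=> x _; exact: mule_ge0.
- exact: emeasurable_funM.
apply: ae_impl H2 => x Hx _; rewrite -ge0_integralZr//.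
apply: ae_ge0_le_integral => //.
- by move=> y _; rewrite mule_ge0// lee_fin.
- by apply: emeasurable_funM => //; exact: ms2.
- by move=> y _; exact: mule_ge0.
- by apply: emeasurable_funM.
by apply: ae_impl Hx => y wy _; rewrite lee_wpmul2l.
Qed.

Lemma H1_power_step (f g1 g2 : R * R -> R) (n : nat) :
  L2 f -> L2 g1 -> L2 g2 -> weak_deriv (e1 R) f g1 -> weak_deriv (e2 R) f g2 ->
  (\int[m2]_z ((f z ^+ n.+1) ^+ 2)%:E <=
   \int[m2]_z (n.+1%:R * `|f z ^+ n * g1 z|)%:E * \int[m2]_z (n.+1%:R * `|f z ^+ n * g2 z|)%:E)%E.
Proof.
move=> f2 G1 G2 w1 w2.
have mf := L2_measurable f2; have mg1 := L2_measurable G1; have mg2 := L2_measurable G2.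
have mh g : measurable_fun setT g -> measurable_fun setT (fun z => n.+1%:R * `|f z ^+ n * g z|).
  move=> mg; apply: measurable_funM => //; apply: measurableT_comp => //.
  by apply: measurable_funM => //; exact: measurable_funX.
have := @integral_sqr_le (fun z => `|f z ^+ n.+1|) _ _ _ (mh _ mg1) (mh _ mg2) _ _ _ _ _.
have -> : (\int[m2]_z (`|f z ^+ n.+1| ^+ 2)%:E = \int[m2]_z ((f z ^+ n.+1) ^+ 2)%:E)%E.
  by apply: eq_integral => z _; rewrite real_normK ?num_real.
apply.
- by apply: measurableT_comp => //; exact: measurable_funX.
- by [].
- by move=> z; rewrite mulr_ge0.
- by move=> z; rewrite mulr_ge0.
- by have := ae_slice_power n f2 G1 (weak_partial1 w1).
- exact: (ae_slice_power n (L2_swap f2) (L2_swap G2) (weak_partial2 mf mg2 w2)).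
Qed.

Lemma ladyzhenskaya (f1 f2 g1 g2 k1 k2 : R * R -> R) :
  L2 f1 -> L2 f2 -> L2 g1 -> L2 g2 -> L2 k1 -> L2 k2 ->
  weak_deriv (e1 R) f1 g1 -> weak_deriv (e1 R) f2 g2 ->
  weak_deriv (e2 R) f1 k1 -> weak_deriv (e2 R) f2 k2 ->
  (\int[m2]_z ((f1 z ^+ 2 + f2 z ^+ 2) ^+ 2)%:E <=
   \int[m2]_z (2 * `|f1 z * g1 z + f2 z * g2 z|)%:E *
   \int[m2]_z (2 * `|f1 z * k1 z + f2 z * k2 z|)%:E)%E.
Proof.
move=> F1 F2 G1 G2 K1 K2 w1 w2 v1 v2.
have mf1 := L2_measurable F1; have mf2 := L2_measurable F2.
have mg1 := L2_measurable G1; have mg2 := L2_measurable G2.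
have mk1 := L2_measurable K1; have mk2 := L2_measurable K2.
have mh a b : measurable_fun setT a -> measurable_fun setT b ->
    measurable_fun setT (fun z => 2 * `|f1 z * a z + f2 z * b z|).
  move=> ma mb; apply: measurable_funM => //; apply: measurableT_comp => //.
  by apply: measurable_funD; exact: measurable_funM.
apply: (@integral_sqr_le _ _ _ _ (mh _ _ mg1 mg2) (mh _ _ mk1 mk2)).
- by apply: measurable_funD; exact: measurable_funX.
- by move=> z; rewrite addr_ge0 ?sqr_ge0.
- by move=> z; rewrite mulr_ge0.
- by move=> z; rewrite mulr_ge0.
- exact: (ae_slice_sqr_sum F1 F2 G1 G2 (weak_partial1 w1) (weak_partial1 w2)).
- exact: (ae_slice_sqr_sum (L2_swap F1) (L2_swap F2) (L2_swap K1) (L2_swap K2)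
    (weak_partial2 mf1 mk1 v1) (weak_partial2 mf2 mk2 v2)).
Qed.

Lemma int_ge0 (f : R * R -> R) : (forall z, 0 <= f z) -> (0 <= \int[m2]_z (f z)%:E)%E.
Proof. by move=> f0; apply: integral_ge0 => z _; rewrite lee_fin. Qed.

Lemma int_le (f g : R * R -> R) : measurable_fun setT f -> measurable_fun setT g ->
  (forall z, 0 <= f z) -> (forall z, f z <= g z) ->
  (\int[m2]_z (f z)%:E <= \int[m2]_z (g z)%:E)%E.
Proof.
move=> mf mg f0 fg; apply: ge0_le_integral => //.
- by move=> z _; rewrite lee_fin.
- exact: measurable_EFin.
- exact: measurable_EFin.
- by move=> z _; rewrite lee_fin.
Qed.

Lemma int_add (f g : R * R -> R) : measurable_fun setT f -> measurable_fun setT g ->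
  (forall z, 0 <= f z) -> (forall z, 0 <= g z) ->
  (\int[m2]_z (f z + g z)%:E = \int[m2]_z (f z)%:E + \int[m2]_z (g z)%:E)%E.
Proof.
move=> mf mg f0 g0; rewrite -ge0_integralD//.
- by move=> z _; rewrite lee_fin.
- exact: measurable_EFin.
- by move=> z _; rewrite lee_fin.
- exact: measurable_EFin.
Qed.

Lemma int_scale (c : R) (f : R * R -> R) : 0 <= c -> measurable_fun setT f ->
  (forall z, 0 <= f z) -> (\int[m2]_z (c * f z)%:E = c%:E * \int[m2]_z (f z)%:E)%E.
Proof.
move=> c0 mf f0; under eq_integral do rewrite EFinM.
by rewrite ge0_integralZl_EFin//; [move=> z _; rewrite lee_fin|exact: measurable_EFin].
Qed.

(** Induction through |f^(n+1) g| <= f^(2n+2) + g^2. C and m are uniform in f, and the factor s is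
    kept outside the power of 1 + s so that a small H^1 norm forces a small Lebesgue norm. *)
Lemma H1_power_bound (n : nat) : exists2 C : R, 0 < C & exists m : nat,
  forall (f g1 g2 : R * R -> R) (s : R), 0 <= s ->
  L2 f -> L2 g1 -> L2 g2 -> weak_deriv (e1 R) f g1 -> weak_deriv (e2 R) f g2 ->
  (\int[m2]_z (f z ^+ 2 + g1 z ^+ 2 + g2 z ^+ 2)%:E <= s%:E)%E ->
  (\int[m2]_z (f z ^+ (2 * n.+1))%:E <= (C * (s * (1 + s) ^+ m))%:E)%E.
Proof.
elim: n => [|n [C C0 [m IH]]].
  exists 1 => //; exists 0%N => f g1 g2 s s0 f2 G1 G2 w1 w2; rewrite ?expr0 ?mulr1 mul1r; apply: le_trans.
  have mf := L2_measurable f2; have mg1 := L2_measurable G1; have mg2 := L2_measurable G2.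
  apply: int_le => [| |z|z].
  - exact: measurable_funX.
  - by apply: measurable_funD; [apply: measurable_funD|]; exact: measurable_funX.
  - exact: sqr_ge0.
  - by rewrite -addrA lerDl addr_ge0 ?sqr_ge0.
(* Each of the two integrals is at most (n+2) (C r + s) <= (n+2) (C+1) r with r = s (1+s)^m. *)
exists ((n.+2%:R * (C + 1)) ^+ 2); first by rewrite exprn_gt0// mulr_gt0// addr_gt0.
(* r^2 = s^2 (1+s)^(2m) <= s (1+s)^(2m+1): one factor s is given up to the power. *)
exists (2 * m + 1)%N => f g1 g2 s s0 f2 G1 G2 w1 w2 fs.
pose r := s * (1 + s) ^+ m.
have p1 : 1 <= (1 + s) ^+ m by rewrite exprn_ege1// lerDl.
have sr : s <= r by rewrite /r ler_peMr.
have r0 : 0 <= r by exact: le_trans sr.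
have mf := L2_measurable f2; have mg1 := L2_measurable G1; have mg2 := L2_measurable G2.
have {}IH := IH f g1 g2 s s0 f2 G1 G2 w1 w2 fs.
have bnd (g : R * R -> R) : measurable_fun setT g -> (\int[m2]_z (g z ^+ 2)%:E <= s%:E)%E ->
    (\int[m2]_z (n.+2%:R * `|f z ^+ n.+1 * g z|)%:E <= (n.+2%:R * (C + 1) * r)%:E)%E.
  move=> mg gs.
  have m1 : measurable_fun setT (fun z => f z ^+ (2 * n.+1)) by exact: measurable_funX.
  have mg' : measurable_fun setT (fun z => g z ^+ 2) by exact: measurable_funX.
  have p2 z : 0 <= f z ^+ (2 * n.+1) by rewrite exprM exprn_ge0 ?sqr_ge0.
  apply: (@le_trans _ _ (\int[m2]_z (n.+2%:R * (f z ^+ (2 * n.+1) + g z ^+ 2))%:E)%E).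
    apply: int_le => [| |z|z].
    - apply: measurable_funM => //; apply: measurableT_comp => //.
      by apply: measurable_funM => //; exact: measurable_funX.
    - by apply: measurable_funM => //; apply: measurable_funD.
    - by rewrite mulr_ge0.
    - rewrite ler_wpM2l// mulnC exprM normrM -[f z ^+ n.+1 ^+ 2]real_normK ?num_real//.
      rewrite -[g z ^+ 2]real_normK ?num_real//.
      have := normr_ge0 (f z ^+ n.+1); have := normr_ge0 (g z); nra.
  rewrite int_scale//; last 2 first.
  - exact: measurable_funD.
  - by move=> z; rewrite addr_ge0 ?sqr_ge0.
  rewrite int_add//; last by move=> z; rewrite sqr_ge0.
  rewrite -mulrA EFinM lee_wpmul2l// mulrDl mul1r EFinD.
  by apply: leeD; [exact: IH|apply: le_trans gs _; rewrite lee_fin].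
have sq_le (g : R * R -> R) : measurable_fun setT g ->
   (forall z, g z ^+ 2 <= f z ^+ 2 + g1 z ^+ 2 + g2 z ^+ 2) -> (\int[m2]_z (g z ^+ 2)%:E <= s%:E)%E.
  move=> mg gle; apply: le_trans fs; apply: int_le => [| |z|z].
  - exact: measurable_funX.
  - by apply: measurable_funD; [apply: measurable_funD|]; exact: measurable_funX.
  - exact: sqr_ge0.
  - exact: gle.
have b1 := bnd g1 mg1 (sq_le g1 mg1 _); have b2 := bnd g2 mg2 (sq_le g2 mg2 _).
have := H1_power_step n.+1 f2 G1 G2 w1 w2.
have -> : (\int[m2]_z ((f z ^+ n.+2) ^+ 2)%:E = \int[m2]_z (f z ^+ (2 * n.+2))%:E)%E.
  by apply: eq_integral => z _; rewrite -exprM mulnC.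
move=> /le_trans; apply.
apply: (@le_trans _ _ ((n.+2%:R * (C + 1) * r)%:E * (n.+2%:R * (C + 1) * r)%:E)%E).
  apply: lee_pmul.
  - by apply: int_ge0 => z; rewrite mulr_ge0.
  - by apply: int_ge0 => z; rewrite mulr_ge0.
  - by apply: b1 => z; rewrite addrAC lerDr addr_ge0 ?sqr_ge0.
  - by apply: b2 => z; rewrite lerDr addr_ge0 ?sqr_ge0.
rewrite -EFinM lee_fin -expr2 exprMn; apply: ler_wpM2l; first exact: sqr_ge0.
rewrite /r exprMn exprD expr1 mulnC exprM expr2 -mulrA ler_wpM2l// mulrC.
by rewrite ler_wpM2l ?sqr_ge0// lerDr.
Qed.

(** In f1 (h1 - c f2) + f2 (h2 + c f1) the terms with c cancel, so a and b need not be bounded and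
    do not enter the constant. Young's inequality then bounds twice this expression by t |f|^2 +
    |D|^2 / t. *)
Lemma magnetic_L4 (f1 f2 g1 g2 k1 k2 a b : R * R -> R) (M K : R) :
  L2 f1 -> L2 f2 -> L2 g1 -> L2 g2 -> L2 k1 -> L2 k2 ->
  measurable_fun setT a -> measurable_fun setT b ->
  weak_deriv (e1 R) f1 g1 -> weak_deriv (e1 R) f2 g2 ->
  weak_deriv (e2 R) f1 k1 -> weak_deriv (e2 R) f2 k2 ->
  0 < M -> 0 <= K ->
  (\int[m2]_z (f1 z ^+ 2 + f2 z ^+ 2)%:E <= M%:E)%E ->
  (\int[m2]_z (((g1 z - a z * f2 z) ^+ 2 + (g2 z + a z * f1 z) ^+ 2) +
     ((k1 z - b z * f2 z) ^+ 2 + (k2 z + b z * f1 z) ^+ 2))%:E <= K%:E)%E ->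
  (\int[m2]_z ((f1 z ^+ 2 + f2 z ^+ 2) ^+ 2)%:E <= (4 * M * (K + 1))%:E)%E.
Proof.
move=> F1 F2 G1 G2 K1 K2 ma mb w1 w2 v1 v2 M0 K0 fM DK.
have mf1 := L2_measurable F1; have mf2 := L2_measurable F2.
have mg1 := L2_measurable G1; have mg2 := L2_measurable G2.
have mk1 := L2_measurable K1; have mk2 := L2_measurable K2.
pose D c h1 h2 := fun z : R * R => (h1 z - c z * f2 z) ^+ 2 + (h2 z + c z * f1 z) ^+ 2 : R.
have mD c h1 h2 : measurable_fun setT c -> measurable_fun setT h1 -> measurable_fun setT h2 ->
    measurable_fun setT (D c h1 h2).
  move=> mc mh1 mh2; apply: measurable_funD; apply: measurable_funX.
    by apply: measurable_funB => //; exact: measurable_funM.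
  by apply: measurable_funD => //; exact: measurable_funM.
have D0 c h1 h2 z : 0 <= D c h1 h2 z by rewrite addr_ge0 ?sqr_ge0.
have mff : measurable_fun setT (fun z => f1 z ^+ 2 + f2 z ^+ 2).
  by apply: measurable_funD; exact: measurable_funX.
(* Balances the two terms: t M = (K+1) / t, so each integral is at most 2 t M and their product is 4
   M (K+1). The 1 keeps t positive when K = 0. *)
pose t := Num.sqrt ((K + 1) / M).
have t0 : 0 < t by rewrite sqrtr_gt0 divr_gt0// ltr_wpDl.
have t2 : t ^+ 2 = (K + 1) / M by rewrite sqr_sqrtr// divr_ge0 ?(ltW M0)// addr_ge0.
have bnd c h1 h2 : measurable_fun setT c -> measurable_fun setT h1 -> measurable_fun setT h2 ->
   (\int[m2]_z (D c h1 h2 z)%:E <= (K + 1)%:E)%E ->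
   (\int[m2]_z (2 * `|f1 z * h1 z + f2 z * h2 z|)%:E <= (2 * (t * M))%:E)%E.
  move=> mc mh1 mh2 DK1.
  apply: (@le_trans _ _ (\int[m2]_z (t * (f1 z ^+ 2 + f2 z ^+ 2) + t^-1 * D c h1 h2 z)%:E)%E).
    apply: int_le => [| |z|z].
    - apply: measurable_funM => //; apply: measurableT_comp => //.
      by apply: measurable_funD => //; exact: measurable_funM.
    - by apply: measurable_funD; apply: measurable_funM => //; exact: mD.
    - by rewrite mulr_ge0.
    - have -> : f1 z * h1 z + f2 z * h2 z =
        f1 z * (h1 z - c z * f2 z) + f2 z * (h2 z + c z * f1 z) by ring.
      rewrite /D; set p := (h1 z - _); set q := (h2 z + _).
      rewrite -(ler_pM2l t0) [X in _ <= X]mulrDr [X in _ <= _ + X]mulrA divff ?gt_eqF// mul1r.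
      rewrite mulrCA -[X in X * `|_|](gtr0_norm t0) -normrM -[2]ger0_norm// -normrM.
      rewrite ler_norml; apply/andP.
      have := sqr_ge0 (t * f1 z - p); have := sqr_ge0 (t * f2 z - q).
      have := sqr_ge0 (t * f1 z + p); have := sqr_ge0 (t * f2 z + q).
      by split; nra.
  rewrite int_add//; last 4 first.
  - exact: measurable_funM.
  - by apply: measurable_funM => //; exact: mD.
  - by move=> z; rewrite mulr_ge0 ?(ltW t0)// addr_ge0 ?sqr_ge0.
  - by move=> z; rewrite mulr_ge0 ?invr_ge0 ?(ltW t0).
  rewrite !int_scale ?invr_ge0 ?(ltW t0)//; last 2 first.
  - exact: mD.
  - by move=> z; rewrite addr_ge0 ?sqr_ge0.
  apply: (@le_trans _ _ (t%:E * M%:E + t^-1%:E * (K + 1)%:E)%E).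
    by apply: leeD; apply: lee_wpmul2l => //; rewrite lee_fin ?invr_ge0 ltW.
  rewrite -!EFinM -EFinD lee_fin.
  have -> : K + 1 = t ^+ 2 * M by rewrite t2 divfK// gt_eqF.
  by rewrite expr2 -!mulrA mulKf ?gt_eqF//; lra.
have part c h1 h2 : measurable_fun setT c -> measurable_fun setT h1 -> measurable_fun setT h2 ->
   (forall z, D c h1 h2 z <= D a g1 g2 z + D b k1 k2 z) -> (\int[m2]_z (D c h1 h2 z)%:E <= (K + 1)%:E)%E.
  move=> mc mh1 mh2 le; apply: (@le_trans _ _ K%:E); last by rewrite lee_fin lerDl.
  apply: le_trans DK; apply: int_le => //.
  - exact: mD.
  - by apply: measurable_funD; exact: mD.
apply: (le_trans (ladyzhenskaya F1 F2 G1 G2 K1 K2 w1 w2 v1 v2)).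
apply: (@le_trans _ _ ((2 * (t * M))%:E * (2 * (t * M))%:E)%E).
  apply: lee_pmul.
  - by apply: int_ge0 => z; rewrite mulr_ge0.
  - by apply: int_ge0 => z; rewrite mulr_ge0.
  - by apply: (bnd a) => //; apply: part => // z; rewrite lerDl.
  - by apply: (bnd b) => //; apply: part => // z; rewrite lerDr.
rewrite -EFinM lee_fin.
have -> : 2 * (t * M) * (2 * (t * M)) = 4 * M * (t ^+ 2 * M) by ring.
by rewrite t2 divfK// gt_eqF.
Qed.

End gagliardo.

(** * Boundedness of the gauge potentials *)

Section kernel.
Context {R : realType}.
Local Notation mu := (@lebesgue_measure R).
Local Notation m2 := (mu \x mu)%E.

Definition sqrt4 (t : R) : R := Num.sqrt (Num.sqrt t).
(** This is |t|^(-3/4), with value 0 at 0. Writing it with a fourth root makes powers algebraic and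
    gives the primitive 4 t^(1/4) for t > 0. *)
Definition sing_pow (t : R) : R := (sqrt4 `|t|)^-1 ^+ 3.

Lemma sqrt4_gt0 t : 0 < t -> 0 < sqrt4 t.
Proof. by move=> t0; rewrite !sqrtr_gt0. Qed.

Lemma sqrt4X t : 0 <= t -> sqrt4 t ^+ 4 = t.
Proof. by move=> t0; rewrite (exprM _ 2 2) !sqr_sqrtr// sqrtr_ge0. Qed.

Lemma sing_pow_ge0 t : 0 <= sing_pow t.
Proof. by rewrite exprn_ge0// invr_ge0 sqrtr_ge0. Qed.

Lemma continuous_sqrt4 : continuous sqrt4.
Proof.
by move=> t; apply: (@continuous_comp _ _ _ Num.sqrt Num.sqrt); exact: sqrt_continuous.
Qed.

Lemma is_derive_sqrt4 (t : R) : 0 < t -> is_derive t 1 sqrt4 (4^-1 * sing_pow t).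
Proof.
move=> t0; have s0 : 0 < Num.sqrt t by rewrite sqrtr_gt0.
have := @is_derive1_comp _ Num.sqrt Num.sqrt t _ _ (is_derive1_sqrt s0) (is_derive1_sqrt t0).
have q0 := sqrt4_gt0 t0.
have -> : (2 * Num.sqrt (Num.sqrt t))^-1 * (2 * Num.sqrt t)^-1 = 4^-1 * sing_pow t; last by [].
rewrite /sing_pow gtr0_norm// -/(sqrt4 t).
have -> : Num.sqrt t = sqrt4 t ^+ 2 by rewrite sqr_sqrtr// sqrtr_ge0.
by field; rewrite gt_eqF.
Qed.

(** Inversion is discontinuous at 0, so it is read as the power -1; both expressions are 0 where f
    vanishes. *)
Lemma measurable_inv_ge0 d (T : measurableType d) (f : T -> R) : measurable_fun setT f ->
  (forall x, 0 <= f x) -> measurable_fun setT (fun x => (f x)^-1).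
Proof.
move=> mf f0; have -> : (fun x => (f x)^-1) = (fun x => f x `^ (-1)).
  by apply/funext => x; rewrite powR_inv1.
exact: (measurableT_comp (measurable_powR _)).
Qed.

Lemma measurable_sing_pow : measurable_fun setT sing_pow.
Proof.
apply: measurable_funX; apply: measurable_inv_ge0; last by move=> t; exact: sqrtr_ge0.
by apply: measurableT_comp; first exact: continuous_measurable_fun continuous_sqrt4.
Qed.

Lemma continuous_sing_pow (t : R) : t != 0 -> {for t, continuous sing_pow}.
Proof.
move=> t0; have q0 : sqrt4 `|t| != 0 by rewrite gt_eqF// sqrt4_gt0// normr_gt0.
have c1 : sqrt4 `|s| @[s --> t] --> sqrt4 `|t|.
  have c0 : `|s| @[s --> t] --> `|t| by exact: (@norm_continuous _ _ t).
  by apply: (cvg_comp _ _ c0); exact: continuous_sqrt4.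
have c2 : (sqrt4 `|s|)^-1 @[s --> t] --> (sqrt4 `|t|)^-1 by exact: cvgV.
have c3 : (sqrt4 `|s|)^-1 * (sqrt4 `|s|)^-1 @[s --> t] --> (sqrt4 `|t|)^-1 * (sqrt4 `|t|)^-1.
  exact: cvgM.
exact: (cvgM c2 c3).
Qed.

(** Monotone convergence, used to evaluate improper integrals at an endpoint singularity. *)
Lemma integral_bigcup_le (f : R -> R) (F : nat -> set R) (c : R) :
  measurable_fun setT f -> (forall x, 0 <= f x) ->
  {homo F : n m / (n <= m)%N >-> (n <= m)%O} -> (forall n, measurable (F n)) ->
  (forall n, (\int[mu]_(t in F n) (f t)%:E <= c%:E)%E) ->
  (\int[mu]_(t in \bigcup_n F n) (f t)%:E <= c%:E)%E.
Proof.
move=> mf f0 ndF mF Fc.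
have cv : ((\int[mu]_(x in F i) (f x)%:E)%E @[i --> \oo] -->
    (\int[mu]_(x in \bigcup_i F i) (f x)%:E)%E).
  apply: ge0_nondecreasing_set_cvg_integral => //.
    by move=> i; apply: measurable_EFin; exact: measurable_funTS.
  by move=> i x _; rewrite lee_fin.
rewrite -(cvg_lim _ cv)//; apply: lime_le; first by apply/cvg_ex; eexists; exact: cv.
exact: nearW.
Qed.

Lemma sing_pow_right (x : R) : (\int[mu]_(t in `]x, (x + 1)%R]) (sing_pow (t - x))%:E <= 4%:E)%E.
Proof.
(* The denominator starts at 2, so that d n < 1 and the intervals [x + d n, x + 1] are
   nondegenerate. *)
pose d (n : nat) : R := n.+2%:R^-1.
pose F (n : nat) : set R := `[x + d n, x + 1]%classic.
have e0 n : 0 < d n by rewrite invr_gt0.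
have e1 n : d n < 1 by rewrite invf_lt1// ltr1n.
have -> : `]x, x + 1]%classic = \bigcup_n F n.
  apply/seteqP; split => t /=.
    rewrite in_itv/= => /andP[xt t1].
    have tx0 : 0 < t - x by rewrite subr_gt0.
    have [N _ HN] := near_infty_natSinv_lt (PosNum tx0).
    exists N => //; rewrite /F /= in_itv/= t1 andbT.
    have h := HN N (leqnn N); rewrite /= in h.
    have : d N < t - x.
      by apply: le_lt_trans h; rewrite lef_pV2 ?posrE// ler_nat.
    lra.
  move=> [n _]; rewrite /F/= !in_itv/= => /andP[xt ->]; rewrite andbT.
  by have := e0 n; lra.
apply: integral_bigcup_le.
- apply: (measurableT_comp measurable_sing_pow); exact: measurable_funB.
- by move=> t; exact: sing_pow_ge0.
- move=> n m nm; apply/subsetPset => t; rewrite /F/= !in_itv/= => /andP[xt ->].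
  rewrite andbT; apply: le_trans xt; rewrite lerD2l.
  by rewrite lef_pV2 ?posrE// ler_nat.
- by move=> n; exact: measurable_itv.
move=> n; rewrite /F.
have -> : (\int[mu]_(t in `[(x + d n)%R, (x + 1)%R]) (sing_pow (t - x))%:E =
   (4 * sqrt4 (x + 1 - x))%:E - (4 * sqrt4 (x + d n - x))%:E)%E.
  have der (t : R) : x < t -> is_derive t 1 (fun t => 4 * sqrt4 (t - x)) (sing_pow (t - x)).
    move=> xt; have tx0 : 0 < t - x by rewrite subr_gt0.
    have := is_derive_subr (is_derive_sqrt4 tx0).
    move=> /(@is_deriveZ _ _ _ _ 4); rewrite /GRing.scale/= mulrA divff ?mul1r//.
  have cF (t : R) : {for t, continuous (fun t => 4 * sqrt4 (t - x))}.
    apply: cvgM; first exact: cvg_cst.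
    apply: (@continuous_comp _ _ _ (fun t => t - x) sqrt4).
      by apply: cvgB; [exact: cvg_id|exact: cvg_cst].
    exact: continuous_sqrt4.
  apply: (@continuous_FTC2 _ (fun t => sing_pow (t - x)) (fun t => 4 * sqrt4 (t - x))).
  - by have := e1 n; lra.
  - apply: continuous_in_subspaceT => t; rewrite inE/= in_itv/= => /andP[xt _].
    apply: (@continuous_comp _ _ _ (fun t => t - x) sing_pow).
      by apply: cvgB; [exact: cvg_id|exact: cvg_cst].
    by apply: continuous_sing_pow; have := e0 n; rewrite subr_eq0 => ?; rewrite gt_eqF//; lra.
  - split.
    + move=> t; rewrite in_itv/= => /andP[xt _]; have xt' : x < t by have := e0 n; lra.
      by have dt := der t xt'; exact: ex_derive.
    + by apply: cvg_at_right_filter; exact: cF.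
    + by apply: cvg_at_left_filter; exact: cF.
  - move=> t; rewrite in_itv/= => /andP[xt _]; have xt' : x < t by have := e0 n; lra.
    by have dt := der t xt'; rewrite derive1E; exact: derive_val.
rewrite -EFinB lee_fin.
have -> : x + 1 - x = 1 by ring.
have : 0 <= sqrt4 (x + d n - x) by exact: sqrtr_ge0.
by rewrite /sqrt4 !sqrtr1; lra.
Qed.

Lemma sing_pow_left (x : R) : (\int[mu]_(t in `[(x - 1)%R, x[) (sing_pow (t - x))%:E <= 4%:E)%E.
Proof.
pose d (n : nat) : R := n.+2%:R^-1.
pose F (n : nat) : set R := `[x - 1, x - d n]%classic.
have e0 n : 0 < d n by rewrite invr_gt0.
have e1 n : d n < 1 by rewrite invf_lt1// ltr1n.
have -> : `[x - 1, x[%classic = \bigcup_n F n.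
  apply/seteqP; split => t /=.
    rewrite in_itv/= => /andP[t1 xt].
    have tx0 : 0 < x - t by rewrite subr_gt0.
    have [N _ HN] := near_infty_natSinv_lt (PosNum tx0).
    exists N => //; rewrite /F /= in_itv/= t1/=.
    have h := HN N (leqnn N); rewrite /= in h.
    have : d N < x - t.
      by apply: le_lt_trans h; rewrite lef_pV2 ?posrE// ler_nat.
    lra.
  move=> [n _]; rewrite /F/= !in_itv/= => /andP[-> xt]/=.
  by have := e0 n; lra.
apply: integral_bigcup_le.
- apply: (measurableT_comp measurable_sing_pow); exact: measurable_funB.
- by move=> t; exact: sing_pow_ge0.
- move=> n m nm; apply/subsetPset => t; rewrite /F/= !in_itv/= => /andP[-> xt]/=.
  apply: (le_trans xt); rewrite lerD2l lerN2.
  by rewrite lef_pV2 ?posrE// ler_nat.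
- by move=> n; exact: measurable_itv.
move=> n; rewrite /F.
have -> : (\int[mu]_(t in `[(x - 1)%R, (x - d n)%R]) (sing_pow (t - x))%:E =
   (- 4 * sqrt4 (x - (x - d n)))%:E - (- 4 * sqrt4 (x - (x - 1)))%:E)%E.
  have der (t : R) : t < x -> is_derive t 1 (fun t => - 4 * sqrt4 (x - t)) (sing_pow (t - x)).
    move=> xt; have tx0 : 0 < x - t by rewrite subr_gt0.
    have dx : is_derive t 1 (fun t : R => x - t) (-1).
      by rewrite -[X in is_derive _ _ _ X]sub0r; apply: is_deriveB.
    have := @is_derive1_comp _ sqrt4 (fun t => x - t) t _ _ (is_derive_sqrt4 tx0) dx.
    move=> /(@is_deriveZ _ _ _ _ (-4)); rewrite /GRing.scale/=.
    have -> // : - 4 * (4^-1 * sing_pow (x - t) * -1) = sing_pow (t - x).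
    have -> : sing_pow (x - t) = sing_pow (t - x) by rewrite /sing_pow distrC.
    by field.
  have cF (t : R) : {for t, continuous (fun t => - 4 * sqrt4 (x - t))}.
    apply: cvgM; first exact: cvg_cst.
    apply: (@continuous_comp _ _ _ (fun t => x - t) sqrt4).
      by apply: cvgB; [exact: cvg_cst|exact: cvg_id].
    exact: continuous_sqrt4.
  apply: (@continuous_FTC2 _ (fun t => sing_pow (t - x)) (fun t => - 4 * sqrt4 (x - t))).
  - by have := e1 n; lra.
  - apply: continuous_in_subspaceT => t; rewrite inE/= in_itv/= => /andP[_ xt].
    apply: (@continuous_comp _ _ _ (fun t => t - x) sing_pow).
      by apply: cvgB; [exact: cvg_id|exact: cvg_cst].
    by apply: continuous_sing_pow; have := e0 n; rewrite subr_eq0 => ?; rewrite lt_eqF//; lra.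
  - split.
    + move=> t; rewrite in_itv/= => /andP[_ xt]; have xt' : t < x by have := e0 n; lra.
      by have dt := der t xt'; exact: ex_derive.
    + by apply: cvg_at_right_filter; exact: cF.
    + by apply: cvg_at_left_filter; exact: cF.
  - move=> t; rewrite in_itv/= => /andP[_ xt]; have xt' : t < x by have := e0 n; lra.
    by have dt := der t xt'; rewrite derive1E; exact: derive_val.
rewrite -EFinB lee_fin.
have -> : x - (x - 1) = 1 by ring.
have : 0 <= sqrt4 (x - (x - d n)) by exact: sqrtr_ge0.
by rewrite /sqrt4 !sqrtr1; lra.
Qed.

Definition sing (t : R) : R := sing_pow t * \1_(`]-1, 1[%classic : set R) t.

Lemma sing_ge0 t : 0 <= sing t.
Proof. by rewrite mulr_ge0// sing_pow_ge0. Qed.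

Lemma measurable_sing : measurable_fun setT sing.
Proof.
apply: measurable_funM; first exact: measurable_sing_pow.
exact: measurable_indic.
Qed.

Lemma sing_pow0 : sing_pow 0 = 0.
Proof. by rewrite /sing_pow /sqrt4 normr0 !sqrtr0 invr0 expr0n. Qed.

Lemma integral_sing (x : R) : (\int[mu]_t (sing (x - t))%:E <= 8%:E)%E.
Proof.
pose r t := sing_pow (t - x) * \1_(`]x, x + 1]%classic : set R) t.
pose l t := sing_pow (t - x) * \1_(`[x - 1, x[%classic : set R) t.
have msx : measurable_fun setT (fun t : R => sing_pow (t - x)).
  by apply: (measurableT_comp measurable_sing_pow); exact: measurable_funB.
have mr : measurable_fun setT r by apply: measurable_funM => //; exact: measurable_indic.
have ml : measurable_fun setT l by apply: measurable_funM => //; exact: measurable_indic.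
have r0 t : 0 <= r t by rewrite mulr_ge0// sing_pow_ge0.
have l0 t : 0 <= l t by rewrite mulr_ge0// sing_pow_ge0.
have cutE (D : set R) : (\int[mu]_t (sing_pow (t - x) * \1_D t)%:E =
    \int[mu]_(t in D) (sing_pow (t - x))%:E)%E.
  rewrite [RHS]integral_mkcond; apply: eq_integral => t _; rewrite patchE indicE.
  by case: ifP => _; rewrite ?mulr1 ?mulr0.
have pw (t : R) : sing (x - t) <= r t + l t.
  rewrite /sing /r /l.
  have -> : sing_pow (x - t) = sing_pow (t - x) by rewrite /sing_pow distrC.
  (* Neither half-open interval contains x; this is harmless because [sing_pow] vanishes at 0. *)
  have [->|tx] := eqVneq t x; first by rewrite subrr sing_pow0 !mul0r addr0.
  rewrite -mulrDr ler_wpM2l ?sing_pow_ge0// !indicE !mem_setE !in_itv/=.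
  have [h1|h1] := ltP (-1) (x - t); have [h2|h2] := ltP (x - t) 1;
    rewrite ?andbF//= ?addr_ge0//.
  have [xt|xt] := ltP x t.
    have h3 : t <= x + 1 by lra.
    by rewrite h3 /= lerDl.
  have xt' : t < x by rewrite lt_neqAle tx.
  have h4 : x - 1 <= t by lra.
  by rewrite xt' h4 /= lerDr.
apply: (@le_trans _ _ (\int[mu]_t ((r t)%:E + (l t)%:E))%E).
  apply: ge0_le_integral => //.
  - by move=> t _; rewrite lee_fin sing_ge0.
  - apply: measurable_EFin; apply: (measurableT_comp measurable_sing).
    exact: measurable_funB.
  - by apply: emeasurable_funD; exact: measurable_EFin.
  - by move=> t _; rewrite -EFinD lee_fin; exact: pw.
rewrite ge0_integralD//; last 4 first.
- by move=> t _; rewrite lee_fin.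
- exact: measurable_EFin.
- by move=> t _; rewrite lee_fin.
- exact: measurable_EFin.
rewrite !cutE (_ : 8%:E = 4%:E + 4%:E)%E; last by rewrite -EFinD; congr (_%:E); ring.
by apply: leeD; [exact: sing_pow_right|exact: sing_pow_left].
Qed.

Lemma integral_sing2 (x : R * R) :
  (\int[m2]_y (sing (x.1 - y.1) * sing (x.2 - y.2))%:E <= 64%:E)%E.
Proof.
have ms (c : R) : measurable_fun setT (fun t : R => sing (c - t)).
  by apply: (measurableT_comp measurable_sing); exact: measurable_funB.
have mss : measurable_fun setT (fun y : R * R => (sing (x.1 - y.1) * sing (x.2 - y.2))%:E).
  apply: measurable_EFin; exact: (measurable_tensor (ms x.1) (ms x.2)).
rewrite (_ : (\int[m2]_y _ = \int[mu]_s \int[mu]_t (sing (x.1 - s) * sing (x.2 - t))%:E)%E); last first.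
  by apply: (@fubini_tonelli1 _ _ _ _ _ mu mu _ mss) => z; rewrite lee_fin mulr_ge0 ?sing_ge0.
apply: (@le_trans _ _ (\int[mu]_s ((sing (x.1 - s))%:E * 8%:E))%E).
  have E s : (\int[mu]_t (sing (x.1 - s) * sing (x.2 - t))%:E =
     (sing (x.1 - s))%:E * \int[mu]_t (sing (x.2 - t))%:E)%E.
    under eq_integral do rewrite EFinM.
    rewrite ge0_integralZl_EFin ?sing_ge0//.
      by move=> t _; rewrite lee_fin sing_ge0.
    by apply: measurable_EFin; exact: ms.
  apply: ge0_le_integral => //.
  - by move=> s _; apply: integral_ge0 => t _; rewrite lee_fin mulr_ge0 ?sing_ge0.
  - apply: (@measurable_fun_fubini_tonelli_F _ _ _ _ _ mu _ mss) => z.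
    by rewrite lee_fin mulr_ge0 ?sing_ge0.
  - by apply: emeasurable_funM => //; apply: measurable_EFin; exact: ms.
  - by move=> s _; rewrite E lee_wpmul2l ?integral_sing// lee_fin sing_ge0.
rewrite ge0_integralZr//; last 2 first.
- by apply: measurable_EFin; exact: ms.
- by move=> s _; rewrite lee_fin sing_ge0.
rewrite (_ : 64%:E = 8%:E * 8%:E)%E; last by rewrite -EFinM; congr (_%:E); ring.
by rewrite lee_wpmul2r// integral_sing.
Qed.

Lemma lt1_sqr_sum (a b : R) : 0 < a -> 0 < b -> a ^+ 2 + b ^+ 2 < a -> a < 1 /\ b < 1.
Proof.
move=> a0 b0 h; split; rewrite ltNge; apply/negP => h1.
  have : a <= a ^+ 2 by rewrite expr2 ler_peMl// ltW.
  have := sqr_ge0 b; lra.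
have : 1 <= b ^+ 2 by rewrite exprn_ege1.
have := sqr_ge0 (a - 1); nra.
Qed.

(* Besides k <= 1 and k <= w^2, the remaining case is w <= k^(1/2), where
   k w <= k^(3/2) <= (a b)^(-3/4) because k <= 1 / max a b; this bound is a tensor product of
   integrable singularities. *)
Lemma kernel_young (a b c k w : R) : 0 < a -> 0 < b -> c = a \/ c = b ->
  k * (a ^+ 2 + b ^+ 2) <= c -> 0 <= k -> 0 <= w ->
  k * w <= w + w ^+ 3 + sing a * sing b.
Proof.
move=> a0 b0 cab kc k0 w0.
have s0 : 0 <= sing a * sing b by rewrite mulr_ge0 ?sing_ge0.
have w30 : 0 <= w ^+ 3 by rewrite exprn_ge0.
have [k1|k1] := leP k 1.
  have : k * w <= 1 * w by rewrite ler_wpM2r.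
  lra.
have ab1 : a < 1 /\ b < 1.
  have h : a ^+ 2 + b ^+ 2 < c.
    apply: lt_le_trans kc; rewrite ltr_pMl// ; nra.
  case: cab => cE; rewrite cE in h; first exact: lt1_sqr_sum h.
  by have [|//] := @lt1_sqr_sum b a b0 a0; rewrite addrC.
have sE t : 0 < t -> t < 1 -> sing t = (sqrt4 t)^-1 ^+ 3.
  move=> t0 t1; rewrite /sing /sing_pow gtr0_norm// indicE mem_set ?mulr1//= in_itv/=.
  by rewrite t1 andbT; lra.
have [a1 b1] := ab1; rewrite (sE a)// (sE b)// -exprMn -invfM.
(* m^4 = a b, so the product of the two singularities is m^(-3), and it remains to show k <= m^(-2)
   and w <= m^(-1). *)
set m := sqrt4 a * sqrt4 b.
have m0 : 0 < m by rewrite mulr_gt0// sqrt4_gt0.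
have m4 : m ^+ 4 = a * b by rewrite exprMn !sqrt4X// ltW.
(* With S = a^2 + b^2 one has a b <= S and c^2 <= S, hence k^2 (a b) S <= (k S)^2 <= c^2 <= S. *)
have km : k * m ^+ 2 <= 1.
  have km0 : 0 <= k * m ^+ 2 by rewrite mulr_ge0 ?sqr_ge0.
  rewrite -(@expr_le1 R 2 (k * m ^+ 2) isT km0) exprMn -exprM m4.
  have h2 : (k * (a ^+ 2 + b ^+ 2)) ^+ 2 <= c ^+ 2.
    rewrite lerXn2r// ?nnegrE; first by rewrite mulr_ge0// addr_ge0 ?sqr_ge0.
    by apply: le_trans kc; rewrite mulr_ge0// addr_ge0 ?sqr_ge0.
  have ab : a * b <= a ^+ 2 + b ^+ 2 by nra.
  have c2 : c ^+ 2 <= a ^+ 2 + b ^+ 2 by case: cab => ->; nra.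
  set S := a ^+ 2 + b ^+ 2 in h2 ab c2.
  have S0 : 0 < S by rewrite /S; nra.
  rewrite -(ler_pM2r S0) mul1r.
  apply: (le_trans _ c2); apply: (le_trans _ h2).
  rewrite exprMn -mulrA ler_wpM2l ?sqr_ge0// expr2 ler_wpM2r// ltW//.
have [kw|wk] := leP k (w ^+ 2).
  have : k * w <= w ^+ 2 * w by rewrite ler_wpM2r.
  rewrite -exprSr => ?; have : 0 <= m^-1 ^+ 3 by rewrite exprn_ge0// invr_ge0 ltW.
  lra.
have kmi : k <= m^-1 ^+ 2 by rewrite exprVn -[leRHS]mul1r ler_pdivlMr// exprn_gt0.
have wm : w <= m^-1.
  have := @ler_pXn2r R 2 isT w m^-1; rewrite !nnegrE invr_ge0 (ltW m0) => /(_ w0 isT) <-.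
  by apply: le_trans kmi; exact: ltW.
have : k * w <= m^-1 ^+ 2 * m^-1 by apply: ler_pM.
by rewrite -exprSr; lra.
Qed.

(** The triple product is reassociated and the two factors are integrated out one after the other by
    Tonelli. *)
Lemma measurable_integral_prod d1 d2 d3 (T1 : measurableType d1) (T2 : measurableType d2)
    (T3 : measurableType d3) (m : {sigma_finite_measure set T2 -> \bar R})
    (m' : {sigma_finite_measure set T3 -> \bar R}) (h : T1 * (T2 * T3) -> \bar R) :
  measurable_fun setT h -> (forall z, (0 <= h z)%E) ->
  measurable_fun setT (fun x => \int[(m \x m')%E]_y h (x, y))%E.
Proof.
move=> mh h0; pose k (z : (T1 * T2) * T3) := h (z.1.1, (z.1.2, z.2)).
have mk : measurable_fun setT k.
  apply: (measurableT_comp mh); apply: measurable_fun_pair.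
    by apply: measurableT_comp; [exact: measurable_fst|exact: measurable_fst].
  apply: measurable_fun_pair; last exact: measurable_snd.
  by apply: measurableT_comp; [exact: measurable_snd|exact: measurable_fst].
have mF := @measurable_fun_fubini_tonelli_F _ _ _ _ R m' k mk (fun z => h0 _).
have F0 z : (0 <= fubini_F m' k z)%E by apply: integral_ge0 => y _; exact: h0.
have mG := @measurable_fun_fubini_tonelli_F _ _ _ _ R m _ mF F0.
have -> // : (fun x => \int[(m \x m')%E]_y h (x, y))%E = fubini_F m (fubini_F m' k).
apply/funext => x; rewrite /fubini_F.
have mx : measurable_fun setT (fun y => h (x, y)).
  by apply: (measurableT_comp mh); exact: measurable_fun_pair.
by rewrite (@fubini_tonelli1 _ _ _ _ _ m m' _ mx).
Qed.

Lemma conv_measurable (K w : R * R -> R) : measurable_fun setT K -> measurable_fun setT w ->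
  measurable_fun setT (Defs.conv K w).
Proof.
move=> mK mw; rewrite /Defs.conv /leb2.
pose h (z : (R * R) * (R * R)) := (K (z.1.1 - z.2.1, z.1.2 - z.2.2) * w z.2)%:E.
have mh : measurable_fun setT h.
  apply: measurable_EFin; apply: measurable_funM; last exact: measurableT_comp.
  apply: (measurableT_comp mK); apply: measurable_fun_pair.
    by apply: measurable_funB; apply: measurableT_comp => //; exact: measurable_fst.
  by apply: measurable_funB; apply: measurableT_comp => //; exact: measurable_snd.
apply: measurableT_comp => //.
(* No integrability is assumed, so positive and negative parts are treated separately. *)
have -> : (fun x : R * R => \int[m2]_y (K (x.1 - y.1, x.2 - y.2) * w y)%:E)%E =
   (fun x => \int[m2]_y (h^\+ (x, y)) - \int[m2]_y (h^\- (x, y)))%E.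
  apply/funext => x; rewrite integralE.
  by congr (_ - _)%E; apply: eq_integral => y _; rewrite ?funeposE ?funenegE.
apply: emeasurable_funB.
  by apply: (@measurable_integral_prod _ _ _ _ _ _ mu mu _ (measurable_funepos mh)) => z; exact: funepos_ge0.
by apply: (@measurable_integral_prod _ _ _ _ _ _ mu mu _ (measurable_funeneg mh)) => z; exact: funeneg_ge0.
Qed.

(** [kernel_young] needs both coordinate differences nonzero; the excluded points form two null
    lines. *)
Lemma ae_neq (x : R * R) : {ae m2, forall y : R * R, x.1 != y.1 /\ x.2 != y.2}.
Proof.
have n1 : m2.-negligible ([set x.1] `*` setT).
  apply/negligibleP; first exact: measurableX.
  have z : (mu \x mu)%E ([set x.1] `*` setT) = (mu [set x.1] * mu [set: R])%E.
    by rewrite product_measure1E.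
  by rewrite lebesgue_measure_set1 mul0e in z; exact: z.
have n2 : m2.-negligible (setT `*` [set x.2]).
  apply/negligibleP; first exact: measurableX.
  have z : (mu \x mu)%E (setT `*` [set x.2]) = (mu [set: R] * mu [set x.2])%E.
    by rewrite product_measure1E.
  by rewrite lebesgue_measure_set1 mule0 in z; exact: z.
have := negligibleU n1 n2.
apply: negligibleS => y /= /not_andP[] /negP; rewrite negbK => /eqP h.
  by left; rewrite /= -h.
by right; rewrite /= -h.
Qed.

(** [kernel_young] splits the integrand into w + w^3, whose integral does not depend on x, and a
    translated product of singularities, whose integral is at most 64 for every x. *)
Lemma conv_bounded (K w : R * R -> R) (B : R) : measurable_fun setT K ->
  measurable_fun setT w -> (forall z, 0 <= w z) ->
  (forall z, exists2 c, c = `|z.1| \/ c = `|z.2| & `|K z| * (`|z.1| ^+ 2 + `|z.2| ^+ 2) <= c) ->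
  (\int[m2]_z (w z + w z ^+ 3)%:E <= B%:E)%E ->
  forall x, `|Defs.conv K w x| <= B + 64.
Proof.
move=> mK mw w0 Kc wB x; rewrite /Defs.conv /leb2.
have msh : measurable_fun setT (fun y : R * R => (x.1 - y.1, x.2 - y.2)).
  apply: measurable_fun_pair.
    by apply: measurable_funB => //; exact: measurable_fst.
  by apply: measurable_funB => //; exact: measurable_snd.
have mh : measurable_fun setT (fun y : R * R => K (x.1 - y.1, x.2 - y.2) * w y).
  by apply: measurable_funM => //; exact: (measurableT_comp mK).
have mss : measurable_fun setT (fun y : R * R => sing (x.1 - y.1) * sing (x.2 - y.2)).
  have ms (c : R) : measurable_fun setT (fun t : R => sing (c - t)).
    by apply: (measurableT_comp measurable_sing); exact: measurable_funB.
  exact: (measurable_tensor (ms x.1) (ms x.2)).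
have W0 z : 0 <= w z + w z ^+ 3 by rewrite addr_ge0 ?exprn_ge0.
have le : (`|\int[m2]_y (K (x.1 - y.1, x.2 - y.2) * w y)%:E| <= (B + 64)%:E)%E.
  apply: le_trans (le_abse_integral _ _ _) _ => //; first exact: measurable_EFin.
  have mW : measurable_fun setT (fun z => w z + w z ^+ 3).
    by apply: measurable_funD => //; exact: measurable_funX.
  apply: (@le_trans _ _ (\int[m2]_y ((w y + w y ^+ 3) + sing (x.1 - y.1) * sing (x.2 - y.2))%:E)%E).
    apply: ae_ge0_le_integral => //.
    - by apply: measurableT_comp => //; exact: measurable_EFin.
    - by move=> y _; rewrite lee_fin; apply: addr_ge0 => //; rewrite mulr_ge0 ?sing_ge0.
    - by apply: measurable_EFin; exact: measurable_funD.
    apply: ae_impl (ae_neq x) => y [n1 n2] _; rewrite abse_EFin lee_fin normrM (ger0_norm (w0 y)).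
    have [c cE] := Kc (x.1 - y.1, x.2 - y.2); rewrite /= in cE * => cle.
    have sn t : sing t = sing `|t|.
      rewrite /sing /sing_pow normr_id !indicE !mem_setE !in_itv/= -!ltr_norml.
      by rewrite normr_id.
    rewrite (sn (x.1 - y.1)) (sn (x.2 - y.2)).
    by apply: kernel_young cE cle _ _ => //; rewrite normr_gt0 subr_eq0.
  rewrite int_add//.
  - by rewrite EFinD; apply: leeD => //; exact: integral_sing2.
  - by move=> y; rewrite mulr_ge0 ?sing_ge0.
move: le; case: (\int[m2]_y _)%E => [r| |]//=.
Qed.

Lemma G_kernel_bound (z : R * R) :
  `|z.1 / (2 * pi * (z.1 ^+ 2 + z.2 ^+ 2))| * (`|z.1| ^+ 2 + `|z.2| ^+ 2) <= `|z.1| /\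
  `|z.2 / (2 * pi * (z.1 ^+ 2 + z.2 ^+ 2))| * (`|z.1| ^+ 2 + `|z.2| ^+ 2) <= `|z.2|.
Proof.
have p1 : 1 <= 2 * pi :> R by have := pi_ge2 R; lra.
have p0 : 0 < 2 * pi :> R by lra.
rewrite !real_normK ?num_real//; set S := z.1 ^+ 2 + z.2 ^+ 2.
have S0 : 0 <= S by rewrite addr_ge0 ?sqr_ge0.
have key (t : R) : `|t / (2 * pi * S)| * S <= `|t|.
  rewrite normrM normfV (ger0_norm (mulr_ge0 (ltW p0) S0)).
  (* At the origin the factor S on the left is 0, so the bound holds whatever value the kernel takes
     there. *)
  have [->|Sn] := eqVneq S 0; first by rewrite mulr0.
  have {}S0 : 0 < S by rewrite lt_neqAle eq_sym Sn.
  have -> : `|t| / (2 * pi * S) * S = `|t| / (2 * pi).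
    by field; rewrite !gt_eqF//; lra.
  by rewrite ler_pdivrMr// ler_peMr.
by split; exact: key.
Qed.

End kernel.

(** * Finiteness of the energy *)

Section sobolev.
Context {R : realType}.
Local Notation mu := (@lebesgue_measure R).
Local Notation m2 := (mu \x mu)%E.

(* As fine +oo = 0, finiteness has to be carried along with nonnegativity. *)
Definition nnint (f : R * R -> R) : Prop :=
  [/\ measurable_fun setT f, (forall z, 0 <= f z) & (\int[m2]_z (f z)%:E < +oo)%E].

Lemma nnint_fine (f : R * R -> R) : nnint f -> (\int[m2]_z (f z)%:E = (fine (int2 f))%:E)%E.
Proof. by move=> [mf f0 fo]; rewrite fineK// ge0_fin_numE// int_ge0. Qed.

Lemma nnint_fine_ge0 (f : R * R -> R) : nnint f -> 0 <= fine (int2 f).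
Proof. by move=> [mf f0 fo]; rewrite fine_ge0// int_ge0. Qed.

Lemma nnint_le (f g : R * R -> R) : measurable_fun setT f -> (forall z, 0 <= f z) ->
  (forall z, f z <= g z) -> nnint g -> nnint f.
Proof.
by move=> mf f0 fg [mg g0 go]; split => //; apply: le_lt_trans go; exact: int_le.
Qed.

Lemma nnintD (f g : R * R -> R) : nnint f -> nnint g -> nnint (fun z => f z + g z).
Proof.
move=> [mf f0 fo] [mg g0 go]; split; first exact: measurable_funD.
  by move=> z; rewrite addr_ge0.
by rewrite int_add// lte_add_pinfty.
Qed.

Lemma nnintZ (c : R) (f : R * R -> R) : 0 <= c -> nnint f -> nnint (fun z => c * f z).
Proof.
move=> c0 [mf f0 fo]; split; first exact: measurable_funM.
  by move=> z; rewrite mulr_ge0.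
by rewrite int_scale// lte_mul_pinfty.
Qed.

Lemma nnint_sqr (f : R * R -> R) : L2 f -> nnint (fun z => f z ^+ 2).
Proof.
move=> f2; split; [|by move=> z; rewrite sqr_ge0|by have [_] := f2].
by apply: measurable_funX; exact: L2_measurable f2.
Qed.

Lemma L2_nnint (f : R * R -> R) : measurable_fun setT f -> nnint (fun z => f z ^+ 2) -> L2 f.
Proof. by move=> mf [_ _ fo]; split. Qed.

Lemma fine_int_le (f : R * R -> R) (c : R) : nnint f ->
  (\int[m2]_z (f z)%:E <= c%:E)%E -> fine (int2 f) <= c.
Proof. by move=> nf; rewrite nnint_fine// lee_fin. Qed.

Lemma fine_int_mono (f g : R * R -> R) : nnint f -> nnint g -> (forall z, f z <= g z) ->
  fine (int2 f) <= fine (int2 g).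
Proof.
move=> nf ng fg; apply: fine_int_le => //; rewrite -nnint_fine//.
by case: nf => mf f0 _; case: ng => mg _ _; exact: int_le.
Qed.

Lemma fine_intD (f g : R * R -> R) : nnint f -> nnint g ->
  fine (int2 (fun z => f z + g z)) = fine (int2 f) + fine (int2 g).
Proof.
move=> nf ng; apply: EFin_inj; rewrite -nnint_fine; last exact: nnintD.
rewrite EFinD -!nnint_fine//.
by case: nf => mf f0 _; case: ng => mg g0 _; exact: int_add.
Qed.

Lemma fine_intZ (c : R) (f : R * R -> R) : 0 <= c -> nnint f ->
  fine (int2 (fun z => c * f z)) = c * fine (int2 f).
Proof.
move=> c0 nf; apply: EFin_inj; rewrite -nnint_fine; last exact: nnintZ.
rewrite EFinM -nnint_fine//.
by case: nf => mf f0 _; exact: int_scale.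
Qed.

Lemma L2D (f g : R * R -> R) : L2 f -> L2 g -> L2 (fun z => f z + g z).
Proof.
move=> f2 g2; have mfg : measurable_fun setT (fun z => f z + g z).
  by apply: measurable_funD; exact: L2_measurable.
apply: L2_nnint => //.
apply: (@nnint_le _ (fun z => 2 * (f z ^+ 2 + g z ^+ 2))).
- exact: measurable_funX.
- by move=> z; exact: sqr_ge0.
- by move=> z; have := sqr_ge0 (f z - g z); nra.
- by apply: nnintZ => //; apply: nnintD; exact: nnint_sqr.
Qed.

Lemma L2_boundedM (a f : R * R -> R) (B : R) : measurable_fun setT a ->
  (forall z, `|a z| <= B) -> L2 f -> L2 (fun z => a z * f z).
Proof.
move=> ma aB f2; have maf : measurable_fun setT (fun z => a z * f z).
  by apply: measurable_funM => //; exact: L2_measurable.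
apply: L2_nnint => //.
apply: (@nnint_le _ (fun z => B ^+ 2 * f z ^+ 2)).
- exact: measurable_funX.
- by move=> z; exact: sqr_ge0.
- move=> z; rewrite exprMn ler_wpM2r ?sqr_ge0// -[leLHS]real_normK ?num_real//.
  by rewrite lerXn2r ?nnegrE// (le_trans _ (aB z)).
- by apply: nnintZ; [exact: sqr_ge0|exact: nnint_sqr].
Qed.

Lemma L2B (f g : R * R -> R) : L2 f -> L2 g -> L2 (fun z => f z - g z).
Proof.
move=> f2 g2; have -> : (fun z => f z - g z) = (fun z => f z + (-1) * g z).
  by apply/funext => z; rewrite mulN1r.
by apply: L2D => //; apply: (@L2_boundedM _ _ 1) => // z; rewrite normrN normr1.
Qed.

Lemma wdP (e : R * R) (f : R * R -> R) : (exists g, weak_deriv e f g /\ L2 g) ->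
  weak_deriv e f (wd e f) /\ L2 (wd e f).
Proof. exact: ClassicalEpsilon.epsilon_spec. Qed.

Lemma H1r_wd (f : R * R -> R) : H1r f ->
  [/\ L2 f, weak_deriv (e1 R) f (wd (e1 R) f), L2 (wd (e1 R) f),
      weak_deriv (e2 R) f (wd (e2 R) f) & L2 (wd (e2 R) f)].
Proof. by move=> [f2 [/wdP[? ?] /wdP[? ?]]]. Qed.

Lemma H1_re (u : cfun R) : H1 u -> H1r (re u).
Proof. by case. Qed.

Lemma H1_im (u : cfun R) : H1 u -> H1r (im u).
Proof. by case. Qed.

Lemma H1_nnint_abs2 (u : cfun R) : H1 u -> nnint (abs2 u).
Proof.
by move=> [[f1 _] [f2 _]]; apply: (nnintD (nnint_sqr f1) (nnint_sqr f2)).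
Qed.

Lemma abs2_ge0 (u : cfun R) z : 0 <= abs2 u z.
Proof. by rewrite addr_ge0// sqr_ge0. Qed.

Lemma mass_ge0 (u : cfun R) : 0 <= mass u.
Proof. by rewrite fine_ge0// int_ge0// => z; exact: abs2_ge0. Qed.

Lemma H1_measurable_abs2 (u : cfun R) : H1 u -> measurable_fun setT (abs2 u).
Proof. by move=> /H1_nnint_abs2[]. Qed.

Lemma H1norm2_nnint (u : cfun R) : H1 u ->
  nnint (fun x => abs2 u x + wd (e1 R) (re u) x ^+ 2 + wd (e2 R) (re u) x ^+ 2
                         + wd (e1 R) (im u) x ^+ 2 + wd (e2 R) (im u) x ^+ 2).
Proof.
move=> hu; have [_ _ g1 _ g2] := H1r_wd (H1_re hu); have [_ _ k1 _ k2] := H1r_wd (H1_im hu).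
by do 4![apply: nnintD; last exact: nnint_sqr]; exact: H1_nnint_abs2.
Qed.

Lemma H1norm2_ge0 (u : cfun R) : H1 u -> 0 <= H1norm2 u.
Proof. by move=> /H1norm2_nnint; exact: nnint_fine_ge0. Qed.

Lemma expr_addn_le (a b : R) (n : nat) : 0 <= a -> 0 <= b ->
  (a + b) ^+ n <= 2 ^+ n * (a ^+ n + b ^+ n).
Proof.
move=> a0 b0; wlog ab : a b a0 b0 / a <= b.
  move=> H; have [|/ltW] := leP a b; first exact: H.
  by move=> ?; rewrite addrC (addrC (a ^+ n)); exact: H.
apply: (@le_trans _ _ ((2 * b) ^+ n)).
  by rewrite lerXn2r ?nnegrE ?addr_ge0 ?mulr_ge0//; lra.
by rewrite exprMn ler_wpM2l ?exprn_ge0// lerDr exprn_ge0.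
Qed.

Lemma sum_sqr_le (a b c d e f : R) :
  a ^+ 2 + c ^+ 2 + d ^+ 2 <= a ^+ 2 + b ^+ 2 + c ^+ 2 + d ^+ 2 + e ^+ 2 + f ^+ 2 /\
  b ^+ 2 + e ^+ 2 + f ^+ 2 <= a ^+ 2 + b ^+ 2 + c ^+ 2 + d ^+ 2 + e ^+ 2 + f ^+ 2.
Proof.
have := sqr_ge0 a; have := sqr_ge0 b; have := sqr_ge0 c; have := sqr_ge0 d.
by have := sqr_ge0 e; have := sqr_ge0 f; split; lra.
Qed.

Lemma H1_abs2_pow (n : nat) : exists2 C : R, 0 < C & exists m : nat,
  forall u : cfun R, H1 u ->
  (\int[m2]_z (abs2 u z ^+ n.+1)%:E <= (C * (H1norm2 u * (1 + H1norm2 u) ^+ m))%:E)%E.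
Proof.
have [C C0 [m H]] := @H1_power_bound R n.
exists (2 ^+ n.+1 * (C + C)); first by rewrite mulr_gt0 ?exprn_gt0// addr_gt0.
exists m => u hu; set s := H1norm2 u.
have s0 : 0 <= s by exact: H1norm2_ge0.
have [f2 wg1 g1 wg2 g2] := H1r_wd (H1_re hu); have [h2 wk1 k1 wk2 k2] := H1r_wd (H1_im hu).
have sE : (\int[m2]_x (abs2 u x + wd (e1 R) (re u) x ^+ 2 + wd (e2 R) (re u) x ^+ 2
                 + wd (e1 R) (im u) x ^+ 2 + wd (e2 R) (im u) x ^+ 2)%:E = s%:E)%E.
  exact: nnint_fine (H1norm2_nnint hu).
have [mN N0 _] := H1norm2_nnint hu.
have sr : (\int[m2]_z (re u z ^+ 2 + wd (e1 R) (re u) z ^+ 2 + wd (e2 R) (re u) z ^+ 2)%:E <= s%:E)%E.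
  rewrite -sE; apply: int_le => //.
  - by apply: measurable_funD; [apply: measurable_funD|]; apply: measurable_funX; exact: L2_measurable.
  - by move=> z; rewrite !addr_ge0 ?sqr_ge0.
  - by move=> z; exact: (sum_sqr_le _ _ _ _ _ _).1.
have si : (\int[m2]_z (im u z ^+ 2 + wd (e1 R) (im u) z ^+ 2 + wd (e2 R) (im u) z ^+ 2)%:E <= s%:E)%E.
  rewrite -sE; apply: int_le => //.
  - by apply: measurable_funD; [apply: measurable_funD|]; apply: measurable_funX; exact: L2_measurable.
  - by move=> z; rewrite !addr_ge0 ?sqr_ge0.
  - by move=> z; exact: (sum_sqr_le _ _ _ _ _ _).2.
have br := H _ _ _ _ s0 f2 g1 g2 wg1 wg2 sr.
have bi := H _ _ _ _ s0 h2 k1 k2 wk1 wk2 si.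
have mr : measurable_fun setT (fun z => re u z ^+ (2 * n.+1)).
  by apply: measurable_funX; exact: L2_measurable f2.
have mi : measurable_fun setT (fun z => im u z ^+ (2 * n.+1)).
  by apply: measurable_funX; exact: L2_measurable h2.
have ev (x : R) : 0 <= x ^+ (2 * n.+1) by rewrite exprM exprn_ge0// sqr_ge0.
apply: (@le_trans _ _ (\int[m2]_z (2 ^+ n.+1 * (re u z ^+ (2 * n.+1) + im u z ^+ (2 * n.+1)))%:E)%E).
  apply: int_le.
  - by apply: measurable_funX; exact: H1_measurable_abs2.
  - by apply: measurable_funM => //; exact: measurable_funD.
  - by move=> z; rewrite exprn_ge0// abs2_ge0.
  - by move=> z; rewrite !exprM; apply: expr_addn_le; exact: sqr_ge0.
rewrite int_scale; last 3 first.
- exact: exprn_ge0.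
- exact: measurable_funD.
- by move=> z; rewrite addr_ge0.
rewrite int_add// -!mulrA EFinM lee_wpmul2l ?lee_fin ?exprn_ge0//.
by rewrite mulrDl EFinD leeD.
Qed.

Lemma H1_pow_nnint (u : cfun R) (n : nat) : H1 u -> nnint (fun z => abs2 u z ^+ n.+1).
Proof.
move=> hu; have [C C0 [m H]] := H1_abs2_pow n; split.
- by apply: measurable_funX; exact: H1_measurable_abs2.
- by move=> z; rewrite exprn_ge0// abs2_ge0.
- by apply: le_lt_trans (H u hu) _; rewrite ltry.
Qed.

Lemma measurable_G1 : measurable_fun setT (@G1 R).
Proof.
apply: measurableT_comp => //; apply: measurable_funM; first exact: measurable_fst.
apply: measurable_inv_ge0; last first.
  by move=> z; rewrite !mulr_ge0 ?pi_ge0// addr_ge0 ?sqr_ge0.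
apply: measurable_funM => //; apply: measurable_funD; apply: measurable_funX.
  exact: measurable_fst.
exact: measurable_snd.
Qed.

Lemma measurable_G2 : measurable_fun setT (@G2 R).
Proof.
apply: measurableT_comp => //; apply: measurable_funM; first exact: measurable_snd.
apply: measurable_inv_ge0; last first.
  by move=> z; rewrite !mulr_ge0 ?pi_ge0// addr_ge0 ?sqr_ge0.
apply: measurable_funM => //; apply: measurable_funD; apply: measurable_funX.
  exact: measurable_fst.
exact: measurable_snd.
Qed.

Lemma measurable_A1 (u : cfun R) : H1 u -> measurable_fun setT (A1 u).
Proof.
move=> hu; apply: measurable_funM => //; apply: conv_measurable; first exact: measurable_G2.
exact: H1_measurable_abs2.
Qed.

Lemma measurable_A2 (u : cfun R) : H1 u -> measurable_fun setT (A2 u).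
Proof.
move=> hu; apply: measurable_funM => //; apply: conv_measurable; first exact: measurable_G1.
exact: H1_measurable_abs2.
Qed.

(** The cubic term of [conv_bounded] is |u|^6, which is integrable on H^1. The bound may depend on
    u: it only serves to make D_j u square integrable. *)
Lemma A_bounded (u : cfun R) : H1 u ->
  exists B : R, (forall z, `|A1 u z| <= B) /\ (forall z, `|A2 u z| <= B).
Proof.
move=> hu; have ni : nnint (fun z => abs2 u z + abs2 u z ^+ 3).
  by apply: nnintD; [exact: H1_nnint_abs2|exact: H1_pow_nnint].
pose B := fine (int2 (fun z => abs2 u z + abs2 u z ^+ 3)).
have le : (\int[m2]_z (abs2 u z + abs2 u z ^+ 3)%:E <= B%:E)%E by rewrite nnint_fine.
exists (B + 64).
have half (x : R) : `|x| <= B + 64 -> `|1 / 2 * x| <= B + 64 /\ `|- (1 / 2) * x| <= B + 64.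
  move=> xB; rewrite mulNr normrN; split; rewrite normrM ger0_norm; have := normr_ge0 x; lra.
split => z.
  apply: (half _ _).2; apply: conv_bounded => //.
  - exact: measurable_G2.
  - exact: H1_measurable_abs2.
  - by move=> y; exact: abs2_ge0.
  - by move=> y; exists `|y.2|; [right|rewrite normrN; exact: (G_kernel_bound y).2].
apply: (half _ _).1; apply: conv_bounded => //.
- exact: measurable_G1.
- exact: H1_measurable_abs2.
- by move=> y; exact: abs2_ge0.
- by move=> y; exists `|y.1|; [left|rewrite normrN; exact: (G_kernel_bound y).1].
Qed.

Lemma nnint_D1 (u : cfun R) : H1 u -> nnint (abs2 (D1 u)).
Proof.
move=> hu; have [B [AB _]] := A_bounded hu.
have [f2 _ g1 _ _] := H1r_wd (H1_re hu); have [h2 _ k1 _ _] := H1r_wd (H1_im hu).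
have mA := measurable_A1 hu.
by apply: nnintD; apply: nnint_sqr; [apply: L2B|apply: L2D] => //; exact: L2_boundedM AB _.
Qed.

Lemma nnint_D2 (u : cfun R) : H1 u -> nnint (abs2 (D2 u)).
Proof.
move=> hu; have [B [_ AB]] := A_bounded hu.
have [f2 _ _ _ g1] := H1r_wd (H1_re hu); have [h2 _ _ _ k1] := H1r_wd (H1_im hu).
have mA := measurable_A2 hu.
by apply: nnintD; apply: nnint_sqr; [apply: L2B|apply: L2D] => //; exact: L2_boundedM AB _.
Qed.

Lemma kinE (u : cfun R) : H1 u ->
  kin u = fine (int2 (abs2 (D1 u))) + fine (int2 (abs2 (D2 u))).
Proof. by move=> hu; apply: fine_intD; [exact: nnint_D1|exact: nnint_D2]. Qed.

Lemma kin_ge0 (u : cfun R) : 0 <= kin u.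
Proof. by rewrite fine_ge0// int_ge0// => z; rewrite addr_ge0 ?abs2_ge0. Qed.

Lemma sqrt_addn_le (a b : R) : 0 <= a -> 0 <= b ->
  Num.sqrt a + Num.sqrt b <= 1 + (a + b).
Proof.
move=> a0 b0; rewrite -{2}(sqr_sqrtr a0) -{2}(sqr_sqrtr b0).
have := sqr_ge0 (Num.sqrt a - 2^-1); have := sqr_ge0 (Num.sqrt b - 2^-1); nra.
Qed.

Lemma Dnorm_le (u : cfun R) : H1 u -> Dnorm u <= 1 + kin u.
Proof.
move=> hu; rewrite kinE// /Dnorm.
have K1 := nnint_fine_ge0 (nnint_D1 hu); have K2 := nnint_fine_ge0 (nnint_D2 hu).
exact: sqrt_addn_le.
Qed.

(** M is a positive upper bound rather than the mass, which may be 0, because the weight in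
    [magnetic_L4] divides by it. *)
Lemma H1_L4 (u : cfun R) (M : R) : H1 u -> 0 < M -> mass u <= M ->
  fine (int2 (fun z => abs2 u z ^+ 2)) <= 4 * M * (kin u + 1).
Proof.
move=> hu M0 uM; apply: fine_int_le; first exact: H1_pow_nnint.
have [f2 wg1 g1 wg2 g2] := H1r_wd (H1_re hu); have [h2 wk1 k1 wk2 k2] := H1r_wd (H1_im hu).
apply: (@magnetic_L4 R (re u) (im u) _ _ _ _ (A1 u) (A2 u) M (kin u)
  f2 h2 g1 k1 g2 k2 (measurable_A1 hu) (measurable_A2 hu) wg1 wk1 wg2 wk2 M0 (kin_ge0 u)).
- by rewrite (nnint_fine (H1_nnint_abs2 hu)) lee_fin.
- by rewrite (nnint_fine (nnintD (nnint_D1 hu) (nnint_D2 hu))).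
Qed.

End sobolev.

(** * Continuity of the Lebesgue norms *)

Section lp_continuity.
Context {R : realType}.
Local Notation mu := (@lebesgue_measure R).
Local Notation m2 := (mu \x mu)%E.

(** An open set is the countable union of the boxes with rational centre and half-width 1/(n+1) that
    it contains; the other boxes are replaced by the empty set to keep the index countable. *)
Lemma open_measurable_prod (U : set (R * R)) : open U -> measurable U.
Proof.
move=> oU; pose d (n : nat) : R := n.+1%:R^-1.
have d0 n : 0 < d n by rewrite invr_gt0.
pose box (i : rat * rat * nat) : set (R * R) :=
  `]ratr i.1.1 - d i.2, ratr i.1.1 + d i.2[%classic `*`
  `]ratr i.1.2 - d i.2, ratr i.1.2 + d i.2[%classic.
pose F i := if `[< box i `<=` U >] then box i else set0.
have -> : U = \bigcup_i F i.
  apply/seteqP; split => [z Uz|z [i _]]; last first.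
    by rewrite /F; case: ifPn => // /asboolP; apply.
  have [e /= e0 eU] : exists2 e : R, 0 < e & ball z e `<=` U.
    by have := oU; rewrite openE => /(_ z Uz) /nbhs_ballP[e /= e0 eU]; exists e.
  (* The rational centre is within d n of z and the box has half-width d n, so its points are within
     2 d n < e of z. *)
  have e20 : 0 < e / 2 by rewrite divr_gt0.
  have [n _ Hn] := near_infty_natSinv_lt (PosNum e20).
  have dn : d n < e / 2 := Hn n (leqnn n).
  have [q /itvP q1] : exists q, ratr q \in `]z.1 - d n, z.1 + d n[.
    by apply: rat_in_itvoo; have := d0 n; lra.
  have [r /itvP r1] : exists q, ratr q \in `]z.2 - d n, z.2 + d n[.
    by apply: rat_in_itvoo; have := d0 n; lra.
  have q2 : z.1 - d n < ratr q by rewrite q1.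
  have q3 : ratr q < z.1 + d n by rewrite q1.
  have r2 : z.2 - d n < ratr r by rewrite r1.
  have r3 : ratr r < z.2 + d n by rewrite r1.
  have bz : box (q, r, n) z by split; rewrite /= in_itv/=; apply/andP; split; lra.
  exists (q, r, n) => //; rewrite /F; case: ifPn => // /asboolPn; case => y [/= y1 y2].
  apply: eU; move: y1 y2; rewrite !in_itv/= => /andP[a1 a2] /andP[b1 b2].
  by split => /=; rewrite /ball/= ltr_norml; apply/andP; split; lra.
apply: countable_bigcupT_measurable; first exact: countableP.
move=> i; rewrite /F; case: ifP => _ //.
by apply: measurableX; exact: measurable_itv.
Qed.

Lemma continuous_measurable_prod (f : R * R -> R) : continuous f -> measurable_fun setT f.
Proof.
move=> cf; apply: (measurability _ (RGenOInfty.measurableE R)).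
move=> _ [_ [a ->]] <-; rewrite setTI; apply: open_measurable_prod.
by apply: open_comp => // x _; exact: cf.
Qed.

Lemma continuous_compact_support_L2 (f : R * R -> R) (r : R) : continuous f ->
  (forall x : R * R, r < `|x.1| + `|x.2| -> f x = 0) -> L2 f.
Proof.
move=> cf f0; have mf := continuous_measurable_prod cf.
have cK : compact (`[- r, r]%classic `*` `[- r, r]%classic : set (R * R)).
  by apply: compact_setX; exact: segment_compact.
have [M [_ HM]] : bounded_set (f @` (`[- r, r]%classic `*` `[- r, r]%classic)).
  by apply: compact_bounded; apply: continuous_compact cK; exact: continuous_subspaceT.
have out (z : R * R) : r < `|z.1| \/ r < `|z.2| -> f z = 0.
  by case=> h; apply: f0; apply: lt_le_trans h _; rewrite ?lerDl ?lerDr.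
apply: (@box_L2 _ _ r (`|M + 1|)) => //.
- move=> z; have [h1|h1] := ltP r `|z.1|; first by rewrite out ?normr0//; left.
  have [h2|h2] := ltP r `|z.2|; first by rewrite out ?normr0//; right.
  apply: le_trans (ler_norm _); apply: (HM (M + 1)); first by rewrite ltrDl.
  by exists z => //; split => /=; rewrite in_itv/= -ler_norml.
- by move=> z h; apply: out; left.
- by move=> z h; apply: out; right.
Qed.

(** The outer region is open, so psi vanishes on a whole neighbourhood of x along the line. *)
Lemma pd_eq0 (e : R * R) (psi : R * R -> R) (r : R) (x : R * R) :
  (forall x : R * R, r < `|x.1| + `|x.2| -> psi x = 0) -> r < `|x.1| + `|x.2| ->
  pd e psi x = 0.
Proof.
move=> p0 rx; rewrite /pd derive1E.
have c : (`|x.1 + s * e.1| + `|x.2 + s * e.2|) @[s --> (0 : R)] --> `|x.1 + 0 * e.1| + `|x.2 + 0 * e.2|.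
  apply: cvgD; apply: cvg_norm; apply: cvgD; try exact: cvg_cst;
    by apply: cvgM; [exact: cvg_id|exact: cvg_cst].
rewrite !mul0r !addr0 in c.
have -> : 'D_1 (fun s : R => psi (x.1 + s * e.1, x.2 + s * e.2)) 0 = 'D_1 (cst (0 : R)) (0 : R).
  apply: near_eq_derive; have /(_ _) H := cvgr_gt _ c _ rx.
  by near=> s; rewrite p0//; near: s; exact: H.
exact: derive_cst.
Unshelve. all: by end_near. Qed.

Lemma testfun_L2 (psi : R * R -> R) : testfun psi ->
  [/\ L2 psi, L2 (pd (e1 R) psi) & L2 (pd (e2 R) psi)].
Proof.
move=> [_ [c [c1 [c2 [r p0]]]]]; split.
- exact: continuous_compact_support_L2 c p0.
- by apply: (continuous_compact_support_L2 (r := r)) => // x; exact: pd_eq0.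
- by apply: (continuous_compact_support_L2 (r := r)) => // x; exact: pd_eq0.
Qed.

Lemma integral_subM (f h p : R * R -> R) : L2 f -> L2 h -> L2 p ->
  (\int[m2]_z ((f z - h z) * p z)%:E = \int[m2]_z (f z * p z)%:E - \int[m2]_z (h z * p z)%:E)%E.
Proof.
move=> f2 h2 p2; rewrite -integralB//; last 2 first.
- exact: integrable_L2M.
- exact: integrable_L2M.
by apply: eq_integral => z _; rewrite mulrBl EFinB.
Qed.

(** A test function and its partial derivatives are square integrable, so all the integrals are
    finite and may be subtracted. *)
Lemma weak_derivB (e : R * R) (f h g k : R * R -> R) : e = e1 R \/ e = e2 R ->
  L2 f -> L2 h -> L2 g -> L2 k -> weak_deriv e f g -> weak_deriv e h k ->
  weak_deriv e (fun z => f z - h z) (fun z => g z - k z).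
Proof.
move=> ee f2 h2 g2 k2 fg hk psi tp; have [p0 p1 p2] := testfun_L2 tp.
have pe : L2 (pd e psi) by case: ee => ->.
rewrite /leb2 !integral_subM//.
have := fg psi tp; have := hk psi tp; rewrite /leb2 => -> ->.
have fi : (\int[m2]_z (g z * psi z)%:E)%E \is a fin_num.
  by apply: integrable_fin_num; [by []|exact: integrable_L2M].
by rewrite oppeD// fin_num_adde_defr.
Qed.

Lemma H1rB (f h : R * R -> R) : H1r f -> H1r h -> H1r (fun z => f z - h z).
Proof.
move=> hf hh; have [f2 wf1 f3 wf2 f4] := H1r_wd hf; have [h2 wh1 h3 wh2 h4] := H1r_wd hh.
split; first exact: L2B.
split; eexists; split.
- by apply: (weak_derivB _ f2 h2 f3 h3 wf1 wh1); left.
- exact: L2B.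
- by apply: (weak_derivB _ f2 h2 f4 h4 wf2 wh2); right.
- exact: L2B.
Qed.

Lemma H1_csub (u v : cfun R) : H1 u -> H1 v -> H1 (csub u v).
Proof. by move=> [u1 u2] [v1 v2]; split; exact: H1rB. Qed.

(** For |u| <= 1 the power p is below the square, and for |u| > 1 it is below the even power
    2n+2. *)
Lemma powR_sqrt_le (w p : R) (n : nat) : 0 <= w -> 2 <= p -> p <= (2 * n.+1)%:R ->
  Num.sqrt w `^ p <= w + w ^+ n.+1.
Proof.
move=> w0 p2 pn; set t := Num.sqrt w.
have t0 : 0 <= t by exact: sqrtr_ge0.
have wE : w = t ^+ 2 by rewrite sqr_sqrtr.
rewrite {}wE; have [t1|t1] := leP t 1.
  have [->|tn] := eqVneq t 0.
    by rewrite powR0 ?addr_ge0 ?exprn_ge0//; lra.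
  have tp : 0 < t <= 1 by rewrite lt_neqAle eq_sym tn t0.
  have := ger_powR tp p2; rewrite (powR_mulrn 2 t0) => /le_trans; apply.
  by rewrite lerDl !exprn_ge0.
have := ler_powR (ltW t1) pn; rewrite powR_mulrn// exprM => /le_trans; apply.
by rewrite lerDr exprn_ge0.
Qed.

Lemma exists_exponent (p : R) : exists n : nat, p <= (2 * n.+1)%:R.
Proof.
have [n pn] : exists n : nat, p <= n%:R.
  by have /archi_boundP := normr_ge0 p => /ltW h; eexists; exact: le_trans (ler_norm _) h.
by exists n; apply: le_trans pn _; rewrite ler_nat mul2n -addnn (leq_trans (leqnSn n))// leq_addr.
Qed.

Lemma measurable_sqrt_powR (u : cfun R) (p : R) : H1 u ->
  measurable_fun setT (fun z => Num.sqrt (abs2 u z) `^ p).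
Proof.
move=> hu; apply: (measurableT_comp (measurable_powR p)).
have ms : measurable_fun setT (@Num.sqrt R).
  by apply: continuous_measurable_fun; exact: sqrt_continuous.
apply: (measurableT_comp ms).
exact: H1_measurable_abs2.
Qed.

Lemma nnint_Lp (p : R) (u : cfun R) : 2 <= p -> H1 u ->
  nnint (fun z => Num.sqrt (abs2 u z) `^ p).
Proof.
move=> p2 hu; have [n pn] := exists_exponent p.
apply: (@nnint_le _ _ (fun z => abs2 u z + abs2 u z ^+ n.+1)).
- exact: measurable_sqrt_powR.
- by move=> z; exact: powR_ge0.
- by move=> z; apply: powR_sqrt_le => //; exact: abs2_ge0.
- by apply: nnintD; [exact: H1_nnint_abs2|exact: H1_pow_nnint].
Qed.

Lemma Lp_ge0 (p : R) (u : cfun R) : 0 <= Lp p u.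
Proof. by rewrite fine_ge0// int_ge0// => z; exact: powR_ge0. Qed.

(** For H^1 norm squared s < 1 the factors (1+s)^m are at most 2^m, so the polynomial bounds become
    linear in s. *)
Lemma Lp_small (p eps : R) : 2 <= p -> 0 < eps -> exists2 delta : R, 0 < delta &
  forall u : cfun R, H1 u -> H1norm2 u < delta -> Lp p u < eps.
Proof.
move=> p2 e0; have [n pn] := exists_exponent p.
have [C C0 [m H]] := @H1_abs2_pow R 0; have [D D0 [l K]] := @H1_abs2_pow R n.
pose B := C * 2 ^+ m + D * 2 ^+ l.
have B0 : 0 < B by rewrite addr_gt0// mulr_gt0// exprn_gt0.
exists (Num.min 1 (eps / B)); first by rewrite lt_min ltr01 divr_gt0.
move=> u hu; rewrite lt_min => /andP[s1 sB]; set s := H1norm2 u in s1 sB.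
have s0 : 0 <= s by exact: H1norm2_ge0.
have n1 := H1_nnint_abs2 hu; have n2 := H1_pow_nnint n hu.
have bd (c : R) (k : nat) : 0 < c -> c * (s * (1 + s) ^+ k) <= c * 2 ^+ k * s.
  move=> c0; rewrite -mulrA ler_wpM2l ?(ltW c0)// mulrC ler_wpM2r//.
  by rewrite lerXn2r ?nnegrE; lra.
have le1 : mass u <= C * 2 ^+ m * s.
  by apply: le_trans (bd _ _ C0); apply: fine_int_le => //; exact: H.
have le2 : fine (int2 (fun z => abs2 u z ^+ n.+1)) <= D * 2 ^+ l * s.
  by apply: le_trans (bd _ _ D0); apply: fine_int_le => //; exact: K.
apply: (@le_lt_trans _ _ (B * s)); last by rewrite mulrC -ltr_pdivlMr.
apply: (@le_trans _ _ (fine (int2 (fun z => abs2 u z + abs2 u z ^+ n.+1)))).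
  apply: fine_int_mono; [exact: nnint_Lp|exact: nnintD|].
  by move=> z; apply: powR_sqrt_le => //; exact: abs2_ge0.
by rewrite fine_intD// /B mulrDl lerD.
Qed.

(** Either d <= delta b, and after division by b continuity of s^p at s = 1 applies, or b < d /
    delta, and both powers are multiples of d^p. *)
Lemma powR_dist (p eps : R) : 0 < p -> 0 < eps -> exists2 C : R, 0 < C &
  forall a b d : R, 0 <= a -> 0 <= b -> `|a - b| <= d ->
    `|a `^ p - b `^ p| <= eps * b `^ p + C * d `^ p.
Proof.
move=> p0 e0.
have c1 : {for 1, continuous (fun s : R => s `^ p)}.
  apply: differentiable_continuous; apply/derivable1_diffP.
  by apply: derivable_powR; rewrite in_itv/= ltr01.
have [delta d0 Hd] : exists2 delta : R, 0 < delta &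
    forall s : R, `|s - 1| <= delta -> `|s `^ p - 1| <= eps.
  have /cvgrPdist_le/(_ _ e0)/nbhs_ballP[delta/= d0 H] := c1.
  exists (delta / 2); first by rewrite divr_gt0.
  move=> s s1; have := H s; rewrite powR1 distrC; apply.
  by rewrite /ball/= distrC; apply: le_lt_trans s1 _; rewrite gtr_pMr// invf_lt1// ltr1n.
(* In the second case b <= d / delta and a <= b + d, so k d dominates both. *)
pose k := delta^-1 + 1.
have k0 : 0 < k by rewrite addr_gt0// invr_gt0.
exists (2 * k `^ p); first by rewrite mulr_gt0// powR_gt0.
move=> a b d a0 b0 abd; have dd : 0 <= d by apply: le_trans abd.
have [db|bd] := leP d (delta * b).
  apply: ler_wpDr; first by rewrite !mulr_ge0 ?powR_ge0.
  have [bz|bn] := eqVneq b 0.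
    have d00 : d <= 0 by move: db; rewrite bz mulr0.
    have az : a = 0.
      by apply/eqP; rewrite -normr_eq0 eq_le normr_ge0 andbT; move: abd; rewrite bz subr0 => /le_trans; apply.
    by rewrite az bz subrr normr0 mulr_ge0 ?powR_ge0// ltW.
  have b1 : 0 < b by rewrite lt_neqAle eq_sym bn.
  have aE : a = a / b * b by rewrite divfK.
  rewrite {1}aE powRM//; last by rewrite divr_ge0.
  rewrite -[X in _ - X]mul1r -mulrBl normrM (ger0_norm (powR_ge0 _ _)) ler_wpM2r ?powR_ge0//.
  apply: Hd; have -> : a / b - 1 = (a - b) / b by rewrite mulrBl divff.
  rewrite normrM normfV (gtr0_norm b1) ler_pdivrMr//.
  exact: le_trans abd db.
have bk : b <= k * d.
  rewrite /k mulrDl mul1r; apply: ler_wpDr => //.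
  by rewrite mulrC ler_pdivlMr// mulrC ltW.
have ak : a <= k * d.
  have h1 : b <= delta^-1 * d by rewrite mulrC ler_pdivlMr// mulrC ltW.
  rewrite /k mulrDl mul1r; have := ler_norm (a - b); lra.
have kd : 0 <= k * d by rewrite mulr_ge0// ltW.
have pa : a `^ p <= k `^ p * d `^ p.
  by rewrite -powRM ?(ltW k0)//; apply: ge0_ler_powR; rewrite ?nnegrE ?(ltW p0).
have pb : b `^ p <= k `^ p * d `^ p.
  by rewrite -powRM ?(ltW k0)//; apply: ge0_ler_powR; rewrite ?nnegrE ?(ltW p0).
have A0 := powR_ge0 a p; have B0 := powR_ge0 b p.
have EB : 0 <= eps * b `^ p by rewrite mulr_ge0// ltW.
rewrite -mulrA ler_norml; apply/andP; split; lra.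
Qed.

Lemma sqrt_sqr_addD (a b x y : R) :
  Num.sqrt ((a + x) ^+ 2 + (b + y) ^+ 2) <=
  Num.sqrt (a ^+ 2 + b ^+ 2) + Num.sqrt (x ^+ 2 + y ^+ 2).
Proof.
set Y := Num.sqrt (a ^+ 2 + b ^+ 2); set Z := Num.sqrt (x ^+ 2 + y ^+ 2).
have Y0 : 0 <= Y by exact: sqrtr_ge0.
have Z0 : 0 <= Z by exact: sqrtr_ge0.
have YE : Y ^+ 2 = a ^+ 2 + b ^+ 2 by rewrite sqr_sqrtr// addr_ge0 ?sqr_ge0.
have ZE : Z ^+ 2 = x ^+ 2 + y ^+ 2 by rewrite sqr_sqrtr// addr_ge0 ?sqr_ge0.
have cs : a * x + b * y <= Y * Z.
  have YZ0 : 0 <= Y * Z by exact: mulr_ge0.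
  apply: le_trans (ler_norm _) _.
  have := @ler_pXn2r R 2 isT `|a * x + b * y| (Y * Z); rewrite !nnegrE => /(_ (normr_ge0 _) YZ0) <-.
  rewrite real_normK ?num_real// exprMn YE ZE; have := sqr_ge0 (a * y - b * x); nra.
have -> : Y + Z = Num.sqrt ((Y + Z) ^+ 2) by rewrite sqrtr_sqr ger0_norm// addr_ge0.
rewrite ler_wsqrtr// [leRHS]sqrrD YE ZE; nra.
Qed.

Lemma sqrt_sqr_dist (a b c d : R) :
  `|Num.sqrt (a ^+ 2 + b ^+ 2) - Num.sqrt (c ^+ 2 + d ^+ 2)| <=
  Num.sqrt ((a - c) ^+ 2 + (b - d) ^+ 2).
Proof.
have h1 := sqrt_sqr_addD c d (a - c) (b - d).
have h2 := sqrt_sqr_addD a b (c - a) (d - b).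
have E (x y : R) : x + (y - x) = y by ring.
have D (x y : R) : (x - y) ^+ 2 = (y - x) ^+ 2 by ring.
rewrite !E (D c) (D d) in h2; rewrite !E in h1.
move: h1 h2; move: (Num.sqrt _) (Num.sqrt _) (Num.sqrt _) => x y z h1 h2.
rewrite ler_norml; apply/andP; split; lra.
Qed.

Lemma sqrt_abs2_dist (u v : cfun R) z :
  `|Num.sqrt (abs2 u z) - Num.sqrt (abs2 v z)| <= Num.sqrt (abs2 (csub u v) z).
Proof. exact: sqrt_sqr_dist. Qed.

Lemma dist_le (x y z : R) : x <= y + z -> y <= x + z -> `|x - y| <= z.
Proof. by move=> h1 h2; rewrite ler_norml; apply/andP; split; lra. Qed.

(** Integrating [powR_dist] pointwise takes the place of Minkowski's inequality and compares the
    integrals of the p-th powers directly. *)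
Lemma Lp_dist (p eps : R) : 2 <= p -> 0 < eps -> exists2 C : R, 0 < C &
  forall u v : cfun R, H1 u -> H1 v ->
    `|Lp p u - Lp p v| <= eps * Lp p v + C * Lp p (csub u v).
Proof.
move=> p2 e0; have p0 : 0 < p by lra.
have [C C0 HC] := powR_dist p0 e0; exists C => // u v hu hv.
have nu := nnint_Lp p2 hu; have nv := nnint_Lp p2 hv.
have nw := nnint_Lp p2 (H1_csub hu hv).
have e0' := ltW e0; have C0' := ltW C0.
have nr := nnintD (nnintZ e0' nv) (nnintZ C0' nw).
have rE : fine (int2 (fun z => eps * Num.sqrt (abs2 v z) `^ p +
    C * Num.sqrt (abs2 (csub u v) z) `^ p)) = eps * Lp p v + C * Lp p (csub u v).
  rewrite fine_intD; [|exact: nnintZ|exact: nnintZ].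
  by congr (_ + _); [exact: (fine_intZ e0' nv)|exact: (fine_intZ C0' nw)].
have pw z := HC _ _ _ (sqrtr_ge0 (abs2 u z)) (sqrtr_ge0 (abs2 v z)) (sqrt_abs2_dist u v z).
have le1 : Lp p u <= Lp p v + (eps * Lp p v + C * Lp p (csub u v)).
  rewrite -rE -fine_intD//; apply: fine_int_mono => //; first exact: nnintD.
  by move=> z; have := pw z; rewrite ler_norml => /andP[_]; rewrite lerBlDl.
have le2 : Lp p v <= Lp p u + (eps * Lp p v + C * Lp p (csub u v)).
  rewrite -rE -fine_intD//; apply: fine_int_mono => //; first exact: nnintD.
  by move=> z; have := pw z; rewrite ler_norml => /andP[h _]; move: h; rewrite lerNl opprB lerBlDl.
exact: dist_le le1 le2.
Qed.

Lemma cont_H1_Lp (p : R) (phi : R -> cfun R) (T : \bar R) : 2 <= p ->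
  (forall t, 0 <= t -> (t%:E < T)%E -> H1 (phi t)) -> cont_H1 phi T ->
  forall t, 0 <= t -> (t%:E < T)%E -> forall eps, 0 < eps ->
  exists2 delta, 0 < delta & forall s, 0 <= s -> (s%:E < T)%E -> `|s - t| < delta ->
    `|Lp p (phi s) - Lp p (phi t)| < eps.
Proof.
move=> p2 hphi cphi t t0 tT eps e0.
have L0 := Lp_ge0 p (phi t).
have L1 : 0 < Lp p (phi t) + 1 by lra.
(* The 1 added to the norm guards against a zero denominator. *)
have e1 : 0 < eps / 2 / (Lp p (phi t) + 1) by rewrite !divr_gt0.
have [C C0 HC] := Lp_dist p2 e1.
have e2 : 0 < eps / 2 / C by rewrite !divr_gt0.
have [d d0 Hd] := Lp_small p2 e2.
have [delta de0 Hdelta] := cphi t t0 tT d d0.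
exists delta => // s s0 sT st.
have hs := hphi s s0 sT; have ht := hphi t t0 tT.
apply: le_lt_trans (HC _ _ hs ht) _.
have := Hd _ (H1_csub hs ht) (Hdelta s s0 sT st).
have := L0; have := L1; move: (Lp p (phi t)) (Lp p (csub _ _)) => L w L1' L0'.
rewrite ltr_pdivlMr// [w * C]mulrC => h.
have h2 : eps / 2 / (L + 1) * L <= eps / 2.
  by rewrite mulrAC ler_pdivrMr// ler_wpM2l//; lra.
move: h h2; move: (_ * L) (C * w) => x y; lra.
Qed.

End lp_continuity.

(** * Global existence *)

Section global_existence.
Context {R : realType}.

Lemma powR_interp (p eps : R) : 2 < p -> p < 4 -> 0 < eps -> exists2 C : R, 0 <= C &
  forall w : R, 0 <= w -> Num.sqrt w `^ p <= eps * w ^+ 2 + C * w.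
Proof.
(* K is the threshold with K^(p-4) = eps: above it t^p = t^4 t^(p-4) <= eps t^4, below it t^p <=
   K^(p-2) t^2. *)
move=> p2 p4 e0; pose K := eps `^ (p - 4)^-1.
have K0 : 0 < K by exact: powR_gt0.
have p40 : p - 4 != 0 by rewrite lt_eqF//; lra.
have KE : K `^ (4 - p) = eps^-1.
  rewrite -powRrM -[4 - p]opprB mulrN mulVf// powRN powRr1//.
  exact: ltW.
exists (K `^ (p - 2)); first exact: powR_ge0.
move=> w w0; set t := Num.sqrt w.
have t0 : 0 <= t by exact: sqrtr_ge0.
have wE : w = t ^+ 2 by rewrite sqr_sqrtr.
have [tz|tn] := eqVneq t 0.
  by rewrite wE tz powR0 ?addr_ge0 ?mulr_ge0 ?exprn_ge0 ?powR_ge0 ?(ltW e0)//; lra.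
have tpos : 0 < t by rewrite lt_neqAle eq_sym tn.
have [tK|Kt] := leP t K.
  have -> : t `^ p = t `^ (p - 2) * w.
    rewrite wE -(powR_mulrn 2 t0) -powRD; last by rewrite tn implybT.
    by rewrite subrK.
  apply: ler_wpDl; first by rewrite mulr_ge0 ?exprn_ge0// ltW.
  rewrite ler_wpM2r//; apply: ge0_ler_powR; rewrite ?nnegrE ?(ltW K0)//; lra.
apply: ler_wpDr; first by rewrite mulr_ge0 ?powR_ge0.
have -> : w ^+ 2 = t `^ p * t `^ (4 - p).
  rewrite wE -exprM -(powR_mulrn 4 t0) -powRD; last by rewrite tn implybT.
  by rewrite addrC subrK.
rewrite mulrCA ler_peMr ?powR_ge0//.
rewrite -[leLHS](mulfV (lt0r_neq0 e0)) ler_wpM2l ?(ltW e0)// -KE.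
by apply: ge0_ler_powR; rewrite ?nnegrE ?(ltW K0) ?(ltW Kt)//; lra.
Qed.

Lemma Lp_interp (p eps : R) : 2 < p -> p < 4 -> 0 < eps -> exists2 C : R, 0 <= C &
  forall u : cfun R, H1 u ->
    Lp p u <= eps * fine (int2 (fun z => abs2 u z ^+ 2)) + C * mass u.
Proof.
move=> p2 p4 e0; have [C C0 HC] := powR_interp p2 p4 e0; exists C => // u hu.
have n1 := H1_nnint_abs2 hu; have n2 := H1_pow_nnint 1 hu; have e0' := ltW e0.
have <- : fine (int2 (fun z => eps * abs2 u z ^+ 2)) = eps * fine (int2 (fun z => abs2 u z ^+ 2)).
  exact: fine_intZ.
have <- : fine (int2 (fun z => C * abs2 u z)) = C * mass u by exact: fine_intZ.
rewrite -fine_intD; [|exact: nnintZ|exact: nnintZ].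
apply: fine_int_mono.
- by apply: nnint_Lp => //; exact: ltW.
- by apply: nnintD; exact: nnintZ.
- by move=> z; apply: HC; exact: abs2_ge0.
Qed.

Lemma Lp4E (u : cfun R) : Lp 4 u = fine (int2 (fun z => abs2 u z ^+ 2)).
Proof.
congr (fine (int2 _)); apply/funext => z.
by rewrite (powR_mulrn 4) ?sqrtr_ge0// (exprM _ 2 2) sqr_sqrtr// abs2_ge0.
Qed.

Lemma kin_bounded_global (phi : R -> cfun R) (T : \bar R) (B : R) : (0%:E < T)%E ->
  (forall t, 0 <= t -> (t%:E < T)%E -> H1 (phi t)) ->
  (forall t, 0 <= t -> (t%:E < T)%E -> kin (phi t) <= B) ->
  (T = +oo%E \/ exists2 T0 : R, T = T0%:E & Dnorm (phi t) @[t --> T0^'-] --> +oo) ->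
  T = +oo%E.
Proof.
move=> T0 hphi kB [//|[T1 TE D]]; exfalso; rewrite TE lte_fin in T0.
have H := (cvgryPgt _).1 D (1 + B).
near T1^'- => t.
have t0 : 0 <= t by near: t; exact: nbhs_left_ge.
have tT : (t%:E < T)%E by rewrite TE lte_fin; near: t; exact: nbhs_left_lt.
have : 1 + B < Dnorm (phi t) by near: t; exact: H.
have := Dnorm_le (hphi t t0 tT); have := kB t t0 tT.
by move=> h1 h2; rewrite ltNge (le_trans h2)// lerD2l.
Unshelve. all: by end_near. Qed.

Lemma energyE (lam p : R) (u : cfun R) : kin u = 2 * (energy lam p u + lam / p * Lp p u).
Proof. by rewrite /energy subrK mulrC divfK. Qed.

(** The energy identity doubles a, so a coefficient 1/4 leaves half of k on the left. *)
Lemma kin_absorb (a b k E : R) : k = 2 * (E + a) -> a <= 4^-1 * (k + 1) + b ->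
  k <= 4 * E + 1 + 4 * b.
Proof. lra. Qed.

Lemma QfE (lam p : R) (u : cfun R) : p != 0 ->
  Qf lam p u = 2 * energy lam p u - lam * (p - 4) / p * Lp p u.
Proof.
by move=> p0; rewrite /Qf /energy; move: (kin u) (Lp p u) => k l; field.
Qed.

(** 2 (p-2) E - (p-4) kin = 2 Q: this combination eliminates the remaining part of the L^p term. *)
Lemma Qf_gt0_kin (lam p : R) (u : cfun R) : 4 < p -> 0 < Qf lam p u ->
  kin u <= 2 * (p - 2) / (p - 4) * energy lam p u.
Proof.
move=> p4; have p0 : p != 0 by rewrite gt_eqF//; lra.
have p40 : 0 < p - 4 by lra.
rewrite /Qf /energy; move: (kin u) (Lp p u) => k l Q.
rewrite mulrAC ler_pdivlMr// -subr_ge0.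
have -> : 2 * (p - 2) * (k / 2 - lam / p * l) - k * (p - 4) =
  2 * (k - lam * (p - 2) / p * l) by field.
by rewrite mulr_ge0// ltW.
Qed.

Lemma max0_sub_le (x y d : R) : x - y <= d -> 0 <= d -> Num.max 0 x - Num.max 0 y <= d.
Proof. by move=> h1 h2; case: (leP 0 x) => ?; case: (leP 0 y) => ?; lra. Qed.

Lemma min_sub_le (x y a d : R) : x - y <= d -> 0 <= d -> Num.min x a - Num.min y a <= d.
Proof. by move=> h1 h2; case: (leP x a) => ?; case: (leP y a) => ?; lra. Qed.

Lemma clamp_dist (a s t : R) :
  `|Num.max 0 (Num.min s a) - Num.max 0 (Num.min t a)| <= `|s - t|.
Proof.
rewrite ler_norml lerNl opprB; apply/andP; split;
  apply: max0_sub_le => //; apply: min_sub_le => //; last exact: ler_norm.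
by rewrite distrC; exact: ler_norm.
Qed.

Lemma Qf_pos_invariant (lam p c : R) (phi : R -> cfun R) (T : \bar R) : 2 <= p ->
  (forall t, 0 <= t -> (t%:E < T)%E -> H1 (phi t)) -> cont_H1 phi T ->
  (forall t, 0 <= t -> (t%:E < T)%E ->
     mass (phi t) = mass (phi 0) /\ energy lam p (phi t) = energy lam p (phi 0)) ->
  Oc lam p c (phi 0) ->
  forall t, 0 <= t -> (t%:E < T)%E -> 0 < Qf lam p (phi t).
Proof.
move=> p2 hphi cphi cons [[h0 mc] [Eg Q0]] a a0 aT; rewrite ltNge; apply/negP => Qa.
have p0 : p != 0 by rewrite gt_eqF// (lt_le_trans _ p2).
(* Clamping time to [0, a] gives a function continuous on the whole line, although the flow is
   controlled only on [0, T). *)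
pose cl (t : R) := Num.max 0 (Num.min t a).
have cl0 t : 0 <= cl t by rewrite le_max lexx.
have cla t : cl t <= a by rewrite ge_max a0 ge_min lexx orbT.
have clT t : ((cl t)%:E < T)%E by apply: le_lt_trans aT; rewrite lee_fin.
have clE t : 0 <= t -> t <= a -> cl t = t.
  by move=> t0 ta; rewrite /cl (min_idPl ta) (max_idPr t0).
pose f (t : R) := 2 * energy lam p (phi 0) - lam * (p - 4) / p * Lp p (phi (cl t)).
have fE t : 0 <= t -> t <= a -> f t = Qf lam p (phi t).
  move=> t0 ta; have tT : (t%:E < T)%E by apply: le_lt_trans aT; rewrite lee_fin.
  by rewrite (QfE lam (phi t) p0) (cons t t0 tT).2 /f (clE t t0 ta).
have cL : continuous (fun t => Lp p (phi (cl t))).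
  move=> t; apply/cvgrPdist_lt => e e0.
  have [d d0 H] := cont_H1_Lp p2 hphi cphi (cl0 t) (clT t) e0.
  apply/nbhs_ballP; exists d => // s; rewrite /ball/= => ts.
  rewrite distrC; apply: H => //.
  by apply: le_lt_trans (clamp_dist _ _ _) _; rewrite distrC.
have cf : continuous f.
  move=> t; apply: cvgB; first exact: cvg_cst.
  by apply: cvgM; [exact: cvg_cst|exact: cL].
have [t] : exists2 t, t \in `[0, a] & f t = 0.
  apply: IVT => //; first exact: continuous_subspaceT.
  have fa : f a <= 0 by rewrite (fE a a0 (lexx a)).
  have f0 : 0 <= f 0 by rewrite (fE 0 (lexx 0) a0) ltW.
  by clearbody f; rewrite ge_min le_max fa f0 orbT.
rewrite in_itv/= => /andP[t0 ta]; rewrite fE// => Qt.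
have tT : (t%:E < T)%E by apply: le_lt_trans aT; rewrite lee_fin.
have [mt Et] := cons t t0 tT.
(* At the zero of Q, conserved mass puts the solution in M(c), while conserved energy is still below
   the infimum. *)
have : (gammac lam p c <= (energy lam p (phi t))%:E)%E.
  apply: ereal_inf_lbound; exists (phi t); last by [].
  by split; [split; [exact: (hphi t t0 tT)|rewrite mt; exact: mc]|exact: Qt].
by rewrite Et leNgt Eg.
Qed.

End global_existence.

Theorem theorem1p7 (R : realType) (lam p : R) :
  0 < lam -> 2 < p ->
  exists2 c0 : R, 0 < c0 &
  forall (phi0 : cfun R) (phi : R -> cfun R) (T : \bar R),
    H1 phi0 ->
    (* properties of the maximal H^1 solution given by the local theory *)
    (0%:E < T)%E ->
    phi 0 = phi0 ->
    (forall t, 0 <= t -> (t%:E < T)%E -> H1 (phi t)) ->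
    cont_H1 phi T ->
    (forall t, 0 <= t -> (t%:E < T)%E ->
       mass (phi t) = mass phi0 /\ energy lam p (phi t) = energy lam p phi0) ->
    (T = +oo%E \/ exists2 T0 : R, T = T0%:E &
        Dnorm (phi t) @[t --> T0^'-] --> +oo) ->
    (* hypotheses (a), (b), (c) *)
    (p < 4 \/
     (p = 4 /\ Num.sqrt (mass phi0) < c0) \/
     (4 < p /\ exists2 c : R, 0 < c & Oc lam p c phi0)) ->
    T = +oo%E.
Proof.
move=> lam0 p2; have p0 : 0 < p by lra.
(* For p = 4 the potential term is at most (lam/4) 4 M (kin + 1), which is (kin + 1) / 4 for this M,
   as [kin_absorb] requires. *)
pose M : R := (4 * lam)^-1; have M0 : 0 < M by rewrite invr_gt0 mulr_gt0.
exists (Num.sqrt M); first by rewrite sqrtr_gt0.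
move=> phi0 phi T _ T0 <- hphi cphi cons blow hyp.
suff [B kB] : exists B, forall t, 0 <= t -> (t%:E < T)%E -> kin (phi t) <= B.
  exact: kin_bounded_global kB blow.
case: hyp => [p4|[[p4 small]|[p4 [c _ oc]]]].
- pose N := mass (phi 0) + 1.
  (* Adding 1 to the mass makes N positive even for zero data. *)
  have N0 : 0 < N by rewrite ltr_wpDl// mass_ge0.
  (* Chosen so that (lam/p) eps 4 N = 1/4, the coefficient in [kin_absorb]. *)
  pose eps := p / (16 * lam * N).
  have e0 : 0 < eps by rewrite divr_gt0// !mulr_gt0.
  have [C C0 HC] := Lp_interp p2 p4 e0.
  exists (4 * energy lam p (phi 0) + 1 + 4 * (lam / p * (C * mass (phi 0)))) => t t0 tT.
  have [mt Et] := cons t t0 tT; have ht := hphi t t0 tT.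
  have kE := energyE lam p (phi t); rewrite Et in kE; apply: (kin_absorb kE).
  have mN : mass (phi t) <= N by rewrite mt lerDl.
  have h4 := H1_L4 ht N0 mN.
  have lp0 : 0 < lam / p by rewrite divr_gt0.
  apply: (@le_trans _ _ (lam / p * (eps * (4 * N * (kin (phi t) + 1)) + C * mass (phi 0)))).
    rewrite (ler_pM2l lp0); apply: le_trans (HC _ ht) _.
    by rewrite mt lerD2r (ler_pM2l e0).
  rewrite mulrDr lerD2r /eps le_eqVlt; apply/orP; left; apply/eqP.
  by move: (kin _) => k; field; rewrite !gt_eqF.
- have mM : mass (phi 0) <= M.
    by move: small; rewrite ltr_sqrt// => /ltW.
  exists (4 * energy lam p (phi 0) + 1 + 4 * 0) => t t0 tT.
  have [mt Et] := cons t t0 tT; have ht := hphi t t0 tT.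
  have kE := energyE lam p (phi t); rewrite Et in kE; apply: (kin_absorb kE).
  rewrite -mt in mM; have h4 := H1_L4 ht M0 mM.
  rewrite addr0 p4 Lp4E.
  apply: (@le_trans _ _ (lam / 4 * (4 * M * (kin (phi t) + 1)))).
    have l4 : 0 < lam / 4 by rewrite divr_gt0.
    by rewrite (ler_pM2l l4); exact: h4.
  rewrite le_eqVlt; apply/orP; left; apply/eqP; rewrite /M.
  by move: (kin _) => k; field; rewrite gt_eqF.
- exists (2 * (p - 2) / (p - 4) * energy lam p (phi 0)) => t t0 tT.
  have [_ Et] := cons t t0 tT; rewrite -Et.
  exact: (Qf_gt0_kin p4 (Qf_pos_invariant (ltW p2) hphi cphi cons oc t0 tT)).
Qed.
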